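(* Let $G$ be a compact Lie group acting smoothly on a compact manifold $M$ and trivially on $\mathbb{T}$, let $\lambda_G$ be a $G$-equivariant complex line bundle on $M$ with structure cocycle $h\in H^1(\Gamma,\underline{\mathbb{T}})$, let $\mathbf{PF}_G$ be the associated $G$-equivariant projective Fock bundle over $\mathbb{T}\times M$, and let $\alpha\in H^1(\Gamma,\mathbb{Z})$, $\beta_G\in H^2(\Gamma,\mathbb{Z})$ be the classes defined in the context. Then the Dixmier-Douady class $f\in H^2(\Gamma,\underline{\mathbb{T}})$ of the equivariant gerbe $\mathbf{PF}_G$ maps to the cup product class $\alpha\smile\beta_G$ under the group isomorphism $H^2(\Gamma,\underline{\mathbb{T}})\to H^3(\Gamma,\mathbb{Z})$ induced by the standard exact sequence $\mathbb{Z}\xrightarrow{2\pi i}i\mathbb{R}\xrightarrow{\exp}\mathbb{T}$.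
   Context: Standing assumption: there is a $G$-invariant open cover $\{V_i:1\le i\le n\}$ of $M$ such that $H^k(V_{i_1}\cap\dots\cap V_{i_l},\underline{\mathbb{T}})=0$ for all $k\ge1$ and all $l\ge1$. For small $\epsilon>0$ put $\mathbb{T}_+=\{e^{i\phi}:\phi\in(-\epsilon,\pi+\epsilon)\}$, $\mathbb{T}_-=\{e^{i\phi}:\phi\in(\pi-\epsilon,2\pi+\epsilon)\}$, with $\mathbb{T}_+\cap\mathbb{T}_-=\mathbb{T}_{+-}^{(1)}\sqcup\mathbb{T}_{+-}^{(-1)}$ (arcs around $1$ and $-1$), and $U_i=\mathbb{T}_+\times V_i$, $U_{i+n}=\mathbb{T}_-\times V_i$, $1\le i\le n$. The upper index $(\pm1)$ indicates the component over $\mathbb{T}_{+-}^{(\pm1)}$. $\Gamma$ is the Lie groupoid $\coprod_{ij}G\times U_{ij}\rightrightarrows\coprod_iU_i$ with $s(g,x_{ij})=x_j$, $t(g,x_{ij})=(gx)_i$, $(g,(hx)_{ij})(h,x_{jk})=(gh,x_{ik})$; it is Morita equivalent to $G\ltimes(\mathbb{T}\times M)$. For an abelian sheaf $A$ on manifolds, $H^*(\Gamma,A)$ is groupoid sheaf cohomology: the total cohomology of the double complex obtained from injective (or acyclic Čech) resolutions of the sheaves on the manifolds $\Gamma^{(p)}$ of composable $p$-tuples of arrows, with horizontal differential $\partial^*=\sum_i(-1)^i\partial_i^*$ induced by the face maps $\partial_i:\Gamma^{(p)}\to\Gamma^{(p-1)}$. Since the groupoid is compact (hence proper), the connecting maps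 $H^k(\Gamma,\underline{\mathbb{T}})\to H^{k+1}(\Gamma,\mathbb{Z})$, $k=1,2$, of the exponential sequence are isomorphisms. The cup product is that of groupoid cohomology. $\lambda_G$ is described by smooth functions $h_{ij}:G\times V_{ij}\to\mathbb{T}$ with $h_{ij}(a,bx)h_{jk}(b,x)=h_{ik}(ab,x)$, pulled back to $\Gamma$ along the projection forgetting $\mathbb{T}$ (so $h_{i,j+n}=h_{i+n,j}=h_{i+n,j+n}=h_{ij}$). $\beta_G\in H^2(\Gamma,\mathbb{Z})$ is the image of $h$ under $H^1(\Gamma,\underline{\mathbb{T}})\to H^2(\Gamma,\mathbb{Z})$. $\alpha\in H^1(\Gamma,\mathbb{Z})$ is the groupoid cocycle with nonzero components $\alpha^{(1)}_{i,j+n}(a,x)=1$, $\alpha^{(1)}_{i+n,j}(a,x)=-1$, $1\le i,j\le n$. Fock space: $\mathcal{H}=\mathcal{H}^+\oplus\mathcal{H}^-$ is a polarized Hilbert space with orthonormal bases $\{u_i:i\ge0\}$, $\{u_i:i<0\}$; the CAR algebra is generated by $a(f)$ (antilinear in $f$) with $\{a(u),a(v)\}=0$, $\{a(u),a(v)^*\}=\langle u,v\rangle\mathbf{1}$; $\mathcal{F}$ is its irreducible representation with vacuum $|0\rangle$, $a(u)|0\rangle=0=a^*(v)|0\rangle$ for $u\in\mathcal{H}^+$, $v\in\mathcal{H}^-$. The charge operator $N$ has eigenvalue $l-k$ on $a(u_{i_1})\cdots a(u_{i_k})a^*(u_{j_1})\cdots a^*(u_{j_l})|0\rangle$ ($i_x<0\le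 j_y$). $S$ is the projective unitary shift with $S|0\rangle=a^*(u_0)|0\rangle$, $Sa(u_k)S^{-1}=a(u_{k+1})$, likewise for $a^*$; $SN=(N-1)S$. $\mathbf{PF}_G$ is given by the cocycle $g_{ij}:G\times U_{ij}\to PU(\mathcal{F})$ with, for $1\le i,j\le n$: $g_{ij}=h_{ij}^N$, $g_{i+n,j+n}=h_{i+n,j+n}^N$, $g^{(-1)}_{i,j+n}=h_{i,j+n}^N$, $g^{(-1)}_{j+n,i}=h_{j+n,i}^N$, $g^{(1)}_{i,j+n}=h_{i,j+n}^NS$, $g^{(1)}_{j+n,i}=S^{-1}h_{j+n,i}^N$. Its Dixmier-Douady class is the class in $H^2(\Gamma,\underline{\mathbb{T}})$ of $f_{ijk}(a,bx,b,x)=\hat g_{ij}(a,bx)\hat g_{jk}(b,x)(\hat g_{ik}(ab,x))^{-1}$, with $\hat g$ the unitary lifts given by the same formulas. *)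

(* Defs.v *)
From HB Require Import structures.
From mathcomp Require Import all_boot all_order all_algebra sesquilinear.
From mathcomp Require Import all_classical reals topology normedtype.
From mathcomp Require Import derive trigo complex.
Set Implicit Arguments.
Unset Strict Implicit.
Unset Printing Implicit Defensive.
Import Order.TTheory GRing.Theory Num.Theory.
Import numFieldNormedType.Exports.
Local Open Scope classical_set_scope.
Local Open Scope ring_scope.

(** * Smooth manifolds *)

Section CalculusDefs.
Context {R : realType} {E F : normedModType R}.

(* [Ck k W f], for an open subset W of a finite-dimensional space E. *)
Fixpoint Ck (k : nat) (W : set E) (f : E -> F) : Prop :=
  if k is k'.+1 then
    (forall x, W x -> differentiable f x) /\
    (forall v, Ck k' W (fun x => 'D_v f x))
  else forall x, W x -> {for x, continuous f}.

Definition smooth_on (W : set E) (f : E -> F) := forall k, Ck k W f.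

End CalculusDefs.

(* A chart is a partial homeomorphism [cmap] from the open set [cdom] onto the
   open set [ccod] of R^d, with inverse [cinv]; the values of [cmap] and [cinv]
   outside these sets are irrelevant. *)
Record chart (R : realType) (X : topologicalType) (d : nat) := Chart {
  cdom : set X;
  ccod : set 'rV[R]_d;
  cmap : X -> 'rV[R]_d;
  cinv : 'rV[R]_d -> X }.

Definition is_chart (R : realType) (X : topologicalType) (d : nat)
    (c : chart R X d) : Prop :=
  [/\ open (cdom c) /\ open (ccod c),
      forall x, cdom c x -> ccod c (cmap c x) /\ cinv c (cmap c x) = x,
      forall t, ccod c t -> cdom c (cinv c t) /\ cmap c (cinv c t) = t,
      forall x, cdom c x -> {for x, continuous (cmap c)} &
      forall t, ccod c t -> {for t, continuous (cinv c)}].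

(* A charted space carries an atlas without any requirement; manifolds are
   singled out by [is_manifold]. *)
Record chartedSpace (R : realType) := ChartedSpace {
  carrier :> topologicalType;
  dim : nat;
  atlas : set (chart R carrier dim) }.

Definition is_manifold (R : realType) (X : chartedSpace R) : Prop :=
  [/\ hausdorff_space X, second_countable (T := X),
      forall c : chart R X (dim X), atlas c -> is_chart c,
      forall x : X, exists2 c : chart R X (dim X), atlas c & cdom c x &
      forall c c' : chart R X (dim X), atlas c -> atlas c' ->
        smooth_on (ccod c `&` cinv c @^-1` cdom c') (cmap c' \o cinv c)].

Definition smooth_map_at (R : realType) (X Y : chartedSpace R)
    (f : X -> Y) (x : X) : Prop :=
  exists (c : chart R X (dim X)) (c' : chart R Y (dim Y)) W,
    [/\ atlas c /\ atlas c', cdom c x, open W /\ W (cmap c x),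
        (forall t, W t -> ccod c t /\ cdom c' (f (cinv c t))) &
        smooth_on W (cmap c' \o f \o cinv c)].

Definition smooth_map (R : realType) (X Y : chartedSpace R) (f : X -> Y) :=
  forall x, smooth_map_at f x.

(* f is smooth on some neighbourhood of x *)
Definition smooth_fun_at (R : realType) (X : chartedSpace R)
    (f : X -> R) (x : X) : Prop :=
  exists (c : chart R X (dim X)) W,
    [/\ atlas c, cdom c x, open W /\ W (cmap c x), W `<=` ccod c &
        smooth_on W (f \o cinv c : _ -> R^o)].

Definition prod_chart (R : realType) (X Y : chartedSpace R)
    (c : chart R X (dim X)) (c' : chart R Y (dim Y)) :
    chart R (X * Y)%type (dim X + dim Y) :=
  Chart (cdom c `*` cdom c')
    [set t | ccod c (lsubmx t) /\ ccod c' (rsubmx t)]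
    (fun xy => row_mx (cmap c xy.1) (cmap c' xy.2))
    (fun t => (cinv c (lsubmx t), cinv c' (rsubmx t))).

Definition prod_space (R : realType) (X Y : chartedSpace R) : chartedSpace R :=
  ChartedSpace [set e : chart R (X * Y)%type (dim X + dim Y) |
    exists c c', [/\ atlas c, atlas c' & e = prod_chart c c']].

Definition discrete_space (R : realType) (T : choiceType) : chartedSpace R :=
  ChartedSpace [set c : chart R (discrete_topology T) 0 | is_chart c].

Fixpoint pow_space (R : realType) (X : chartedSpace R) (p : nat) :
    chartedSpace R :=
  if p is p'.+1 then prod_space X (pow_space X p') else discrete_space R unit.

Definition is_lie_group (R : realType) (G : chartedSpace R)
    (mul : G -> G -> G) (one : G) (inv : G -> G) : Prop :=
  [/\ is_manifold G,
      associative mul, left_id one mul /\ left_inverse one inv mul,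
      smooth_map (fun ab : prod_space G G => mul ab.1 ab.2 : G) &
      smooth_map inv].

Definition is_smooth_action (R : realType) (G M : chartedSpace R)
    (mul : G -> G -> G) (one : G) (act : G -> M -> M) : Prop :=
  [/\ forall x, act one x = x,
      forall a b x, act (mul a b) x = act a (act b x) &
      smooth_map (fun gx : prod_space G M => act gx.1 gx.2 : M)].

(** * The circle *)

(* The group law of the circle is written additively, as it serves as a
   coefficient group: [u + v] in [circle R] is the product of u and v. *)
Section Circle.
Context {R : realType}.

Definition circle := {z : R[i] | `|z| == 1}.

HB.instance Definition _ := Choice.on circle.

Fact circle_mul_subproof (u v : circle) : `|val u * val v| == 1.
Proof. by rewrite normrM (eqP (valP u)) (eqP (valP v)) mulr1. Qed.
Fact circle_inv_subproof (u : circle) : `|(val u)^-1| == 1.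
Proof. by rewrite normfV (eqP (valP u)) invr1. Qed.
Fact circle_one_subproof : `|1 : R[i]| == 1.
Proof. by rewrite normr1. Qed.

Definition circle_mul (u v : circle) : circle :=
  exist _ (val u * val v) (circle_mul_subproof u v).
Definition circle_inv (u : circle) : circle :=
  exist _ (val u)^-1 (circle_inv_subproof u).
Definition circle_one : circle := exist _ 1 circle_one_subproof.

Fact circle_mulA : associative circle_mul.
Proof. by move=> u v w; apply/val_inj; rewrite /= mulrA. Qed.
Fact circle_mulC : commutative circle_mul.
Proof. by move=> u v; apply/val_inj; rewrite /= mulrC. Qed.
Fact circle_mul1 : left_id circle_one circle_mul.
Proof. by move=> u; apply/val_inj; rewrite /= mul1r. Qed.
Fact circle_mulV : left_inverse circle_one circle_inv circle_mul.
Proof.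
move=> u; apply/val_inj; rewrite /= mulVf //.
by rewrite -normr_eq0 (eqP (valP u)) oner_eq0.
Qed.

HB.instance Definition _ := GRing.isZmodule.Build circle
  circle_mulA circle_mulC circle_mul1 circle_mulV.

Definition circle_coord (u : circle) : R * R :=
  (complex.Re (val u), complex.Im (val u)).

HB.instance Definition _ :=
  Topological.copy circle (initial_topology circle_coord).

Fact expi_subproof (t : R) : `|Complex (cos t) (sin t)| == 1.
Proof. by rewrite normc_def /= cos2Dsin2 sqrtr1. Qed.

Definition expi (t : R) : circle :=
  exist _ (Complex (cos t) (sin t)) (expi_subproof t).

(* The charts are all the partial inverses of t |-> e^{it}. *)
Definition circle_space : chartedSpace R :=
  ChartedSpace [set c : chart R circle 1 |
    is_chart c /\ forall t, ccod c t -> cinv c t = expi (t 0 0)].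

End Circle.
Arguments circle R : clear implicits.
Arguments circle_space R : clear implicits.

(** * Sheaf cohomology *)

(* An abelian sheaf on manifolds, consisting of functions with values in an
   abelian group: [is_section phi x] means that phi is a section of the sheaf
   on some neighbourhood of x. *)
Record coeff (R : realType) := Coeff {
  cgroup :> zmodType;
  is_section : forall X : chartedSpace R, (X -> cgroup) -> X -> Prop }.

Definition sheafZ (R : realType) : coeff R :=
  @Coeff R int (fun X phi x => \forall y \near x, phi y = phi x).
Definition sheafR (R : realType) : coeff R :=
  @Coeff R R (fun X phi x => smooth_fun_at phi x).
Definition sheafT (R : realType) : coeff R :=
  @Coeff R (circle R) (fun X phi x =>
    smooth_fun_at (fun y => complex.Re (val (phi y))) x /\
    smooth_fun_at (fun y => complex.Im (val (phi y))) x).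

Definition sgn (V : zmodType) (k : nat) (v : V) : V := if odd k then - v else v.

(* Cohomology is computed with the canonical flasque resolution of Godement,
   which is functorial, so that it may be used on all the manifolds of
   composable arrows of a groupoid simultaneously.  Its degree q term F^q A is
   C^0 iterated q+1 times on A, where C^0 B (D) is the product of the stalks
   B_x, x in D.  Thus a section s of F^q A over D gives a germ s(x0,...,xq) in
   A_{xq} for every x0 in D, every x1 close to x0, every x2 close to x1 (how
   close may depend on x0 and x1), etc.; two such s are identified when they
   agree for every x0 in D, every x1 close to x0, etc.  The differential is
     (d s)(x0,...,x_{q+1}) = sum_i (-1)^i s(x0,..,x_{i-1},x_{i+1},..,x_{q+1}),
   all terms being regarded as germs at x_{q+1}.
   A germ is represented by a function defined on the whole space, and s by a
   function of the list [:: x0; ...; xq]. *)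
Section Godement.
Context {R : realType} (A : coeff R) {X : chartedSpace R}.

Definition gcochain := seq X -> X -> A.

(* for all x1 close to x, x2 close to x1, ..., xq close to x_{q-1}, the
   property P holds of the list [:: x; x1; ...; xq] and of its last point *)
Fixpoint iter_near (q : nat) (P : seq X -> X -> Prop) (x : X) : Prop :=
  if q is q'.+1
  then \forall y \near x, iter_near q' (fun l z => P (x :: l) z) y
  else P [:: x] x.

Definition gsection (D : set X) (q : nat) (s : gcochain) : Prop :=
  forall x, D x -> iter_near q (fun l z => is_section (s l) z) x.

Definition geq (D : set X) (q : nat) (s t : gcochain) : Prop :=
  forall x, D x ->
    iter_near q (fun l z => \forall y \near z, s l y = t l y) x.

Definition gdiff (s : gcochain) : gcochain := fun l x =>
  if (size l <= 1)%N then 0 else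
  \sum_(i < size l) sgn i (s (take i l ++ drop i.+1 l) x).

(* H^k(D, A) = 0 for all k >= 1, for D an open subset of X *)
Definition acyclic (D : set X) : Prop :=
  forall (k : nat) (s : gcochain),
    gsection D k.+1 s -> geq D k.+2 (gdiff s) (fun _ _ => 0) ->
    exists2 t, gsection D k t & geq D k.+1 s (gdiff t).

End Godement.
Arguments gcochain {R} A X.

(** * Cohomology of a groupoid *)

(* The manifolds of composable p-tuples of arrows, p >= 0, each one given as an
   open subset [gdom p] of a manifold [gspace p], and the face maps
   [gface p i], 0 <= i <= p+1. *)
Record nerve (R : realType) := Nerve {
  gspace : nat -> chartedSpace R;
  gdom : forall p, set (gspace p);
  gface : forall p, nat -> gspace p.+1 -> gspace p }.

Section GroupoidCohomology.
Context {R : realType} (Gam : nerve R).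

(* A cochain of total degree n has components c_p in K^{p,n-p}, for p <= n,
   where K^{p,q} = F^q A (Gam^(p)); the components with p > n are ignored. *)
Definition cochain (A : coeff R) := forall p, gcochain A (gspace Gam p).

Definition tsection A n (c : cochain A) : Prop :=
  forall p, (p <= n)%N -> gsection (@gdom _ Gam p) (n - p) (c p).

Definition teq A n (c c' : cochain A) : Prop :=
  forall p, (p <= n)%N -> geq (@gdom _ Gam p) (n - p) (c p) (c' p).

(* the horizontal differential sum_i (-1)^i (face i)^* *)
Definition hdiff A (c : cochain A) : cochain A := fun p =>
  match p return gcochain A (gspace Gam p) with
  | 0 => fun _ _ => 0
  | p'.+1 => fun l x =>
      \sum_(i < p'.+2) sgn i (c p' (map (gface i) l) (gface i x))
  end.

(* D = horizontal + (-1)^p vertical *)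
Definition tdiff A (c : cochain A) : cochain A := fun p l x =>
  hdiff c l x + sgn p (gdiff (c p) l x).

Definition cocycle A n (c : cochain A) : Prop :=
  tsection n c /\ teq n.+1 (tdiff c) (fun _ _ _ => 0).

Definition cohomologous A n (c c' : cochain A) : Prop :=
  if n is m.+1
  then exists2 b : cochain A,
         tsection m b & teq n (fun p l x => c p l x - c' p l x) (tdiff b)
  else teq n c c'.

(* the cohomology class of the n-cocycle c, as a coset *)
Definition cclass A n (c : cochain A) : set (cochain A) :=
  [set c' | cocycle n c' /\ cohomologous n c' c].

(* the set of elements of H^n(Gam, A) *)
Definition cohomology A n : set (set (cochain A)) :=
  [set X | exists2 c, cocycle n c & X = cclass n c].

(* global sections over Gam^(1) and Gam^(2), as elements of K^{1,0}, K^{2,0} *)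
Definition cochain1 (A : coeff R) (u : gspace Gam 1 -> A) : cochain A :=
  fun p => match p return gcochain A (gspace Gam p) with
           | 1 => fun _ => u | _ => fun _ _ => 0 end.
Definition cochain2 (A : coeff R) (u : gspace Gam 2 -> A) : cochain A :=
  fun p => match p return gcochain A (gspace Gam p) with
           | 2 => fun _ => u | _ => fun _ _ => 0 end.

(* The exponential sequence Z -> iR -> T, with iR identified with R through
   t |-> i t: its maps are k |-> 2 pi k and t |-> e^{it}. *)
Definition cochainZR (c : cochain (sheafZ R)) : cochain (sheafR R) :=
  fun p l x => (c p l x)%:~R * (2 * pi).
Definition cochainRT (r : cochain (sheafR R)) : cochain (sheafT R) :=
  fun p l x => expi (r p l x).

(* the connecting map H^n(Gam, T) -> H^{n+1}(Gam, Z): lift a representative to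
   a real cochain r and express D r as 2 pi times an integral cocycle.  The set
   of all the integral cocycles so obtained from a class is again a class. *)
Definition connecting n (X : set (cochain (sheafT R))) :
    set (cochain (sheafZ R)) :=
  [set c | cocycle n.+1 c /\
     exists r : cochain (sheafR R),
       [/\ tsection n r, X (cochainRT r) & teq n.+1 (tdiff r) (cochainZR c)]].

(* pullbacks of the component k of c to Gam^(p), k <= p, along the maps
   (g1,...,gp) |-> (g1,...,gk) and (g1,...,gp) |-> (g_{p-k+1},...,gp) *)
Fixpoint front A (c : cochain A) (k p : nat) : gcochain A (gspace Gam p) :=
  if p == k then c p else
  match p return gcochain A (gspace Gam p) with
  | 0 => fun _ _ => 0
  | p'.+1 => fun l x =>
      front c k (map (gface p'.+1) l) (gface p'.+1 x)
  end.
Fixpoint back A (c : cochain A) (k p : nat) : gcochain A (gspace Gam p) :=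
  if p == k then c p else
  match p return gcochain A (gspace Gam p) with
  | 0 => fun _ _ => 0
  | p'.+1 => fun l x => back c k (map (gface 0) l) (gface 0 x)
  end.

(* The cup product of cochains of degrees m and n: the product of a in K^{k,r}
   and b in K^{k',r'} is (-1)^{r k'} times the Alexander-Whitney product in
   both the groupoid and the Godement directions. *)
Definition tcup m n (a b : cochain (sheafZ R)) : cochain (sheafZ R) :=
  fun p l x =>
  \sum_(k < p.+1 | (k <= m)%N && (p - k <= n)%N)
    sgn ((m - k) * (p - k))
      (front a k (take (m - k).+1 l) x * back b (p - k) (drop (m - k) l) x).

Definition cup m n (X Y : set (cochain (sheafZ R))) : set (cochain (sheafZ R)) :=
  [set c | exists a b, [/\ X a, Y b & cclass (m + n) (tcup m n a b) c]].

End GroupoidCohomology.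
Arguments cohomology {R} Gam A n.

(** * The groupoid Gamma *)

Section EquivariantData.
Context {R : realType} {G M : chartedSpace R}.
Context (mul : G -> G -> G) (act : G -> M -> M) (n : nat) (V : 'I_n -> set M).

Definition is_invariant_open_cover : Prop :=
  [/\ forall i, open (V i), forall x, exists i, V i x &
      forall i g x, V i x -> V i (act g x)].

(* H^k(V_{i_1} cap ... cap V_{i_l}, T) = 0 for all k >= 1 and l >= 1 *)
Definition has_acyclic_intersections : Prop :=
  forall l (i : 'I_l.+1 -> 'I_n),
    acyclic (sheafT R) [set x : M | forall m, V (i m) x].

(* the structure functions h_{ij} : G x V_{ij} -> T of a G-equivariant line
   bundle over M; the values of h i j outside G x V_{ij} are irrelevant *)
Definition is_line_bundle_cocycle
    (h : 'I_n -> 'I_n -> G -> M -> circle R) : Prop :=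
  (forall i j g x, V i x -> V j x ->
     @is_section R (sheafT R) (prod_space G M)
       (fun gx => h i j gx.1 gx.2) (g, x)) /\
  (forall i j k a b x, V i x -> V j x -> V k x ->
     val (h i j a (act b x)) * val (h j k b x) = val (h i k (mul a b) x)).

End EquivariantData.

Section Gamma.
Context {R : realType} (eps : R).

Definition Tplus : set (circle R) := expi @` `]- eps, pi + eps[.
Definition Tminus : set (circle R) := expi @` `]pi - eps, 2 * pi + eps[.
(* the component around 1 of the intersection of Tplus and Tminus *)
Definition Tone : set (circle R) := expi @` `]- eps, eps[.

Context (G M : chartedSpace R) (mul : G -> G -> G) (act : G -> M -> M).
Context (n : nat) (V : 'I_n -> set M).

(* (false, i) and (true, i) stand for the indices i and i + n *)
Definition cover_index := (bool * 'I_n)%type.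

Definition TM := prod_space (circle_space R) M.

Definition Ucover (j : cover_index) : set TM :=
  [set zx | (if j.1 then Tminus zx.1 else Tplus zx.1) /\ V j.2 zx.2].

(* A composable p-tuple of arrows
     (g1, (g2...gp y)_{i0 i1}), (g2, (g3...gp y)_{i1 i2}), ..., (gp, y_{i(p-1) ip})
   is given by ((i0,...,ip), ((g1,...,gp), y)), where y lies in all the sets
   U_{i0}, ..., U_{ip} (which are G-invariant); the disjoint union of the
   manifolds G^p x U_{i0...ip} is an open subset of the following manifold,
   in which the set of indices is discrete. *)
Definition gamma_space (p : nat) : chartedSpace R :=
  prod_space (pow_space (discrete_space R cover_index) p.+1)
             (prod_space (pow_space G p) TM).

Fixpoint all_pow (X : chartedSpace R) (P : X -> Prop) (p : nat) :
    pow_space X p -> Prop :=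
  match p return pow_space X p -> Prop with
  | 0 => fun _ => True
  | p'.+1 => fun xs => P xs.1 /\ all_pow P xs.2
  end.

Definition gamma_dom (p : nat) : set (gamma_space p) :=
  [set jgy | all_pow (X := discrete_space R cover_index)
               (fun j : cover_index => Ucover j jgy.2.2) jgy.1].

(* (x0, ..., xp) |-> (x0, .., x_{i-1}, x_{i+1}, .., xp) *)
Fixpoint delete_nth (X : chartedSpace R) (p i : nat) {struct p} :
    pow_space X p.+1 -> pow_space X p :=
  match p return pow_space X p.+1 -> pow_space X p with
  | 0 => fun _ => tt
  | p'.+1 => fun xs => if i is i'.+1 then (xs.1, delete_nth i' xs.2) else xs.2
  end.

Definition actTM (g : G) (y : TM) : TM := (y.1, act g y.2).

(* ((g1,...,g_{p+1}), y) is sent by the 0-th face to ((g2,...,g_{p+1}), y), by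
   the i-th face to ((g1,...,g_i g_{i+1},...,g_{p+1}), y) for 1 <= i <= p, and
   by the last face to ((g1,...,gp), g_{p+1} y). *)
Fixpoint action_face (p i : nat) {struct p} :
    pow_space G p.+1 * TM -> pow_space G p * TM :=
  match p return pow_space G p.+1 * TM -> pow_space G p * TM with
  | 0 => fun gy => if i is 0 then (tt, gy.2) else (tt, actTM gy.1.1 gy.2)
  | p'.+1 => fun gy =>
      match i with
      | 0 => (gy.1.2, gy.2)
      | 1 => ((mul gy.1.1 gy.1.2.1, gy.1.2.2), gy.2)
      | i'.+1 => let r := action_face i' (gy.1.2, gy.2) in
                 ((gy.1.1, r.1), r.2)
      end
  end.

Definition gamma_face (p i : nat) (x : gamma_space p.+1) : gamma_space p :=
  (delete_nth i x.1, action_face i x.2).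

Definition Gamma : nerve R := Nerve gamma_dom gamma_face.

(* an arrow (i0, i1; g; (z, x)) of Gamma *)
Definition arrow_fun (B : Type)
    (f : cover_index -> cover_index -> G -> circle R -> M -> B)
    (y : gspace Gamma 1) : B :=
  f y.1.1 y.1.2.1 y.2.1.1 y.2.2.1 y.2.2.2.

Definition alpha_fun (j0 j1 : cover_index) (g : G) (z : circle R) (x : M) : int :=
  if `[< Tone z >] then
    match j0.1, j1.1 with
    | false, true => 1
    | true, false => -1
    | _, _ => 0
    end
  else 0.

Definition alpha : cochain Gamma (sheafZ R) :=
  cochain1 (A := sheafZ R) (arrow_fun alpha_fun : gspace Gamma 1 -> int).

Context (h : 'I_n -> 'I_n -> G -> M -> circle R).

Definition line_cochain : cochain Gamma (sheafT R) :=
  cochain1 (A := sheafT R)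
    (arrow_fun (fun j0 j1 g _ x => h j0.2 j1.2 g x) : gspace Gamma 1 -> circle R).

End Gamma.
Arguments alpha {R} eps {G M} mul act {n} V.
Arguments line_cochain {R} eps {G M} mul act {n} V h.

(** * The Fock space *)

Section Hilbert.
Context {R : realType} {H : lmodType R[i]}.
Variable dot : {dot H for @Num.conj R[i]}.

Definition sqnorm (v : H) : R := complex.Re (dot v v).

Definition is_complete : Prop := forall v : nat -> H,
  (forall e : R, 0 < e -> exists N, forall m k, (N <= m)%N -> (N <= k)%N ->
     sqnorm (v m - v k) < e) ->
  exists w, forall e : R, 0 < e -> exists N, forall m, (N <= m)%N ->
     sqnorm (v m - w) < e.

Definition nclosure (A : set H) : set H :=
  [set v | forall e : R, 0 < e -> exists2 w, A w & sqnorm (v - w) < e].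

Definition lspan (A : set H) : set H :=
  [set w | exists k (c : 'I_k -> R[i]) (v : 'I_k -> H),
     (forall i, A (v i)) /\ w = \sum_(i < k) c i *: v i].

Definition closed_subspace (W : set H) : Prop :=
  [/\ W 0, forall (c : R[i]) v w, W v -> W w -> W (c *: v + w) &
      nclosure W `<=` W].

Definition orthonormal_basis (I : eqType) (u : I -> H) : Prop :=
  (forall i j, dot (u i) (u j) = (i == j)%:R) /\
  nclosure (lspan (range u)) = setT.

Record unitary := Unitary {
  uop :> H -> H;
  uinv : H -> H;
  uop_linear : forall (c : R[i]) v w, uop (c *: v + w) = c *: uop v + uop w;
  uop_isometry : forall v w, dot (uop v) (uop w) = dot v w;
  uopK : cancel uop uinv;
  uinvK : cancel uinv uop }.

Program Definition ucomp (A B : unitary) : unitary :=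
  {| uop := A \o B; uinv := uinv B \o uinv A |}.
Next Obligation. by move=> A B c v w; rewrite /= !uop_linear. Qed.
Next Obligation. by move=> A B v w; rewrite /= !uop_isometry. Qed.
Next Obligation. by move=> A B v; rewrite /= !uopK. Qed.
Next Obligation. by move=> A B v; rewrite /= !uinvK. Qed.

Program Definition uinverse (A : unitary) : unitary :=
  {| uop := uinv A; uinv := A |}.
Next Obligation.
by move=> A c v w; apply: (can_inj (uopK A)); rewrite uop_linear !uinvK.
Qed.
Next Obligation. by move=> A v w; rewrite -(uop_isometry A) !uinvK. Qed.
Next Obligation. by move=> A; exact: uinvK. Qed.
Next Obligation. by move=> A; exact: uopK. Qed.

End Hilbert.

(* Forms of type [{dot H for conj}] are linear in the first variable and
   antilinear in the second one: the scalar product <v, w> of the canonical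
   anticommutation relations, antilinear in v, is [dot w v]. *)
Record fockSpace (R : realType) := FockSpace {
  oneH : lmodType R[i];
  dotH : {dot oneH for @Num.conj R[i]};
  basisH : int -> oneH;
  completeH : is_complete dotH;
  basisHP : orthonormal_basis dotH basisH;
  fock :> lmodType R[i];
  dotF : {dot fock for @Num.conj R[i]};
  completeF : is_complete dotF;
  ann : oneH -> fock -> fock;
  cre : oneH -> fock -> fock;
  vacuum : fock;
  ann_linear : forall f (c : R[i]) v w,
    ann f (c *: v + w) = c *: ann f v + ann f w;
  ann_antilinear : forall (c : R[i]) f g v,
    ann (c *: f + g) v = Num.conj c *: ann f v + ann g v;
  cre_adjoint : forall f v w, dotF (ann f v) w = dotF v (cre f w);
  car_ann : forall f g v, ann f (ann g v) + ann g (ann f v) = 0;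
  car_cre : forall f g v, ann f (cre g v) + cre g (ann f v) = dotH g f *: v;
  vacuum_unit : dotF vacuum vacuum = 1;
  ann_vacuum : forall f,
    nclosure dotH (lspan (basisH @` [set k : int | 0 <= k])) f ->
    ann f vacuum = 0;
  cre_vacuum : forall f,
    nclosure dotH (lspan (basisH @` [set k : int | k < 0])) f ->
    cre f vacuum = 0;
  fock_irreducible : forall W : set fock, closed_subspace dotF W ->
    (forall f v, W v -> W (ann f v) /\ W (cre f v)) ->
    W = [set 0] \/ W = setT }.

Section FockOperators.
Context {R : realType} (F : fockSpace R).

Definition monomial (ks ls : seq int) : F :=
  foldr (fun k => ann (basisH F k))
    (foldr (fun k => cre (basisH F k)) (vacuum F) ls) ks.

(* N, with domain Ndom, is the self-adjoint operator with the prescribed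
   eigenvectors; the first condition says that N is equal to its adjoint. *)
Definition is_charge (Ndom : set F) (N : F -> F) : Prop :=
  (forall v w, (Ndom v /\ N v = w) <->
     (forall v', Ndom v' -> dotF F (N v') v = dotF F v' w)) /\
  (forall ks ls : seq int,
     all (fun k => k < 0) ks -> all (fun k => 0 <= k) ls ->
     Ndom (monomial ks ls) /\
     N (monomial ks ls) = ((size ls)%:Z - (size ks)%:Z)%:~R *: monomial ks ls).

(* The unitary operators z^N, given by functional calculus: z^N acts as z^k on
   the eigenspace of N for the eigenvalue k (the spectrum of N is integral). *)
Definition is_charge_power (Ndom : set F) (N : F -> F)
    (powN : circle R -> unitary (dotF F)) : Prop :=
  forall z (k : int) v, Ndom v -> N v = k%:~R *: v ->
    powN z v = (val z) ^ k *: v.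

Definition is_shift (S : unitary (dotF F)) : Prop :=
  [/\ S (vacuum F) = cre (basisH F 0) (vacuum F),
      forall k v, S (ann (basisH F k) (uinv S v)) = ann (basisH F (k + 1)) v &
      forall k v, S (cre (basisH F k) (uinv S v)) = cre (basisH F (k + 1)) v].

End FockOperators.

(** * The projective Fock bundle *)

Section FockBundle.
Context {R : realType} (eps : R) (G M : chartedSpace R).
Context (mul : G -> G -> G) (act : G -> M -> M) (n : nat) (V : 'I_n -> set M).
Context (h : 'I_n -> 'I_n -> G -> M -> circle R).
Context (F : fockSpace R) (powN : circle R -> unitary (dotF F)).
Context (S : unitary (dotF F)).

(* the lifts to U(F) of the transition functions, with values in PU(F) *)
Definition ghat (j0 j1 : cover_index n) (g : G) (z : circle R) (x : M) :
    unitary (dotF F) :=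
  let P := powN (h j0.2 j1.2 g x) in
  if `[< Tone eps z >] then
    match j0.1, j1.1 with
    | false, true => ucomp P S
    | true, false => ucomp (uinverse S) P
    | _, _ => P
    end
  else P.

(* the T-valued function f with
   f_{ijk}(a, b x, b, x) = ghat_{ij}(a, b x) ghat_{jk}(b, x) ghat_{ik}(a b, x)^-1 *)
Definition is_DD_cocycle
    (f : gspace (Gamma eps mul act V) 2 -> circle R) : Prop :=
  forall i j k a b z x,
    let y := ((i, (j, (k, tt))), ((a, (b, tt)), (z, x))) in
    @gdom _ (Gamma eps mul act V) 2 y ->
    forall v, ucomp (ucomp (ghat i j a z (act b x)) (ghat j k b z x))
                (uinverse (ghat i k (mul a b) z x)) v = val (f y) *: v.

Definition DD_class : set (cochain (Gamma eps mul act V) (sheafT R)) :=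
  [set c | exists2 f, is_DD_cocycle f &
     cclass 2 (cochain2 (A := sheafT R) f) c].

End FockBundle.
Arguments DD_class {R} eps {G M} mul act {n} V h {F} powN S.

(* Main.v *)
(** Moving S past z^N produces the scalar z.  Apart from these scalars the lifts
    of the transition functions multiply like the powers h_ij^N, so f is read
    off from the position of S in them: f = - (alpha cup h) + d u, where u is
    h_ij over the component of 1 for i > n >= j, and 1 otherwise.  Now let r be
    a real lift of h, with D r = 2 pi beta.  Then - (alpha cup r) is a real lift
    of - (alpha cup h), and as alpha is a cocycle of degree 1, the Leibniz rule
    gives D (- (alpha cup r)) = alpha cup D r = 2 pi (alpha cup beta). *)

Require Import Defs.
From HB Require Import structures.
From mathcomp Require Import all_boot all_order all_algebra sesquilinear.
From mathcomp Require Import all_classical reals topology normedtype.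
From mathcomp Require Import landau derive trigo complex ring lra zify.
Set Implicit Arguments.
Unset Strict Implicit.
Unset Printing Implicit Defensive.
Import Order.TTheory GRing.Theory Num.Theory.
Import numFieldNormedType.Exports.
Local Open Scope classical_set_scope.
Local Open Scope ring_scope.

(** * Smooth functions and maps *)

(** Classes are sets of cochains and cochains are families of germs indexed by lists of points, so
    the identities of the overview must be kept apart from the bookkeeping of germs. They are proved
    as equalities of functions on lists of the right length; vanishing up to germs is handled by the
    sheaf [germ0], whose sections are the germs of 0, so that each closure property shown for
    sections also holds for null cochains. The products of alpha with h, r and beta are instances of
    one product [zcup] of an integral cochain with a cochain in any coefficients, on which the
    integers act; Leibniz is proved once, for it. Real lifts meet no obstruction, since a Godement
    cochain chooses its germs independently and each germ lifts. On the Fock side z^N is prescribed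
    on eigenvectors of N only, so its commutation with S must be extended from the monomials, whose
    span is dense by irreducibility. Finally, alpha and u are sections because the component of 1 in
    the overlap of the arcs is told apart from the other one by the sign of the real part. *)

Lemma cvg_rV (R : realType) (T : Type) (Fl : set_system T) (FFl : Filter Fl)
    d (g : T -> 'rV[R]_d) (l : 'rV[R]_d) :
  (forall i, g x 0 i @[x --> Fl] --> l 0 i) -> g @ Fl --> l.
Proof.
move=> cg A [P nP PA].
have H : \forall x \near Fl, forall j : 'I_d, P 0 j (g x 0 j).
  by apply: filter_forall => j; apply: cg; exact: nP.
apply: (filterS _ H) => x Px; apply: PA => i j; rewrite (ord1 i); exact: Px.
Qed.

(** * Calculus of C^k functions on open sets *)

Section CkTheory.
Context {R : realType}.
Implicit Types E F : normedModType R.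

(** Near x the differential of [f] also gives a first-order expansion of [g], and such an expansion
    determines the differential. *)
Lemma near_eq_differentiable E F (f g : E -> F) (x : E) :
  (\forall y \near x, f y = g y) -> differentiable f x -> differentiable g x.
Proof.
move=> fg dfx; have fgx : f x = g x := nbhs_singleton fg.
have dc : continuous ('d f x) := diff_continuous dfx.
suff gE : g \o shift x = cst (g x) + 'd f x +o_ 0 id.
  by apply/diff_locallyP; rewrite (diff_unique dc gE).
apply/eqaddoP => e e0; have /eqaddoP/(_ e e0) := diff_locally dfx.
move: fg; rewrite (near_shift 0 x) => fg.
apply: filter_app; apply: filterS fg => h /=; rewrite subr0.
by rewrite !fctE /= fgx => ->.
Qed.

Lemma Ck_eq k E F (W : set E) (f g : E -> F) :
  open W -> (forall x, W x -> f x = g x) -> Ck k W f -> Ck k W g.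
Proof.
move=> oW; elim: k f g => [|k IH] f g fg /=.
  move=> cf x Wx; rewrite /prop_for/continuous_at -fg//.
  apply: cvg_trans (cf x Wx); apply: near_eq_cvg.
  by near=> y; rewrite fg//; near: y; exact: open_nbhs_nbhs.
move=> [df cf]; split=> [x Wx|v].
  apply: near_eq_differentiable (df x Wx).
  by near=> y; rewrite fg//; near: y; exact: open_nbhs_nbhs.
apply: IH (cf v) => x Wx; apply: near_eq_derive.
by near=> y; rewrite fg//; near: y; exact: open_nbhs_nbhs.
Unshelve. all: by end_near. Qed.

Lemma CkS k E F (W : set E) (f : E -> F) : Ck k.+1 W f -> Ck k W f.
Proof.
elim: k f => [|k IH] f [df cf] /=.
  by move=> x Wx; apply: differentiable_continuous; exact: df.
by split=> // v; apply: IH.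
Qed.

Lemma sub_Ck k E F (W W' : set E) (f : E -> F) :
  W' `<=` W -> Ck k W f -> Ck k W' f.
Proof.
move=> sW; elim: k f => [|k IH] f /=; first by move=> cf x /sW; exact: cf.
by move=> [df cf]; split=> [x /sW|v]; [exact: df|apply: IH].
Qed.

Lemma Ck_cst k E F (W : set E) (a : F) : Ck k W (fun _ => a).
Proof.
elim: k a => [|k IH] a /=; first by move=> x _; exact: cvg_cst.
split=> [x _|v]; first exact: (differentiable_cst a x).
have -> : (fun x : E => 'D_v (fun _ => a) x) = fun _ => 0 :> F => //.
by apply/funext => x; rewrite (derive_cst a).
Qed.

Lemma CkD k E F (W : set E) (f g : E -> F) : open W ->
  Ck k W f -> Ck k W g -> Ck k W (fun x => f x + g x).
Proof.
move=> oW; elim: k f g => [|k IH] f g /=.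
  by move=> cf cg x Wx; apply: cvgD; [exact: cf|exact: cg].
move=> [df cf] [dg cg]; split=> [x Wx|v].
  by apply: differentiableD; [exact: df|exact: dg].
apply: Ck_eq (IH _ _ (cf v) (cg v)) => // x Wx.
by rewrite -deriveD//; apply: diff_derivable; [exact: df|exact: dg].
Qed.

Lemma CkM k E (W : set E) (f g : E -> R^o) : open W ->
  Ck k W f -> Ck k W g -> Ck k W (fun x => f x * g x : R^o).
Proof.
move=> oW; elim: k f g => [|k IH] f g.
  by move=> /= cf cg x Wx; apply: cvgM; [exact: cf|exact: cg].
move=> cf' cg'; have [df cf] := cf'; have [dg cg] := cg'; split=> [x Wx|v].
  by apply: differentiableM; [exact: df|exact: dg].
have H := CkD oW (IH _ _ (CkS cf') (cg v)) (IH _ _ (CkS cg') (cf v)).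
apply: Ck_eq H => // x Wx.
by rewrite -deriveM//; apply: diff_derivable; [exact: df|exact: dg].
Qed.

Lemma CkN k E (W : set E) (f : E -> R^o) : open W ->
  Ck k W f -> Ck k W (fun x => - f x : R^o).
Proof.
move=> oW cf; have := CkM oW (Ck_cst k W (-1 : R^o)) cf.
by apply: Ck_eq => // x _; rewrite mulN1r.
Qed.

Lemma Ck_sum k E (W : set E) n (f : 'I_n -> E -> R^o) : open W ->
  (forall i, Ck k W (f i)) -> Ck k W (fun x => \sum_(i < n) f i x : R^o).
Proof.
move=> oW; elim: n f => [|n IH] f cf.
  by apply: Ck_eq (Ck_cst k W (0 : R^o)) => // x _; rewrite big_ord0.
have := CkD oW (cf ord0) (IH (fun i => f (lift ord0 i)) (fun i => cf _)).
by apply: Ck_eq => // x _; rewrite big_ord_recl.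
Qed.

Lemma Ck_coord k E d (W : set E) (f : E -> 'rV[R]_d) i : open W ->
  Ck k W f -> Ck k W (fun x => f x 0 i : R^o).
Proof.
move=> oW; elim: k f => [|k IH] f /=.
  move=> cf x Wx; apply: (@continuous_comp _ _ _ f (fun M : 'rV_d => M 0 i)).
    exact: cf.
  exact: coord_continuous.
move=> [df cf]; split=> [x Wx|v].
  apply: (@differentiable_comp _ _ _ _ f (fun M : 'rV_d => M 0 i : R^o)).
    exact: df.
  exact: differentiable_coord.
by apply: Ck_eq (IH _ (cf v)) => // x Wx; rewrite derive_mx ?mxE//;
  apply: diff_derivable; exact: df.
Qed.

Lemma Ck_proj k d (W : set 'rV[R]_d) (i : 'I_d) :
  Ck k W (fun x => x 0 i : R^o).
Proof.
case: k => [|k] /=; first by move=> x _; exact: coord_continuous.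
split=> [x _|v]; first exact: differentiable_coord.
rewrite (_ : (fun x => _) = fun _ => v 0 i); first exact: Ck_cst.
apply/funext => x.
have := @derive_mx R 'rV[R]_d 1 d id x v (@derivable_id _ _ x v).
by rewrite derive_id => /matrixP/(_ 0 i); rewrite mxE.
Qed.

Lemma differentiable_mxP E d (f : E -> 'rV[R]_d) x :
  (forall i, differentiable (fun y => f y 0 i : R^o) x) -> differentiable f x.
Proof.
move=> df; have -> : f = \sum_(i < d) (fun y => f y 0 i *: delta_mx 0 i).
  by apply/funext => y; rewrite [LHS]row_sum_delta fct_sumE.
apply: differentiable_sum => i.
exact: (@differentiableZl _ _ _ (fun y => f y 0 i) (delta_mx 0 i)).
Qed.

(** [Ck] differentiates along a fixed v, whereas the chain rule yields the direction ['d g x v],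
    which moves with x. Expanding it in the basis [delta_mx 0 i] turns the derivative into a sum of
    products to which the induction hypothesis applies. *)
Lemma Ck_comp k E d (U : set E) (W : set 'rV[R]_d) (g : E -> 'rV[R]_d)
    (f : 'rV[R]_d -> R^o) : open U ->
  (forall x, U x -> W (g x)) -> (forall i, Ck k U (fun x => g x 0 i : R^o)) ->
  Ck k W f -> Ck k U (fun x => f (g x)).
Proof.
move=> oU gUW; elim: k f => [|k IH] f.
  move=> /= cg cf x Ux; apply: (@continuous_comp _ _ _ g f); last first.
    exact: cf (gUW _ Ux).
  apply: cvg_rV => i; exact: cg.
move=> cg' [df cf]; have cg i := (cg' i).2.
have dg x : U x -> differentiable g x.
  by move=> Ux; apply: differentiable_mxP => i; exact: (cg' i).1.
split=> [x Ux|v].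
  by apply: (@differentiable_comp _ _ _ _ g f); [exact: dg|exact: df (gUW _ Ux)].
have H : Ck k U (fun x => \sum_(i < d)
    ('D_v (fun y => g y 0 i : R^o) x * 'D_(delta_mx 0 i) f (g x)) : R^o).
  apply: Ck_sum => // i; apply: CkM => //; first exact: cg.
  apply: (IH (fun y => 'D_(delta_mx 0 i) f y)); last exact: cf.
  by move=> j; exact: CkS.
apply: Ck_eq H => // x Ux; have dfg := df _ (gUW _ Ux); have dgx := dg _ Ux.
rewrite deriveE; last exact: (@differentiable_comp _ _ _ _ g f).
rewrite (@diff_comp _ _ _ _ g f)//=.
have -> : 'd g x v = \sum_(i < d) 'D_v (fun y => g y 0 i) x *: delta_mx 0 i.
  rewrite -deriveE// derive_mx; last exact: diff_derivable.
  by rewrite [LHS]row_sum_delta; apply: eq_bigr => i _; rewrite mxE.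
rewrite linear_sum; apply: eq_bigr => i _.
by rewrite linearZ /= -(deriveE _ dfg).
Qed.

End CkTheory.

(** * Smooth functions read in charts *)

Section SmoothFunctions.
Context {R : realType}.
Implicit Types X Y Z : chartedSpace R.

Lemma openS_nbhs (T : topologicalType) (A : set T) :
  (forall x, A x -> nbhs x A) -> open A.
Proof. by move=> H; rewrite openE => x /H. Qed.

Lemma nbhs_open (T : topologicalType) (A : set T) (x : T) :
  open A -> A x -> nbhs x A.
Proof. by move=> oA Ax; apply: open_nbhs_nbhs. Qed.

Lemma near_continuous (T U : topologicalType) (phi : T -> U) x (P : set U) :
  {for x, continuous phi} -> nbhs (phi x) P -> \forall y \near x, P (phi y).
Proof. by move=> cphi; exact: cphi. Qed.

(** The local part of [is_manifold], with transition maps taken coordinate by coordinate as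
    [Ck_comp] wants them. It passes to products, powers and discrete spaces, hence to every space of
    composable arrows. *)
Definition smooth_charts X : Prop :=
  [/\ forall c : chart R X (Defs.dim X), atlas c -> is_chart c,
      forall x : X, exists2 c : chart R X (Defs.dim X), atlas c & cdom c x &
      forall c c' : chart R X (Defs.dim X), atlas c -> atlas c' -> forall k i,
        Ck k (ccod c `&` cinv c @^-1` cdom c')
          (fun t => cmap c' (cinv c t) 0 i : R^o)].

Lemma open_transition (T : topologicalType) d (c : chart R T d) (A : set T) :
  is_chart c -> open A -> open (ccod c `&` cinv c @^-1` A).
Proof.
move=> [[_ oc] _ _ _ cc] oA; apply: openS_nbhs => t [ct At].
by apply: filterI; [exact: nbhs_open|apply: (cc t ct); exact: nbhs_open].
Qed.

Lemma manifold_smooth_charts X : is_manifold X -> smooth_charts X.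
Proof.
move=> [_ _ ch cov tr]; split=> // c c' ac ac' k i.
have [[oc' _] _ _ _ _] := ch c' ac'.
apply: (@Ck_coord _ _ _ _ _ (cmap c' \o cinv c)); last exact: tr.
by apply: open_transition; [exact: ch|].
Qed.

Section InCharts.
Variable X : chartedSpace R.
Hypothesis hX : smooth_charts X.
Implicit Types (f g : X -> R) (x : X) (c : chart R X (Defs.dim X)).

Lemma near_chart c x (P : X -> Prop) : atlas c -> cdom c x ->
  (\forall y \near x, P y) <->
  (\forall t \near cmap c x, ccod c t /\ P (cinv c t)).
Proof.
move=> ac cx; have [/(_ c ac)[[oc oc'] c1 c2 c3 c4] _ _] := hX.
split=> [Px|Pt].
  apply: filterI; first by apply: nbhs_open => //; exact: (c1 _ cx).1.
  by apply: (c4 _ (c1 _ cx).1); rewrite (c1 _ cx).2.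
have H : \forall y \near x, ccod c (cmap c y) /\ P (cinv c (cmap c y)) := c3 _ cx _ Pt.
by apply: filterS2 (nbhs_open oc cx) H => y cy [_]; rewrite (c1 _ cy).2.
Qed.

Lemma smooth_fun_intro c x f : atlas c -> cdom c x ->
  (exists2 N, nbhs (cmap c x) N & forall k, Ck k N° (f \o cinv c : _ -> R^o)) ->
  smooth_fun_at f x.
Proof.
move=> ac cx [N nN cf]; have [/(_ c ac)[[oc oc'] c1 c2 c3 c4] _ _] := hX.
exists c, (N° `&` ccod c); split=> //.
- split; first by apply: openI => //; exact: open_interior.
  by split; [exact: nbhs_singleton (nbhs_interior nN)|exact: (c1 _ cx).1].
- by move=> k; apply: sub_Ck (cf k) => t [].
Qed.

(** Composing with the transition map replaces the chart hidden in [smooth_fun_at] by any prescribed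
    chart at x. Together with [smooth_fun_intro] this lets two functions be compared in a common
    chart. *)
Lemma smooth_fun_elim c x f : atlas c -> cdom c x -> smooth_fun_at f x ->
  exists2 N, nbhs (cmap c x) N & forall k, Ck k N° (f \o cinv c : _ -> R^o).
Proof.
move=> ac cx [c' [W [ac' cx' [oW Wx] Wc cf]]].
have [ch _ tr] := hX; have [_ c1 _ _ c4] := ch c ac.
have [[oc' _] c1' _ c3' _] := ch c' ac'.
have ox : cdom c' (cinv c (cmap c x)) by rewrite (c1 _ cx).2.
have cc'x : {for cmap c x, continuous (cmap c' \o cinv c)}.
  by apply: continuous_comp; [exact: (c4 _ (c1 _ cx).1)|exact: c3'].
set U := ccod c `&` cinv c @^-1` cdom c'.
have oU : open U by apply: open_transition; [exact: ch|].
exists (U `&` (cmap c' \o cinv c) @^-1` W).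
  apply: filterI; first by apply: nbhs_open => //; split=> //; exact: (c1 _ cx).1.
  by apply: cc'x; apply: nbhs_open => //=; rewrite (c1 _ cx).2.
move=> k; set V := (X in Ck k X); have oV : open V := @open_interior _ _.
have VU : V `<=` U by move=> t /interior_subset[].
have VW t : V t -> W (cmap c' (cinv c t)) by move=> /interior_subset[].
apply: Ck_eq (Ck_comp oV VW (fun i => sub_Ck VU (tr _ _ ac ac' k i)) (cf k)) => //.
by move=> t /VU[_ /= ct]; rewrite (c1' _ ct).2.
Qed.

Lemma smooth_fun_near_eq f g x :
  (\forall y \near x, f y = g y) -> smooth_fun_at f x -> smooth_fun_at g x.
Proof.
move=> fg sf; have [_ /(_ x)[c ac cx] _] := hX.
have [N nN cf] := smooth_fun_elim ac cx sf.
move: fg => /(near_chart _ ac cx) fg.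
apply: (smooth_fun_intro ac cx).
exists (N `&` [set t | ccod c t /\ f (cinv c t) = g (cinv c t)]).
  exact: filterI.
move=> k; apply: Ck_eq (sub_Ck _ (cf k)).
- exact: open_interior.
- by move=> t /interior_subset[_ []].
- by move=> t; rewrite interiorI => -[].
Qed.

Lemma smooth_fun_near f x : smooth_fun_at f x -> \forall y \near x, smooth_fun_at f y.
Proof.
move=> [c [W [ac cx [oW Wx] Wc cf]]].
have [ch _ _] := hX; have [[oc _] _ _ c3 _] := ch c ac.
have nW : \forall y \near x, W (cmap c y) by apply: (c3 _ cx); exact: nbhs_open.
by apply: filterS2 (nbhs_open oc cx) nW => y cy Wy; exists c, W; split.
Qed.

Lemma smooth_fun_continuous f x : smooth_fun_at f x -> {for x, continuous f}.
Proof.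
move=> sf; have [_ /(_ x)[c ac cx] _] := hX.
have [N nN /(_ 0%N) cf] := smooth_fun_elim ac cx sf.
have [ch _ _] := hX; have [[oc _] c1 _ c3 _] := ch c ac.
move=> A nA; apply/(near_chart _ ac cx); apply: filterI.
  by apply: nbhs_open; [have [[]] := ch c ac|exact: (c1 _ cx).1].
have := cf _ (nbhs_singleton (nbhs_interior nN)); apply.
by rewrite /= (c1 _ cx).2.
Qed.

Lemma smooth_fun_cst a x : smooth_fun_at (fun _ => a) x.
Proof.
have [_ /(_ x)[c ac cx] _] := hX; apply: (smooth_fun_intro ac cx).
by exists setT; [exact: filterT|move=> k; exact: Ck_cst].
Qed.

Lemma smooth_fun_op2 (op : R -> R -> R) f g x :
  (forall k (W : set 'rV[R]_(Defs.dim X)) (u v : _ -> R^o), open W ->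
     Ck k W u -> Ck k W v -> Ck k W (fun t => op (u t) (v t) : R^o)) ->
  smooth_fun_at f x -> smooth_fun_at g x -> smooth_fun_at (fun y => op (f y) (g y)) x.
Proof.
move=> Hop sf sg; have [_ /(_ x)[c ac cx] _] := hX.
have [N nN cf] := smooth_fun_elim ac cx sf.
have [N' nN' cg] := smooth_fun_elim ac cx sg.
apply: (smooth_fun_intro ac cx); exists (N `&` N'); first exact: filterI.
move=> k; rewrite interiorI.
by apply: Hop; [apply: openI; exact: open_interior|
  apply: sub_Ck (cf k) => t []|apply: sub_Ck (cg k) => t []].
Qed.

Lemma smooth_funD f g x : smooth_fun_at f x -> smooth_fun_at g x ->
  smooth_fun_at (fun y => f y + g y) x.
Proof. by apply: smooth_fun_op2 => k W u v; exact: CkD. Qed.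

Lemma smooth_funM f g x : smooth_fun_at f x -> smooth_fun_at g x ->
  smooth_fun_at (fun y => f y * g y) x.
Proof. by apply: smooth_fun_op2 => k W u v; exact: CkM. Qed.

Lemma smooth_funN f x : smooth_fun_at f x -> smooth_fun_at (fun y => - f y) x.
Proof.
move=> sf; apply: (@smooth_fun_op2 (fun a _ => - a) f f) => // k W u v oW cu _.
exact: CkN.
Qed.

Lemma smooth_fun_coord c x i : atlas c -> cdom c x ->
  smooth_fun_at (fun y => cmap c y 0 i) x.
Proof.
move=> ac cx; have [/(_ c ac)[[oc oc'] c1 c2 c3 c4] _ _] := hX.
apply: (smooth_fun_intro ac cx); exists (ccod c).
  by apply: nbhs_open => //; exact: (c1 _ cx).1.
move=> k; apply: (@Ck_eq _ _ _ _ _ (fun t : 'rV[R]_(Defs.dim X) => t 0 i : R^o)); last exact: Ck_proj.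
  exact: open_interior.
by move=> t /interior_subset ct /=; rewrite (c2 _ ct).2.
Qed.

End InCharts.

(** Smoothness is tested in every chart of Y at the image point, and continuity is included so that
    the chart domain pulls back to a neighbourhood of x. In this form compositions and pairs need no
    choice of charts. *)
Definition smooth_at X Y (phi : X -> Y) (x : X) : Prop :=
  {for x, continuous phi} /\
  forall c : chart R Y (Defs.dim Y), atlas c -> cdom c (phi x) ->
    forall i, smooth_fun_at (fun y => cmap c (phi y) 0 i) x.

(** Only one chart of Y is tested here. Applied to the coordinates of another chart, this shows that
    [smooth_at] may be checked in a single chart; applied to any f, it gives pullback of
    functions. *)
Lemma smooth_fun_comp_chart X Y (phi : X -> Y) x (c : chart R Y (Defs.dim Y)) f :
  smooth_charts X -> smooth_charts Y ->
  {for x, continuous phi} -> atlas c -> cdom c (phi x) ->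
  (forall i, smooth_fun_at (fun y => cmap c (phi y) 0 i) x) ->
  smooth_fun_at f (phi x) -> smooth_fun_at (fun y => f (phi y)) x.
Proof.
move=> hX hY cphi ac cx sphi sf; have [N nN cf] := smooth_fun_elim hY ac cx sf.
have [_ /(_ x)[e ae ex] _] := hX; have [ch _ _] := hY.
have [[oc oc'] c1 c2 c3 c4] := ch c ac.
have [M HM] := choice (fun i =>
  (exists2P _ _).1 (smooth_fun_elim hX ae ex (sphi i))).
have nM : \forall t \near cmap e x, forall i, M i t.
  by apply: (@filter_forall _ _ M (nbhs (cmap e x))) => i; exact: (HM i).1.
have : \forall y \near x, cdom c (phi y) /\ N° (cmap c (phi y)).
  apply: (near_continuous (P := [set z | cdom c z /\ N° (cmap c z)]) cphi).
  apply: filterI; first exact: nbhs_open.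
  by apply: (c3 _ cx); exact: nbhs_interior.
move=> /(near_chart hX _ ae ex) nN'.
apply: (smooth_fun_intro hX ae ex).
exists ([set t | forall i, M i t] `&`
  [set t | ccod e t /\ cdom c (phi (cinv e t)) /\ N° (cmap c (phi (cinv e t)))]).
  exact: filterI.
move=> k; set U := (X in Ck k X); have oU : open U := @open_interior _ _.
have UN t : U t -> N° (cmap c (phi (cinv e t))).
  by move=> /interior_subset[_ [_ []]].
have cphi' i : Ck k U (fun t => cmap c (phi (cinv e t)) 0 i : R^o).
  apply: sub_Ck ((HM i).2 k); rewrite -open_subsetE//.
  by move=> t /interior_subset[].
apply: Ck_eq (Ck_comp oU UN cphi' (cf k)) => // t /interior_subset[_ [_ [ct _]]].
by rewrite /= (c1 _ ct).2.
Qed.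

End SmoothFunctions.

(** * Smooth maps, products, powers and discrete spaces *)

Section SmoothMaps.
Context {R : realType}.
Implicit Types X Y Z : chartedSpace R.

Lemma near_eq_continuous (T U : topologicalType) (f g : T -> U) x :
  (\forall y \near x, f y = g y) -> {for x, continuous f} -> {for x, continuous g}.
Proof.
move=> e cf A; rewrite -(nbhs_singleton e) => /cf nA.
by apply: filterS2 e nA => y /= ->.
Qed.

Lemma smooth_fun_comp X Y (phi : X -> Y) x f :
  smooth_charts X -> smooth_charts Y -> smooth_at phi x ->
  smooth_fun_at f (phi x) -> smooth_fun_at (fun y => f (phi y)) x.
Proof.
move=> hX hY [cphi sphi]; have [_ /(_ (phi x))[c ac cx] _] := hY.
exact: (smooth_fun_comp_chart hX hY cphi ac cx (sphi c ac cx)).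
Qed.

Lemma smooth_at_chart X Y (phi : X -> Y) x (c : chart R Y (Defs.dim Y)) :
  smooth_charts X -> smooth_charts Y ->
  {for x, continuous phi} -> atlas c -> cdom c (phi x) ->
  (forall i, smooth_fun_at (fun y => cmap c (phi y) 0 i) x) -> smooth_at phi x.
Proof.
move=> hX hY cphi ac cx sphi; split=> // c' ac' cx' i.
apply: (@smooth_fun_comp_chart _ _ _ phi x c (fun z => cmap c' z 0 i)) => //.
exact: smooth_fun_coord.
Qed.

Lemma smooth_at_comp X Y Z (phi : X -> Y) (psi : Y -> Z) x :
  smooth_charts X -> smooth_charts Y ->
  smooth_at phi x -> smooth_at psi (phi x) -> smooth_at (fun y => psi (phi y)) x.
Proof.
move=> hX hY sphi [cpsi spsi]; split.
  by apply: (@continuous_comp _ _ _ phi psi) => //; exact: sphi.1.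
move=> c ac cx i.
by apply: (@smooth_fun_comp _ _ phi x (fun z => cmap c (psi z) 0 i)) => //; exact: spsi.
Qed.

Lemma smooth_at_cst X Y (b : Y) (x : X) :
  smooth_charts X -> smooth_at (fun _ : X => b) x.
Proof.
by move=> hX; split; [exact: cvg_cst|move=> c ac cx i; exact: smooth_fun_cst].
Qed.

Lemma smooth_map_at_smooth X Y (phi : X -> Y) x :
  smooth_charts X -> smooth_charts Y -> smooth_map_at phi x -> smooth_at phi x.
Proof.
move=> hX hY [c [c' [W [[ac ac'] cx [oW Wx] Wc sW]]]].
have [/(_ c ac)[[oc oc'] c1 c2 c3 c4] _ _] := hX.
have [/(_ c' ac')[_ d1 d2 d3 d4] _ _] := hY.
have cx' : cdom c' (phi x) by have [_] := Wc _ Wx; rewrite (c1 _ cx).2.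
apply: (smooth_at_chart hX hY _ ac' cx').
(* [smooth_map_at] does not mention continuity. It is recovered by factoring phi near x through its
   expression in charts, which is continuous by the case k = 0. *)
- have e : \forall y \near x, phi y = cinv c' (cmap c' (phi (cinv c (cmap c y)))).
    apply: filterS2 (nbhs_open oc cx) (near_continuous (c3 _ cx) (nbhs_open oW Wx)).
    by move=> y cy Wy; rewrite (c1 _ cy).2 (d1 _ _).2// -(c1 _ cy).2; exact: (Wc _ Wy).2.
  apply: (near_eq_continuous (f := fun y => cinv c' (cmap c' (phi (cinv c (cmap c y)))))).
    by apply: filterS e => y ->.
  apply: (@continuous_comp _ _ _ (cmap c)
    (fun t => cinv c' (cmap c' (phi (cinv c t))))); first exact: c3.
  apply: (@continuous_comp _ _ _ (fun t => cmap c' (phi (cinv c t))) (cinv c')).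
    exact: (sW 0%N).
  by apply: d4; rewrite (c1 _ cx).2; exact: (d1 _ cx').1.
- move=> i; apply: (smooth_fun_intro hX ac cx); exists W; first exact: nbhs_open.
  move=> k; apply: sub_Ck (@interior_subset _ W) _.
  exact: (Ck_coord i oW (sW k)).
Qed.

Lemma prod_chart_is_chart X Y (c : chart R X (Defs.dim X)) (c' : chart R Y (Defs.dim Y)) :
  is_chart c -> is_chart c' -> is_chart (prod_chart c c').
Proof.
move=> [[oc oc'] c1 c2 c3 c4] [[od od'] d1 d2 d3 d4]; split=> /=.
- split.
    apply: openS_nbhs => -[x y] [/= cx dy]; exists (cdom c, cdom c') => //=.
    by split; exact: nbhs_open.
  apply: openS_nbhs => t [/= ct dt]; apply: filterI.
    by apply: (near_continuous (@continuous_lsubmx _ _ _ _ t)); exact: nbhs_open.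
  by apply: (near_continuous (@continuous_rsubmx _ _ _ _ t)); exact: nbhs_open.
- move=> [x y] [/= cx dy]; rewrite !row_mxKl !row_mxKr (c1 _ cx).2 (d1 _ dy).2.
  by split=> //; split; [exact: (c1 _ cx).1|exact: (d1 _ dy).1].
- move=> t [/= ct dt]; split; first by split; [exact: (c2 _ ct).1|exact: (d2 _ dt).1].
  by rewrite (c2 _ ct).2 (d2 _ dt).2 hsubmxK.
- move=> [x y] [/= cx dy]; apply: cvg_rV => i.
  have cf : {for (x, y), continuous (fun xy : X * Y => cmap c xy.1)}.
    by apply: (@continuous_comp _ _ _ (@fst X Y) (cmap c)); [exact: cvg_fst|exact: c3].
  have cs : {for (x, y), continuous (fun xy : X * Y => cmap c' xy.2)}.
    by apply: (@continuous_comp _ _ _ (@snd X Y) (cmap c')); [exact: cvg_snd|exact: d3].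
  rewrite -(splitK i); case: (fintype.split i) => j /=.
    rewrite row_mxEl; under eq_fun do rewrite row_mxEl.
    exact: (continuous_comp cf (@coord_continuous _ _ _ 0 j _)).
  rewrite row_mxEr; under eq_fun do rewrite row_mxEr.
  exact: (continuous_comp cs (@coord_continuous _ _ _ 0 j _)).
- move=> t [ct dt].
  exact: (cvg_pair (continuous_comp (@continuous_lsubmx R 1 _ _ t) (c4 _ ct))
    (continuous_comp (@continuous_rsubmx R 1 _ _ t) (d4 _ dt))).
Qed.

Lemma smooth_charts_prod X Y :
  smooth_charts X -> smooth_charts Y -> smooth_charts (prod_space X Y).
Proof.
move=> [chX covX trX] [chY covY trY]; split.
- by move=> _ [c [c' [ac ac' ->]]]; apply: prod_chart_is_chart; auto.
- move=> [x y]; have [c ac cx] := covX x; have [c' ac' cy] := covY y.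
  by exists (prod_chart c c'); [exists c, c'|].
- move=> _ _ [c [c' [ac ac' ->]]] [d [d' [ad ad' ->]]] k i.
  have [[_ oc] _ _ _ cc] := chX c ac; have [[_ oc'] _ _ _ cc'] := chY c' ac'.
  have [[od _] _ _ _ _] := chX d ad; have [[od' _] _ _ _ _] := chY d' ad'.
  have oW := open_transition (chX c ac) od.
  have oW' := open_transition (chY c' ac') od'.
  set U := (X in Ck k X); have oU : open U.
    apply: openS_nbhs => t [[/= ct ct'] [/= dt dt']].
    have := near_continuous (@continuous_lsubmx _ _ _ _ t)
      (nbhs_open oW (conj ct dt)).
    apply: filterS2 (near_continuous (@continuous_rsubmx _ _ _ _ t)
      (nbhs_open oW' (conj ct' dt'))) => s [? ?] [? ?]; split; split => //.
  rewrite -(splitK i); case: (fintype.split i) => j /=.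
    under eq_fun do rewrite row_mxEl.
    apply: (@Ck_comp _ _ _ _ _ _ (@lsubmx R 1 _ _)
      (fun t => cmap d (cinv c t) 0 j : R^o)) (trX _ _ ac ad k j) => //.
      by move=> t [[? ?] [? ?]]; split.
    by move=> l; under eq_fun do rewrite mxE; exact: Ck_proj.
  under eq_fun do rewrite row_mxEr.
  apply: (@Ck_comp _ _ _ _ _ _ (@rsubmx R 1 _ _)
    (fun t => cmap d' (cinv c' t) 0 j : R^o)) (trY _ _ ac' ad' k j) => //.
    by move=> t [[? ?] [? ?]]; split.
  by move=> l; under eq_fun do rewrite mxE; exact: Ck_proj.
Qed.

Lemma smooth_at_fst X Y (x : prod_space X Y) :
  smooth_charts X -> smooth_charts Y ->
  smooth_at (X := prod_space X Y) (fun xy => xy.1 : X) x.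
Proof.
move=> hX hY; have hXY := smooth_charts_prod hX hY.
split; first exact: cvg_fst.
move=> c ac cx i; have [_ /(_ x.2)[c' ac' cx'] _] := hY.
have axy : atlas (prod_chart c c' : chart R (prod_space X Y) _) by exists c, c'.
have := @smooth_fun_coord _ _ hXY (prod_chart c c') x (lshift _ i) axy (conj cx cx').
by under eq_fun do rewrite /= row_mxEl.
Qed.

Lemma smooth_at_snd X Y (x : prod_space X Y) :
  smooth_charts X -> smooth_charts Y ->
  smooth_at (X := prod_space X Y) (fun xy => xy.2 : Y) x.
Proof.
move=> hX hY; have hXY := smooth_charts_prod hX hY.
split; first exact: cvg_snd.
move=> c ac cx i; have [_ /(_ x.1)[c' ac' cx'] _] := hX.
have axy : atlas (prod_chart c' c : chart R (prod_space X Y) _) by exists c', c.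
have := @smooth_fun_coord _ _ hXY (prod_chart c' c) x (rshift _ i) axy (conj cx' cx).
by under eq_fun do rewrite /= row_mxEr.
Qed.

Lemma smooth_at_pair X Y Z (phi : Z -> X) (psi : Z -> Y) z :
  smooth_at phi z -> smooth_at psi z ->
  smooth_at (Y := prod_space X Y) (fun y => (phi y, psi y)) z.
Proof.
move=> [cphi sphi] [cpsi spsi]; split; first exact: cvg_pair.
move=> _ [c [c' [ac ac' ->]]] [/= cx cy] i.
rewrite -(splitK i); case: (fintype.split i) => j /=.
  by under eq_fun do rewrite row_mxEl; exact: sphi.
by under eq_fun do rewrite row_mxEr; exact: spsi.
Qed.

Lemma near_discrete (T : choiceType) (x : discrete_topology T) :
  \forall y \near x, y = x.
Proof. have H : principal_filter x [set x] by exact/principal_filterP.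
exact: H. Qed.

Lemma rV0_eq (x y : 'rV[R]_0) : x = y.
Proof. by apply/rowP => -[]. Qed.

(** Singletons are open, hence domains of charts onto the one-point space R^0, and transition maps
    have no coordinate to check. *)
Lemma smooth_charts_discrete (T : choiceType) : smooth_charts (discrete_space R T).
Proof.
split=> [c ac|x|c c' ac ac' k []//]; first exact: ac.
exists (@Chart R (discrete_topology T) 0 [set x] setT (fun _ => 0) (fun _ => x));
  last by [].
split; rewrite /cdom /ccod /cmap /cinv.
- split; last exact: openT.
  by apply: openS_nbhs => y ->; exact: near_discrete.
- by move=> y ->; split.
- by move=> t _; split; [|exact: rV0_eq].
- by move=> y _; exact: cvg_cst.
- move=> t _ A /nbhs_singleton Ax.
  by have : nbhs t (fun=> A x) by exact: filterE.
Qed.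

Lemma smooth_charts_pow X p : smooth_charts X -> smooth_charts (pow_space X p).
Proof.
move=> hX; elim: p => [|p IH] /=; first exact: smooth_charts_discrete.
exact: smooth_charts_prod.
Qed.

Lemma near_pow_discrete (T : choiceType) p (x : pow_space (discrete_space R T) p) :
  \forall y \near x, y = x.
Proof.
elim: p x => [|p IH] x /=; first exact: near_discrete.
case: x => x xs; exists ([set x], [set xs]) => /=.
  by split; [exact: near_discrete|exact: IH].
by move=> [y ys] [/= -> ->].
Qed.

End SmoothMaps.

(** * The circle *)

Section CircleTopology.
Context {R : realType}.
Implicit Types (s t : R) (z w : circle R).

Lemma circle_norm z : complex.Re (val z) ^+ 2 + complex.Im (val z) ^+ 2 = 1.
Proof.
case: z => -[a b] /= /eqP; rewrite normc_def /= => -[] /(congr1 (fun r => r ^+ 2)).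
by rewrite sqr_sqrtr ?expr1n// addr_ge0 ?sqr_ge0.
Qed.

Lemma circle_eqP z w :
  complex.Re (val z) = complex.Re (val w) -> complex.Im (val z) = complex.Im (val w) ->
  z = w.
Proof.
by case: z w => -[a b] p [[c d] q] /= ac bd; apply/val_inj; rewrite /= ac bd.
Qed.

Lemma val_add z w : val (z + w) = val z * val w.
Proof. by []. Qed.

Lemma ReD z w : complex.Re (val (z + w)) =
  complex.Re (val z) * complex.Re (val w) - complex.Im (val z) * complex.Im (val w).
Proof. by rewrite val_add; case: (val z) (val w) => a b [c d]. Qed.

Lemma ImD z w : complex.Im (val (z + w)) =
  complex.Re (val z) * complex.Im (val w) + complex.Im (val z) * complex.Re (val w).
Proof. by rewrite val_add; case: (val z) (val w) => a b [c d]. Qed.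

Lemma val_oppr z : val (- z) = Complex (complex.Re (val z)) (- complex.Im (val z)).
Proof.
have zz := circle_norm z; have vz : val z != 0.
  by apply: contra_eq_neq (eqP (valP z)) => ->; rewrite normr0 eq_sym oner_neq0.
apply: (mulfI vz); rewrite [LHS]/= mulfV//.
case: (val z) zz {vz} => a b /= zz; apply/eqP; rewrite eq_complex /=.
by apply/andP; split; apply/eqP; nra.
Qed.

Lemma ReN z : complex.Re (val (- z)) = complex.Re (val z).
Proof. by rewrite val_oppr. Qed.

Lemma ImN z : complex.Im (val (- z)) = - complex.Im (val z).
Proof. by rewrite val_oppr. Qed.

Lemma expiD s t : expi (s + t) = expi s + expi t.
Proof.
apply: circle_eqP; rewrite ?ReD ?ImD /= ?cosD ?sinD //.
by rewrite addrC.
Qed.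

Lemma expi0 : expi 0 = 0 :> circle R.
Proof. by apply: circle_eqP; rewrite /= ?cos0 ?sin0. Qed.

Lemma expiN t : expi (- t) = - expi t.
Proof. by apply/eqP; rewrite -addr_eq0 -expiD addNr expi0. Qed.

Lemma expiB s t : expi (s - t) = expi s - expi t.
Proof. by rewrite expiD expiN. Qed.

Lemma expi2pi (k : int) : expi (k%:~R * (2 * pi)) = 0 :> circle R.
Proof.
have e1 : expi (2 * pi) = 0 :> circle R.
  by apply: circle_eqP; rewrite /= mulr_natl ?cos2pi ?sin2pi.
have en (n : nat) : expi (n%:R * (2 * pi)) = 0 :> circle R.
  elim: n => [|n IH]; first by rewrite mul0r expi0.
  by rewrite -natr1 mulrDl mul1r expiD IH e1 addr0.
by case: k => n; rewrite ?NegzE ?mulrNz ?mulNr ?expiN -pmulrn en ?oppr0.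
Qed.

(** The cosine is even and injective on [0, pi]. This is what makes continuous families of multiples
    of 2 pi locally constant: a variation of less than pi must be zero. *)
Lemma expi_eq0_small t : - pi <= t <= pi -> cos t = 1 -> t = 0.
Proof.
move=> /andP[t1 t2] ct.
have [t0|/ltW t0] := leP 0 t.
  by apply: cos_inj; rewrite ?in_itv/= ?t0 ?t2 ?lexx ?pi_ge0// ct cos0.
apply: oppr_inj; rewrite oppr0.
by apply: cos_inj; rewrite ?in_itv/= ?cosN ?ct ?cos0 ?lexx ?pi_ge0//
  lerNr oppr0 t0 lerNl.
Qed.

Lemma expi_eq0 t : expi t = 0 -> exists k : int, t = k%:~R * (2 * pi).
Proof.
move=> et; have p0 := pi_gt0 R; have pp : 0 < 2 * pi :> R by rewrite mulr_gt0.
(* This k brings t - 2 pi k into [-pi, pi[. *)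
set k := Num.floor ((t + pi) / (2 * pi)); exists k; apply/eqP; rewrite -subr_eq0.
have := floor_itv ((t + pi) / (2 * pi)); rewrite -/k ler_pdivlMr// ltr_pdivrMr//.
rewrite intrD => /andP[k1 k2].
apply/eqP; apply: expi_eq0_small; first by apply/andP; split; lra.
have : expi (t - k%:~R * (2 * pi)) = 0 :> circle R by rewrite expiB et expi2pi subrr.
move=> /(congr1 (fun z : circle R => complex.Re (val z))) e.
exact: (etrans e (erefl (1 : R))).
Qed.

Lemma expi_surj_itv z : exists2 t : R, - pi <= t <= pi & expi t = z.
Proof.
have := circle_norm z; set x := complex.Re (val z); set y := complex.Im (val z).
move=> xy; have x1 : -1 <= x <= 1 by apply/andP; split; have := sqr_ge0 y; nra.
have ax0 := acos_ge0 x1; have axp := acos_lepi x1; have p0 := pi_gt0 R.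
have cx : cos (acos x) = x by rewrite acosK// in_itv.
have sx : sin (acos x) = `|y|.
  by rewrite sin_acos// (_ : 1 - x ^+ 2 = y ^+ 2) ?sqrtr_sqr// -xy addrC addKr.
have [y0|y0] := leP 0 y.
  exists (acos x); first by rewrite axp (le_trans _ ax0)// oppr_le0 ltW.
  by apply: circle_eqP; rewrite /= ?cx ?sx ?ger0_norm.
exists (- acos x); first by rewrite lerN2 axp lerNl (le_trans _ ax0)// oppr_le0 ltW.
by apply: circle_eqP; rewrite /= ?cosN ?sinN ?cx ?sx ?ltr0_norm ?opprK.
Qed.

Lemma expi_surj z : exists t : R, expi t = z.
Proof. by have [t _ <-] := expi_surj_itv z; exists t. Qed.

(* tan (t / 2) = sin t / (1 + cos t); the value at z = -1 is meaningless. *)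
Definition angle z : R :=
  2 * atan (complex.Im (val z) / (1 + complex.Re (val z))).

Lemma expiK t : - pi < t < pi -> angle (expi t) = t.
Proof.
move=> /andP[t1 t2]; rewrite /angle /=.
have t3 : - (pi / 2) < t / 2 < pi / 2 by apply/andP; split; lra.
have c0 := cos_gt0_pihalf t3.
suff -> : sin t / (1 + cos t) = tan (t / 2) by rewrite tanK ?in_itv//; field.
rewrite {1 2}(_ : t = t / 2 *+ 2); last by rewrite mulr2n; field.
rewrite sin_mulr2n cos_mulr2n /tan; move: c0.
set c := cos _; set s := sin _ => /lt0r_neq0 c0.
have -> : 1 + (c ^+ 2 *+ 2 - 1) = c ^+ 2 *+ 2 by ring.
by field.
Qed.

Lemma expi_itv z : complex.Re (val z) != -1 ->
  exists2 t : R, - pi < t < pi & expi t = z.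
Proof.
have [t /andP[t1 t2] <-] := expi_surj_itv z; move=> /= ct; exists t => //.
rewrite !lt_neqAle t1 t2 !andbT; apply/andP; split; apply: contra_neq ct.
  by move=> <-; rewrite cosN cospi.
by move=> ->; rewrite cospi.
Qed.

Lemma angleK z : complex.Re (val z) != -1 -> expi (angle z) = z.
Proof. by move=> /expi_itv[t tp <-]; rewrite expiK. Qed.

Lemma angle_itv z : - pi < angle z < pi.
Proof.
have := atan_gtNpi2 (complex.Im (val z) / (1 + complex.Re (val z))).
have := atan_ltpi2 (complex.Im (val z) / (1 + complex.Re (val z))).
by rewrite /angle => ? ?; apply/andP; split; lra.
Qed.

Lemma angle0 : angle 0 = 0.
Proof. by rewrite /angle mul0r atan0 mulr0. Qed.

End CircleTopology.

(** * The circle as a charted space *)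

Section CircleManifold.
Context {R : realType}.
Implicit Types (s t : R) (z w : circle R).

Lemma circle_cvgP (T : topologicalType) (f : T -> circle R) :
  continuous (fun x => complex.Re (val (f x))) ->
  continuous (fun x => complex.Im (val (f x))) -> continuous f.
Proof.
move=> cr ci; apply: (@continuous_comp_initial _ _ _ (@circle_coord R)) => x.
exact: (cvg_pair (cr x) (ci x)).
Qed.

Lemma expi_continuous : continuous (@expi R).
Proof.
by apply: circle_cvgP; [exact: continuous_cos|exact: continuous_sin].
Qed.

Lemma circle_coord_continuous : continuous (@circle_coord R : circle R -> _).
Proof. exact: initial_continuous. Qed.

Lemma Re_continuous : continuous (fun z : circle R => complex.Re (val z)).
Proof.
move=> z; apply: (@continuous_comp _ _ _ (@circle_coord R) fst).
  exact: circle_coord_continuous.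
exact: cvg_fst. Qed.

Lemma Im_continuous : continuous (fun z : circle R => complex.Im (val z)).
Proof.
move=> z; apply: (@continuous_comp _ _ _ (@circle_coord R) snd).
  exact: circle_coord_continuous.
exact: cvg_snd. Qed.

Lemma circle_addr_continuous w : continuous (fun z => z + w).
Proof.
apply: circle_cvgP.
  under eq_fun do rewrite ReD.
  move=> z; exact: (cvgB (cvgM (@Re_continuous z) (cvg_cst _)) (cvgM (@Im_continuous z) (cvg_cst _))).
under eq_fun do rewrite ImD.
move=> z; exact: (cvgD (cvgM (@Re_continuous z) (cvg_cst _)) (cvgM (@Im_continuous z) (cvg_cst _))).
Qed.

Lemma open_ReN1 : open [set z : circle R | complex.Re (val z) != -1].
Proof.
apply: (@open_comp _ _ (fun z : circle R => complex.Re (val z)) [set x | x != -1]).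
  by move=> z _; exact: Re_continuous.
exact: open_neq.
Qed.

Lemma angle_continuous z : complex.Re (val z) != -1 -> {for z, continuous angle}.
Proof.
move=> zN1; have z1 : 1 + complex.Re (val z) != 0 by rewrite addrC addr_eq0.
have cf : {for z, continuous (fun w : circle R => complex.Im (val w) / (1 + complex.Re (val w)))}.
  exact: (cvgM (@Im_continuous z) (cvgV z1 (cvgD (cvg_cst _) (@Re_continuous z)))).
exact: (cvgM (cvg_cst _) (continuous_comp cf (@continuous_atan _ _))).
Qed.

(** The map z |-> t + angle(z - expi t) is a local section of [expi] through t, continuous off the
    antipode of [expi t]; the points it sends into A are values of [expi] on A. *)
Lemma expi_open (A : set R) : open A -> open (expi @` A : set (circle R)).
Proof.
move=> oA; apply: openS_nbhs => _ [t At <-].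
have e0 : expi t - expi t = 0 :> circle R by rewrite subrr.
have c0 : complex.Re (val (expi t - expi t : circle R)) != -1.
  by rewrite e0 [X in X != _](_ : _ = 1) // gt_eqF // (lt_trans (ltrN10 _)).
have cz : {for expi t, continuous (fun z : circle R => t + angle (z - expi t))}.
  exact: (cvgD (cvg_cst _)
    (continuous_comp (@circle_addr_continuous (- expi t) (expi t)) (angle_continuous c0))).
have nA : nbhs (t + angle (expi t - expi t)) A.
  by rewrite e0 angle0 addr0; exact: nbhs_open.
have nR := near_continuous (@circle_addr_continuous (- expi t) (expi t))
  (nbhs_open open_ReN1 c0).
apply: filterS2 nR (near_continuous cz nA) => z zN1 Az.
by exists (t + angle (z - expi t)) => //; rewrite expiD angleK// addrC subrK.
Qed.

Lemma Re_expi_neqN1 t : - pi < t < pi -> complex.Re (val (expi t : circle R)) != -1.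
Proof.
move=> tp; apply: contraTneq tp => cN1.
have [y0|y0] := leP 0 t; apply/negP => /andP[xp1 xp2].
  suff e : t = pi by rewrite e ltxx in xp2.
  by apply: cos_inj; rewrite ?in_itv/= ?y0 ?(ltW xp2) ?pi_ge0 ?lexx// cospi.
suff e : - t = pi by rewrite -e opprK ltxx in xp1.
apply: cos_inj; rewrite ?in_itv/= ?pi_ge0 ?lexx ?cosN ?cospi//.
by rewrite oppr_ge0 (ltW y0) lerNl (ltW xp1).
Qed.

(** The branch of the argument with values in ]t - pi, t + pi[: rotating by [- expi t] moves the cut
    of [angle], which lies at -1, to the antipode of [expi t]. *)
Definition circle_chart t : chart R (circle R) 1 :=
  Chart [set z | complex.Re (val (z - expi t)) != -1]
    [set x | t - pi < x 0 0 < t + pi]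
    (fun z => (t + angle (z - expi t))%:M)
    (fun x => expi (x 0 0)).

Lemma circle_chart_is_chart t : is_chart (circle_chart t).
Proof.
rewrite /circle_chart; split; rewrite /cdom /ccod /cmap /cinv.
- split.
    apply: (@open_comp _ _ (fun z => z - expi t) _ _ open_ReN1).
    by move=> z _; exact: circle_addr_continuous.
  apply: (@open_comp _ _ (fun x : 'rV[R]_1 => x 0 0) `]t - pi, t + pi[%classic).
    by move=> x _; exact: coord_continuous.
  exact: interval_open.
- move=> z zN1; have /andP[a1 a2] := angle_itv (z - expi t).
  rewrite /mkset mxE eqxx mulr1n !ltrD2l a1 a2; split=> //.
  by rewrite expiD angleK// addrC subrK.
- move=> x /andP[x1 x2]; rewrite /mkset -expiB.
  have xt : - pi < x 0 0 - t < pi by apply/andP; split; lra.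
  rewrite expiK// [t + _]addrC subrK; split; first exact: Re_expi_neqN1.
  by apply/rowP => i; rewrite !ord1 mxE eqxx mulr1n.
- move=> z zN1; apply: (@cvg_rV R _ (nbhs z) (nbhs_filter z)) => i; rewrite ord1.
  under eq_fun do rewrite mxE eqxx mulr1n; rewrite mxE eqxx mulr1n.
  exact: (cvgD (cvg_cst _)
    (continuous_comp (@circle_addr_continuous (- expi t) z) (angle_continuous zN1))).
- move=> x _; exact: (continuous_comp (@coord_continuous _ _ _ 0 0 x) (@expi_continuous _)).
Qed.

Lemma Ck_local (E F : normedModType R) k (W : set E) (f : E -> F) :
  (forall x, W x -> exists2 U, nbhs x U & Ck k U° f) -> Ck k W f.
Proof.
elim: k f => [|k IH] f H.
  by move=> x /H[U nU cf]; exact: cf (nbhs_singleton (nbhs_interior nU)).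
split=> [x /H[U nU [df _]]|v]; first exact: df (nbhs_singleton (nbhs_interior nU)).
by apply: IH => x /H[U nU [_ cf]]; exists U; last exact: cf.
Qed.

(** Both charts invert [expi], so a transition map differs from the identity by a multiple of 2 pi.
    By continuity this multiple is locally constant, and the transition map is locally a
    translation. *)
Lemma smooth_charts_circle : smooth_charts (circle_space R).
Proof.
split.
- by move=> c [].
- move=> z; have [t tz] := expi_surj z; exists (circle_chart t).
    by split; [exact: circle_chart_is_chart|].
  have zt : complex.Re (val (z - expi t)) != -1.
    by rewrite tz subrr [X in X != _](_ : _ = 1) // gt_eqF // (lt_trans (ltrN10 _)).
  exact: zt.
- move=> c c' [hc ec] [hc' ec'] k i; rewrite (ord1 i).
  have [[oc oc'] c1 c2 c3 c4] := hc; have [[od od'] d1 d2 d3 d4] := hc'.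
  set W := _ `&` _; have oW : open W by exact: open_transition.
  set g := fun x : 'rV[R]_1 => cmap c' (cinv c x) 0 0 : R^o.
  have eg x : W x -> expi (g x) = expi (x 0 0).
    by move=> [cx /= dx]; rewrite -(ec x cx) -(d1 _ dx).2 ec' ?(d1 _ dx).2//; exact: (d1 _ dx).1.
  have cg x : W x -> {for x, continuous (fun y => g y - y 0 0)}.
    move=> [cx /= dx]; have cc : {for x, continuous (fun y => cmap c' (cinv c y))}.
      exact: (continuous_comp (c4 _ cx) (d3 _ dx)).
    exact: (cvgB (continuous_comp cc (@coord_continuous _ _ _ 0 0 _)) (@coord_continuous _ _ _ 0 0 x)).
  apply: Ck_local => x Wx; have pi0 := pi_gt0 R.
  (* On this neighbourhood the difference with the identity varies by less than pi, so it does not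
     vary at all. *)
  exists (W `&` [set y | `|(g y - y 0 0) - (g x - x 0 0)| < pi]).
    apply: filterI; first exact: nbhs_open.
    have H : \forall y \near x, `|(g x - x 0 0) - (g y - y 0 0)| < pi.
      exact: (near_continuous (cg x Wx) (nbhsx_ballx _ _ pi0)).
    by apply: (filterS _ H) => y /=; rewrite distrC.
  apply: (@Ck_eq _ _ _ _ _ (fun y : 'rV[R]_1 => y 0 0 + (g x - x 0 0) : R^o)).
  + exact: open_interior.
  + move=> y /interior_subset[Wy yx].
    suff : (g y - y 0 0) - (g x - x 0 0) = 0 by rewrite /g => e; lra.
    apply: expi_eq0_small; first by rewrite -ler_norml ltW.
    have : expi ((g y - y 0 0) - (g x - x 0 0)) = 0 :> circle R.
      by rewrite expiB (expiB (g y)) (expiB (g x)) (eg y Wy) (eg x Wx) !subrr.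
    move=> /(congr1 (fun z : circle R => complex.Re (val z))) e.
    exact: (etrans e (erefl (1 : R))).
  + by apply: CkD; [exact: open_interior|exact: Ck_proj|exact: Ck_cst].
Qed.

End CircleManifold.

(** * The sheaves of the exponential sequence *)

Section SheafSections.
Context {R : realType}.
Implicit Types X Y : chartedSpace R.

Lemma derive_comp1 (E : normedModType R) (f : R -> R) (g : E -> R^o) (x v : E) :
  differentiable g x -> derivable f (g x) 1 ->
  'D_v (fun y => f (g y) : R^o) x = 'D_v g x * f^`()%classic (g x).
Proof.
move=> dg /derivable1_diffP df.
rewrite deriveE; last exact: (@differentiable_comp _ _ _ _ g f).
by rewrite (@diff_comp _ _ _ _ g f)//= diff1E// deriveE.
Qed.

(* The differential of the angle of a + ib is a db - b da, so no derivative of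
   the arctangent has to be iterated. *)
Lemma Ck_angle k (E : normedModType R) (W : set E) (u : E -> circle R) : open W ->
  (forall x, W x -> complex.Re (val (u x)) != -1) ->
  Ck k W (fun x => complex.Re (val (u x)) : R^o) ->
  Ck k W (fun x => complex.Im (val (u x)) : R^o) ->
  Ck k W (fun x => angle (u x) : R^o).
Proof.
move=> oW uN1; set a := fun x => complex.Re (val (u x)) : R^o.
set b := fun x => complex.Im (val (u x)) : R^o.
have a1 x : W x -> 1 + a x != 0 by move=> /uN1; rewrite addrC addr_eq0.
case: k => [|k].
  move=> ca cb x Wx.
  have cf : {for x, continuous (fun y => b y / (1 + a y))}.
    exact: (cvgM (cb x Wx) (cvgV (a1 x Wx) (cvgD (cvg_cst _) (ca x Wx)))).
  exact: (cvgM (cvg_cst _) (continuous_comp cf (@continuous_atan _ _))).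
move=> ca cb; have [da cda] := ca; have [db cdb] := cb.
have dt x : W x -> differentiable (fun y => angle (u y) : R^o) x.
  move=> Wx; apply: differentiableM; first exact: differentiable_cst.
  apply: (@differentiable_comp _ _ _ _ (fun y => b y / (1 + a y) : R^o) (@atan R)).
    apply: differentiableM; first exact: db.
    apply: (@differentiableV _ _ (fun y => 1 + a y)); last exact: a1.
    by apply: differentiableD; [exact: differentiable_cst|exact: da].
  by apply/derivable1_diffP; exact: derivable_atan.
split=> // v.
have H : Ck k W (fun x => a x * 'D_v b x + - (b x * 'D_v a x) : R^o).
  apply: (CkD oW); last apply: (CkN oW); apply: (CkM oW).
  - exact: CkS ca.
  - exact: cdb.
  - exact: CkS cb.
  - exact: cda.
apply: Ck_eq H => // x Wx.
have ea : \forall y \near x, cos (angle (u y)) = a y.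
  by apply: filterS (nbhs_open oW Wx) => y Wy; rewrite /a -[in RHS](angleK (uN1 _ Wy)).
have eb : \forall y \near x, sin (angle (u y)) = b y.
  by apply: filterS (nbhs_open oW Wx) => y Wy; rewrite /b -[in RHS](angleK (uN1 _ Wy)).
have := @near_eq_derive _ _ _ (fun y => cos (angle (u y)) : R^o) a x v ea.
have := @near_eq_derive _ _ _ (fun y => sin (angle (u y)) : R^o) b x v eb.
rewrite (derive_comp1 _ (dt _ Wx) (@derivable_cos _ _)).
rewrite (derive_comp1 _ (dt _ Wx) (@derivable_sin _ _)).
rewrite !derive1E !derive_val => <- <-.
rewrite -(nbhs_singleton ea) -(nbhs_singleton eb).
have := cos2Dsin2 (angle (u x)); set t := 'D_v _ x => e.
transitivity (t * (cos (angle (u x)) ^+ 2 + sin (angle (u x)) ^+ 2)); first by ring.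
by rewrite e mulr1.
Qed.

Lemma smooth_fun_angle X (u : X -> circle R) x : smooth_charts X ->
  is_section (c := sheafT R) u x -> complex.Re (val (u x)) != -1 ->
  smooth_fun_at (fun y => angle (u y)) x.
Proof.
move=> hX [sr si] uN1; have [_ /(_ x)[c ac cx] _] := hX.
have [N nN cf] := smooth_fun_elim hX ac cx sr.
have [N' nN' cg] := smooth_fun_elim hX ac cx si.
have nR : \forall y \near x, complex.Re (val (u y)) != -1.
  exact: (near_continuous (smooth_fun_continuous hX sr) (nbhs_open (@open_neq R (-1)) uN1)).
move: nR => /(near_chart hX _ ac cx) nR.
apply: (smooth_fun_intro hX ac cx).
exists (N `&` N' `&` [set t | ccod c t /\ complex.Re (val (u (cinv c t))) != -1]).
  by apply: filterI => //; exact: filterI.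
move=> k; apply: Ck_angle; first exact: open_interior.
- by move=> t /interior_subset[_ []].
- by apply: sub_Ck (cf k) => t; rewrite !interiorI => -[[]].
- by apply: sub_Ck (cg k) => t; rewrite !interiorI => -[[]].
Qed.

(** A [coeff] carries no axioms. The ones used are that being a section is an open condition, that
    it depends on the germ only, and that sections form a group; [is_sheaf] adds stability under
    smooth pullback, for the face maps. *)
Definition is_sheaf_on (A : coeff R) X : Prop :=
  [/\ forall (u : X -> A) x, is_section u x -> \forall y \near x, is_section u y,
      forall (u v : X -> A) x, (\forall y \near x, u y = v y) ->
        is_section u x -> is_section v x,
      forall x, is_section (fun _ : X => 0 : A) x &
      forall (u v : X -> A) x, is_section u x -> is_section v x ->
        is_section (fun y => u y - v y) x].

Definition is_sheaf (A : coeff R) : Prop :=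
  (forall X, smooth_charts X -> is_sheaf_on A X) /\
  (forall X Y (phi : X -> Y) (u : Y -> A) x, smooth_charts X -> smooth_charts Y ->
     smooth_at phi x -> is_section u (phi x) -> is_section (fun y => u (phi y)) x).

Lemma sheafZ_is_sheaf : is_sheaf (sheafZ R).
Proof.
split=> [X hX|X Y phi u x hX hY [cphi _] su]; last exact: near_continuous su.
split=> /=.
- move=> u x e; apply: (filterS _ (near_join e)) => y ey.
  by apply: (filterS _ ey) => z ->; rewrite (nbhs_singleton ey).
- move=> u v x e su; near=> y.
  have <- : u y = v y by near: y.
  by rewrite -(nbhs_singleton e); near: y.
- by move=> x; exact: nearW.
- move=> u v x su sv; near=> y.
  by congr (_ - _); near: y.
Unshelve. all: by end_near. Qed.

Lemma sheafR_is_sheaf : is_sheaf (sheafR R).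
Proof.
split=> [X hX|X Y phi u x hX hY]; last exact: smooth_fun_comp.
split=> /=.
- by move=> u x; exact: smooth_fun_near.
- by move=> u v x; exact: smooth_fun_near_eq.
- by move=> x; exact: smooth_fun_cst.
- by move=> u v x su sv; apply: smooth_funD => //; exact: smooth_funN.
Qed.

Lemma sheafT_is_sheaf : is_sheaf (sheafT R).
Proof.
split=> [X hX|X Y phi u x hX hY sphi [sr si]]; last first.
  split; first exact: (smooth_fun_comp (f := fun y => complex.Re (val (u y)))).
  exact: (smooth_fun_comp (f := fun y => complex.Im (val (u y)))).
split; last 1 first.
- move=> u v x [sr si] [tr ti]; split.
    under eq_fun do rewrite ReD ReN ImN.
    apply: smooth_funD => //; first exact: smooth_funM.
    by apply: smooth_funN => //; apply: smooth_funM => //; exact: smooth_funN.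
  under eq_fun do rewrite ImD ReN ImN.
  apply: smooth_funD => //; last exact: smooth_funM.
  by apply: smooth_funM => //; exact: smooth_funN.
- by move=> u x [sr si]; apply: filterI; exact: smooth_fun_near.
- move=> u v x e [sr si]; split.
    by apply: smooth_fun_near_eq sr => //; apply: (filterS _ e) => y ->.
  by apply: smooth_fun_near_eq si => //; apply: (filterS _ e) => y ->.
- by move=> x; split; exact: smooth_fun_cst.
Qed.

(** Exactness of the exponential sequence at T on germs: after division by the value of u at x, the
    section takes values near 1, where [angle] is a smooth logarithm. *)
Lemma section_lift X (u : X -> circle R) x : smooth_charts X ->
  is_section (c := sheafT R) u x ->
  exists2 r : X -> R, smooth_fun_at r x & \forall y \near x, expi (r y) = u y.
Proof.
move=> hX su; have [t tu] := expi_surj (u x).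
have [[_ _ sT0 sTB] _] := (sheafT_is_sheaf.1 X hX, 0%N).
have st : is_section (c := sheafT R) (fun _ : X => expi t) x.
  by split; exact: smooth_fun_cst.
have sw := sTB _ _ x su st; have wN1 : complex.Re (val (u x - expi t)) != -1.
  by rewrite tu subrr [X in X != _](_ : _ = 1) // gt_eqF // (lt_trans (ltrN10 _)).
exists (fun y => t + angle (u y - expi t)).
  by apply: smooth_funD => //; [exact: smooth_fun_cst|exact: smooth_fun_angle].
have nR : \forall y \near x, complex.Re (val (u y - expi t)) != -1.
  exact: (near_continuous (smooth_fun_continuous hX sw.1) (nbhs_open (@open_neq R (-1)) wN1)).
by apply: (filterS _ nR) => y yN1; rewrite expiD angleK// addrC subrK.
Qed.

(** The floor only serves to make division by 2 pi integer-valued; the function is meant for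
    multiples of 2 pi. *)
Definition turns (t : R) : int := Num.floor (t / (2 * pi)).

Lemma turnsK t : expi t = 0 -> (turns t)%:~R * (2 * pi) = t.
Proof.
move=> /expi_eq0[k ->]; rewrite /turns mulfK ?intrKfloor//.
by rewrite mulf_neq0 ?pnatr_eq0// gt_eqF// pi_gt0.
Qed.

Lemma section_turns X (r : X -> R) x :
  {for x, continuous r} -> (\forall y \near x, expi (r y) = 0) ->
  is_section (c := sheafZ R) (fun y => turns (r y)) x.
Proof.
move=> cr er; have p0 := pi_gt0 R.
have nr : \forall y \near x, `|r x - r y| < pi.
  exact: (near_continuous cr (nbhsx_ballx _ _ p0)).
suff H : \forall y \near x, turns (r y) = turns (r x) by exact: H.
near=> y; have ey : expi (r y) = 0 by near: y.
have yx : `|r x - r y| < pi by near: y.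
congr turns.
apply/esym/eqP; rewrite -subr_eq0; apply/eqP; apply: expi_eq0_small.
  by rewrite -ler_norml ltW.
have : expi (r x - r y) = 0 :> circle R by rewrite expiB ey (nbhs_singleton er) subrr.
move=> /(congr1 (fun z : circle R => complex.Re (val z))) e.
exact: (etrans e (erefl (1 : R))).
Unshelve. all: by end_near. Qed.

End SheafSections.

(** * The total complex *)

Section IteratedNear.
Context {R : realType}.
Implicit Types X Y : chartedSpace R.

(** The lists met by [iter_near] have length q + 1 and end in the point at which the germ is taken.
    Every later length condition is extracted from this lemma. *)
Lemma iter_near_sub X q (P Q : seq X -> X -> Prop) x :
  (forall l z, size l = q -> P (rcons l z) z -> Q (rcons l z) z) ->
  iter_near q P x -> iter_near q Q x.
Proof.
elim: q P Q x => [|q IH] P Q x PQ /=; first exact: (PQ [::]).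
apply: filterS => y; apply: IH => l z lq; exact: (PQ (x :: l) z (congr1 S lq)).
Qed.

Lemma iter_near_mono X q (P Q : seq X -> X -> Prop) x :
  (forall l z, P l z -> Q l z) -> iter_near q P x -> iter_near q Q x.
Proof. by move=> PQ; apply: iter_near_sub => l z _; exact: PQ. Qed.

Lemma iter_nearW X q (P : seq X -> X -> Prop) x :
  (forall l z, size l = q -> P (rcons l z) z) -> iter_near q P x.
Proof.
elim: q P x => [|q IH] P x HP /=; first exact: (HP [::]).
by apply: nearW => y; apply: IH => l z lq; exact: (HP (x :: l) z (congr1 S lq)).
Qed.

Lemma iter_nearI X q (P Q : seq X -> X -> Prop) x :
  iter_near q P x -> iter_near q Q x -> iter_near q (fun l z => P l z /\ Q l z) x.
Proof.
elim: q P Q x => [|q IH] P Q x //=.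
by apply: filterS2 => y; exact: IH.
Qed.

Lemma iter_near_forall X q n (P : 'I_n -> seq X -> X -> Prop) x :
  (forall i, iter_near q (P i) x) -> iter_near q (fun l z => forall i, P i l z) x.
Proof.
elim: q P x => [|q IH] P x //= HP.
have H : \forall y \near x, forall i, iter_near q (fun l z => P i (x :: l) z) y.
  by apply: filter_forall => i; exact: HP.
by apply: (filterS _ H) => y; exact: IH.
Qed.

Lemma iter_near_open X q (D : set X) x :
  open D -> D x -> iter_near q (fun _ z => D z) x.
Proof.
move=> oD; elim: q x => [|q IH] x Dx //=.
by apply: (filterS _ (nbhs_open oD Dx)) => y; exact: IH.
Qed.

Lemma iter_near_pull X Y q (f : Y -> X) (P : seq X -> X -> Prop) y :
  continuous f -> iter_near q P (f y) -> iter_near q (fun l z => P (map f l) (f z)) y.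
Proof.
move=> cf; elim: q P y => [|q IH] P y //= HP.
by apply: (filterS _ (near_continuous (cf y) HP)) => z; exact: IH.
Qed.

(** The set D is a parameter because inductions on q restart, at the next point, from the open set
    on which the remaining conditions hold. *)
Definition gnear X (D : set X) q (P : seq X -> X -> Prop) :=
  forall x, D x -> iter_near q P x.

Definition germ_open X (P : seq X -> X -> Prop) :=
  forall l z, P l z -> \forall y \near z, P l y.

Lemma germ_open_cons X (P : seq X -> X -> Prop) x :
  germ_open P -> germ_open (fun l z => P (x :: l) z).
Proof. by move=> oP l z; exact: oP. Qed.

Lemma gnear_interior X q (P : seq X -> X -> Prop) :
  gnear [set y | iter_near q P y]° q P.
Proof. by move=> y /interior_subset. Qed.

(** Skipping an interior point is harmless, since its neighbour may be chosen as close as wanted.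
    When the last point is skipped the germ is evaluated at a point near its own base point, and
    [germ_open] is needed. *)
Lemma gnear_delete X (D : set X) q (P : seq X -> X -> Prop) i :
  open D -> germ_open P -> gnear D q P -> (i <= q.+1)%N ->
  gnear D q.+1 (fun l z => P (take i l ++ drop i.+1 l) z).
Proof.
elim: i q D P => [|i IH] q D P oD oP HP iq x Dx.
  rewrite /=; apply: (filterS _ (nbhs_open oD Dx)) => y Dy.
  by apply: iter_near_mono (HP y Dy) => l z; rewrite ?take0 ?drop0.
case: q HP iq => [|q] HP iq.
  (* Here the skipped point is the last one: the list is [:: x], but the germ is read at y. *)
  rewrite /=; apply: (filterS _ (oP _ _ (HP x Dx))) => y.
  by move: iq; rewrite ltnS leqn0 => /eqP ->.
(* The induction continues with the interior of the set of admissible second points in place of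
   D. *)
have nD := nbhs_interior (HP x Dx).
apply: (filterS _ nD) => y Dy.
exact: (IH q _ _ (@open_interior _ _) (germ_open_cons oP) (@gnear_interior _ _ _) iq).
Qed.

(** The property concerns a germ at x_r and is claimed at the later point x_q, to which [germ_open]
    carries it step by step. *)
Lemma gnear_take X (D : set X) q r (P : seq X -> X -> Prop) :
  germ_open P -> gnear D r P -> (r <= q)%N ->
  gnear D q (fun l z => P (take r.+1 l) z).
Proof.
elim: q r D P => [|q IH] r D P oP HP rq x Dx.
  by move: rq HP; rewrite leqn0 => /eqP -> /(_ x Dx).
case: r HP rq => [|r] HP rq.
  have nD := nbhs_interior (oP _ _ (HP x Dx)).
  apply: (filterS _ nD) => y Dy.
  apply: iter_near_mono (iter_near_open q (@open_interior _ _) Dy) => l z.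
  by move=> /interior_subset; rewrite /= take0.
have nD := nbhs_interior (HP x Dx).
apply: (filterS _ nD) => y Dy.
exact: (IH r _ _ (germ_open_cons oP) (@gnear_interior _ _ _) rq).
Qed.

Lemma gnear_drop X (D : set X) q r (P : seq X -> X -> Prop) :
  open D -> gnear D q P -> gnear D (r + q) (fun l z => P (drop r l) z).
Proof.
move=> oD HP; elim: r => [|r IH] x Dx.
  by apply: iter_near_mono (HP x Dx) => l z; rewrite drop0.
by apply: (filterS _ (nbhs_open oD Dx)) => y Dy; exact: IH.
Qed.

End IteratedNear.

(** * Signs and alternating sums *)

Section Signs.
Implicit Types V W : zmodType.

Lemma sgnE V k (v : V) : sgn k v = v *~ ((-1) ^+ k).
Proof. by rewrite /sgn -signr_odd; case: (odd k); rewrite ?expr1 ?mulrN1z. Qed.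

Lemma sgn_sgn V j k (v : V) : sgn j (sgn k v) = sgn (k + j) v.
Proof. by rewrite !sgnE -mulrzA exprD. Qed.

Lemma sgn_addn2 V k i (v : V) : sgn (k + i.*2) v = sgn k v.
Proof. by rewrite /sgn oddD odd_double addbF. Qed.

Lemma sgnD V k (v w : V) : sgn k (v + w) = sgn k v + sgn k w.
Proof. by rewrite !sgnE mulrzDl. Qed.

Lemma sgnN V k (v : V) : sgn k (- v) = - sgn k v.
Proof. by rewrite !sgnE mulNrz. Qed.

Lemma sgnS V k (v : V) : sgn k.+1 v = - sgn k v.
Proof. by rewrite !sgnE exprS mulN1r mulrNz. Qed.

Lemma sgn0 V k : sgn k (0 : V) = 0.
Proof. by rewrite sgnE mul0rz. Qed.

Lemma sgn_sum V k I (r : seq I) (P : pred I) (F : I -> V) :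
  sgn k (\sum_(i <- r | P i) F i) = \sum_(i <- r | P i) sgn k (F i).
Proof. by elim/big_rec2: _ => [|i x y _ <-]; rewrite ?sgn0 ?sgnD. Qed.

Lemma sgn_morph V W (f : V -> W) k v :
  (forall u w, f (u - w) = f u - f w) -> f (sgn k v) = sgn k (f v).
Proof.
move=> fB; have f0 : f 0 = 0 by have := fB 0 0; rewrite !subrr.
by rewrite /sgn; case: ifP => // _; rewrite -[- v]add0r fB f0 add0r.
Qed.

(** The hypothesis is the simplicial identity: for i <= j the terms (i, j) and (j + 1, i) have the
    same value and opposite signs. Both the Godement and the groupoid differential square to zero
    through it. *)
Lemma alternating_double_sum V n (F : nat -> nat -> V) :
  (forall i j, (i <= j < n)%N -> F j.+1 i = F i j) ->
  \sum_(i < n.+1) sgn i (\sum_(j < n) sgn j (F i j)) = 0.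
Proof.
move=> FE; under eq_bigr do rewrite sgn_sum.
pose G i j := sgn i (sgn j (F i j)).
rewrite (eq_bigr (fun i : 'I_n.+1 => \sum_(j < n | (i <= j)%N) G i j +
   \sum_(j < n | (j < i)%N) G i j)); last first.
  move=> i _; rewrite (bigID (fun j : 'I_n => (i <= j)%N)) /=; congr (_ + _).
  by apply: eq_bigl => j; rewrite -ltnNge.
rewrite big_split /= big_ord_recr /= [X in _ + X + _]big1 ?addr0; last first.
  by move=> j; rewrite leqNgt ltn_ord.
rewrite big_ord_recl /= [X in _ + (X + _)]big1 // add0r.
rewrite (exchange_big_dep predT) //= -big_split /=; apply: big1 => j _.
rewrite (eq_bigl (fun i : 'I_n => (i <= j)%N)) //.
rewrite -big_split /=; apply: big1 => i ij.
rewrite /G FE ?ij //= sgn_sgn sgn_sgn /bump add1n addnS sgnS addnC.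
by rewrite subrr.
Qed.

End Signs.

Section GodementDifferential.
Context {R : realType}.
Implicit Types (A B : coeff R) (X Y : chartedSpace R).

Definition delete (T : Type) i (l : seq T) := take i l ++ drop i.+1 l.
Arguments delete : simpl never.

Lemma delete_cons (T : Type) i (x : T) l : delete i.+1 (x :: l) = x :: delete i l.
Proof. by []. Qed.

Lemma delete0 (T : Type) (x : T) l : delete 0 (x :: l) = l.
Proof. by rewrite /delete /= drop0. Qed.

Lemma size_delete (T : Type) i (l : seq T) :
  (i < size l)%N -> size (delete i l) = (size l).-1.
Proof.
by move=> il; rewrite /delete size_cat size_take size_drop il; lia.
Qed.

Lemma deleteC (T : Type) i j (l : seq T) : (i <= j)%N ->
  delete i (delete j.+1 l) = delete j (delete i l).
Proof.
elim: l i j => [|x l IH] i j; first by [].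
case: i => [|i]; first by rewrite delete_cons !delete0.
by case: j => // j ij; rewrite !delete_cons IH.
Qed.

Lemma gdiffE A X (s : gcochain A X) l x :
  (1 < size l)%N -> gdiff s l x = \sum_(i < size l) sgn i (s (delete i l) x).
Proof. by rewrite /gdiff ltnNge => /negbTE ->. Qed.

Lemma gdiff1 A X (s : gcochain A X) l x : (size l <= 1)%N -> gdiff s l x = 0.
Proof. by rewrite /gdiff => ->. Qed.

Lemma gdiff_morph A B X (f : A -> B) (s : gcochain A X) l x :
  (forall u v, f (u - v) = f u - f v) ->
  gdiff (A := B) (fun l x => f (s l x)) l x = f (gdiff s l x).
Proof.
move=> fB; have f0 : f 0 = 0 by have := fB 0 0; rewrite !subrr.
have fD u v : f (u + v) = f u + f v by rewrite -{1}[v]opprK fB -[- v]add0r fB f0 add0r opprK.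
rewrite /gdiff; case: ifP => // _.
rewrite (big_morph f fD f0); apply: eq_bigr => i _.
by rewrite (sgn_morph _ _ fB).
Qed.

Lemma gdiffD A X (s t : gcochain A X) l x :
  gdiff (A := A) (fun l x => s l x + t l x) l x = gdiff s l x + gdiff t l x.
Proof.
rewrite /gdiff; case: ifP => _; first by rewrite addr0.
by rewrite -big_split; apply: eq_bigr => i _; rewrite sgnD.
Qed.

Lemma gdiff_pull A X Y (f : Y -> X) (s : gcochain A X) l y :
  gdiff (A := A) (fun l y => s (map f l) (f y)) l y = gdiff s (map f l) (f y).
Proof.
rewrite /gdiff size_map; case: ifP => // _.
by apply: eq_bigr => i _; rewrite map_cat map_take map_drop.
Qed.

Lemma gdiff_gdiff A X (s : gcochain A X) l x : gdiff (gdiff s) l x = 0.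
Proof.
have [l1|l1] := leqP (size l) 1; first exact: gdiff1.
rewrite gdiffE//; case E : (size l) l1 => [//|n] l1.
(* For a list of length 2 the inner differential meets singletons, where [gdiff] is 0 by
   convention. *)
have [n1|n1] := leqP n 1.
  apply: big1 => i _; rewrite gdiff1 ?sgn0// size_delete ?E//.
rewrite (eq_bigr (fun i : 'I_n.+1 =>
  sgn i (\sum_(j < n) sgn j (s (delete j (delete i l)) x)))).
  apply: (alternating_double_sum (F := fun i j => s (delete j (delete i l)) x)).
  by move=> i j /andP[ij _]; rewrite deleteC.
by move=> i _; rewrite gdiffE size_delete E.
Qed.

End GodementDifferential.

Section TotalComplex.
Context {R : realType} {Gam : nerve R}.
Implicit Types A B : coeff R.

(** A [nerve] carries no axioms; these make it a presimplicial manifold with open subspaces [gdom]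
    stable under faces. The simplicial identity is required on all of [gspace], so that identities
    between pullbacks are equalities of functions. *)
Definition good_nerve : Prop :=
  [/\ forall p, smooth_charts (gspace Gam p),
      forall p, open (@gdom _ Gam p),
      forall p i (x : gspace Gam p.+1), smooth_at (@gface _ Gam p i) x,
      forall p i (x : gspace Gam p.+1), gdom x -> gdom (gface i x) &
      forall p i j (x : gspace Gam p.+2), (i <= j)%N ->
        gface i (gface j.+1 x) = gface j (gface i x)].

Definition pull A p i (s : gcochain A (gspace Gam p)) : gcochain A (gspace Gam p.+1) :=
  fun l x => s (map (gface i) l) (gface i x).

Lemma hdiffS A (c : cochain Gam A) p l x :
  hdiff c (p := p.+1) l x = \sum_(i < p.+2) sgn i (pull i (c p) l x).
Proof. by []. Qed.

Lemma hdiff_morph A B (f : A -> B) (c : cochain Gam A) p l x :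
  (forall u v, f (u - v) = f u - f v) ->
  hdiff (A := B) (fun p l x => f (c p l x)) (p := p) l x = f (hdiff c l x).
Proof.
move=> fB; have f0 : f 0 = 0 by have := fB 0 0; rewrite !subrr.
have fD u v : f (u + v) = f u + f v by rewrite -{1}[v]opprK fB -[- v]add0r fB f0 add0r opprK.
case: p l x => [|p] l x //; rewrite hdiffS (big_morph f fD f0).
by apply: eq_bigr => i _; rewrite (sgn_morph _ _ fB).
Qed.

Lemma tdiff_morph A B (f : A -> B) (c : cochain Gam A) p l x :
  (forall u v, f (u - v) = f u - f v) ->
  tdiff (A := B) (fun p l x => f (c p l x)) (p := p) l x = f (tdiff c l x).
Proof.
move=> fB; have f0 : f 0 = 0 by have := fB 0 0; rewrite !subrr.
have fD u v : f (u + v) = f u + f v by rewrite -{1}[v]opprK fB -[- v]add0r fB f0 add0r opprK.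
by rewrite /tdiff fD (hdiff_morph _ _ _ fB) (gdiff_morph (B := B) _ _ _ fB) (sgn_morph _ _ fB).
Qed.

Lemma tdiffN A (c : cochain Gam A) p l x :
  tdiff (A := A) (fun p l x => - c p l x) (p := p) l x = - tdiff c l x.
Proof. by rewrite (tdiff_morph (f := fun u : A => - u)) // => u v; rewrite opprB opprK addrC. Qed.

Lemma tdiffD A (c d : cochain Gam A) p l x :
  tdiff (A := A) (fun p l x => c p l x + d p l x) (p := p) l x = tdiff c l x + tdiff d l x.
Proof.
rewrite /tdiff gdiffD sgnD addrACA; congr (_ + _).
case: p l x => [|p] l x; first by rewrite addr0.
by rewrite !hdiffS -big_split; apply: eq_bigr => i _; rewrite /pull sgnD.
Qed.

Lemma tdiffB A (c d : cochain Gam A) p l x :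
  tdiff (A := A) (fun p l x => c p l x - d p l x) (p := p) l x = tdiff c l x - tdiff d l x.
Proof. by rewrite (tdiffD c (fun p l x => - d p l x)) tdiffN. Qed.

Lemma pull_pull A p i j (s : gcochain A (gspace Gam p)) : good_nerve -> (i <= j)%N ->
  pull i (pull j s) = pull j.+1 (pull i s).
Proof.
move=> [_ _ _ _ face] ij; apply/funext => l; apply/funext => x.
rewrite /pull -face// -!map_comp; congr (s _ _); apply: eq_map => y /=.
by rewrite face.
Qed.

(** The horizontal and vertical squares vanish separately, and the mixed terms cancel because the
    sign (-1)^p changes between neighbouring columns. The equality holds at every list and point,
    not only up to germs. *)
Lemma tdiff_tdiff A (c : cochain Gam A) p l x : good_nerve ->
  tdiff (tdiff c) (p := p) l x = 0.
Proof.
move=> good; rewrite {1}/tdiff.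
have -> : hdiff (tdiff c) (p := p) l x = hdiff (hdiff c) (p := p) l x +
    hdiff (A := A) (fun p l x => sgn p (gdiff (c p) l x)) (p := p) l x.
  case: p l x => [|p] l x; first by rewrite addr0.
  by rewrite !hdiffS -big_split; apply: eq_bigr => i _; rewrite /pull sgnD.
have -> : hdiff (hdiff c) (p := p) l x = 0.
  case: p l x => [|[|p]] l x //.
    by rewrite hdiffS big1 // => i _; rewrite /pull /= sgn0.
  rewrite hdiffS; pose F i j := pull i (pull j (c p)) l x.
  rewrite (eq_bigr (fun i : 'I_p.+3 => sgn i (\sum_(j < p.+2) sgn j (F i j)))) //.
  apply: alternating_double_sum => i j /andP[ij _].
  by rewrite /F (pull_pull (i := i)).
have -> : gdiff (tdiff c (p := p)) l x = gdiff (hdiff c (p := p)) l x.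
  rewrite [LHS](gdiffD (hdiff c (p := p)) (fun l x => sgn p (gdiff (c p) l x))).
  rewrite (gdiff_morph (B := A) (f := sgn p)) ?gdiff_gdiff ?sgn0 ?addr0//.
  by move=> u v; rewrite sgnD sgnN.
rewrite add0r; case: p l x => [|p] l x; first
  by rewrite add0r sgnE (gdiff_morph (f := fun _ : A => 0 : A)) ?mul0rz// => _ _; rewrite subr0.
have -> : gdiff (hdiff c (p := p.+1)) l x = \sum_(i < p.+2) sgn i (pull i (gdiff (c p)) l x).
  have [l1|l1] := leqP (size l) 1.
    by rewrite gdiff1// big1// => i _; rewrite /pull gdiff1 ?sgn0// size_map.
  rewrite gdiffE// (eq_bigr (fun j : 'I_(size l) =>
    \sum_(i < p.+2) sgn j (sgn i (pull i (c p) (delete j l) x)))); last first.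
    by move=> j _; rewrite hdiffS sgn_sum.
  rewrite exchange_big /=; apply: eq_bigr => i _.
  rewrite /pull gdiffE size_map// sgn_sum; apply: eq_bigr => j _.
  by rewrite !sgn_sgn addnC /delete map_cat map_take map_drop.
rewrite hdiffS sgn_sum -big_split; apply: big1 => i _.
by rewrite /pull /= !sgn_sgn addnS sgnS (addnC p) subrr.
Qed.

End TotalComplex.
Arguments good_nerve {R} Gam.

(** * Section conditions and null cochains *)

Section TotalSections.
Context {R : realType} {Gam : nerve R}.
Implicit Types A B : coeff R.

(** The zero subsheaf of the sheaf of all functions. Being null up to germs becomes a section
    condition, so the stability of sections under D, sums and cup products yields that of null
    cochains. *)
Definition germ0 A : coeff R :=
  @Coeff R A (fun X u x => \forall y \near x, u y = 0).

Lemma germ0_is_sheaf A : is_sheaf (germ0 A).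
Proof.
split=> [X hX|X Y phi u x hX hY [cphi _] su]; last exact: near_continuous su.
split=> /=.
- by move=> u x; exact: near_join.
- move=> u v x e su; near=> y.
  have <- : u y = v y by near: y.
  by near: y.
- by move=> x; exact: nearW.
- move=> u v x su sv; near=> y.
  have -> : u y = 0 by near: y.
  have -> : v y = 0 by near: y.
  by rewrite subr0.
Unshelve. all: by end_near. Qed.

Section OnSpace.
Variables (A : coeff R) (X : chartedSpace R).
Hypothesis hA : is_sheaf_on A X.
Implicit Types (u v : X -> A) (x : X).

Lemma section0 x : is_section (fun _ : X => 0 : A) x.
Proof. by have [_ _ + _] := hA; apply. Qed.

Lemma sectionB u v x : is_section u x -> is_section v x ->
  is_section (fun y => u y - v y) x.
Proof. by have [_ _ _ +] := hA; apply. Qed.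

Lemma sectionN u x : is_section u x -> is_section (fun y => - u y) x.
Proof.
by move=> su; have := sectionB (section0 x) su; under eq_fun do rewrite sub0r.
Qed.

Lemma sectionD u v x : is_section u x -> is_section v x ->
  is_section (fun y => u y + v y) x.
Proof.
by move=> su sv; have := sectionB su (sectionN sv); under eq_fun do rewrite opprK.
Qed.

Lemma section_sgn k u x : is_section u x -> is_section (fun y => sgn k (u y)) x.
Proof. by rewrite /sgn; case: (odd k) => //; exact: sectionN. Qed.

Lemma section_sum (I : Type) (r : seq I) (P : pred I) (u : I -> X -> A) x :
  (forall i, P i -> is_section (u i) x) ->
  is_section (fun y => \sum_(i <- r | P i) u i y) x.
Proof.
move=> su; elim: r => [|i r IH].
  by under eq_fun do rewrite big_nil; exact: section0.
case Pi: (P i); under eq_fun do rewrite big_cons Pi; last exact: IH.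
by apply: sectionD => //; exact: su.
Qed.

Lemma section_mulrz (m : int) u x : is_section u x -> is_section (fun y => u y *~ m) x.
Proof.
move=> su; have sn (n : nat) : is_section (fun y => u y *+ n) x.
  elim: n => [|n IH]; first by under eq_fun do rewrite mulr0n; exact: section0.
  by under eq_fun do rewrite mulrS; exact: sectionD.
case: m => n; first exact: sn.
by under eq_fun do rewrite NegzE mulrNz; exact: (sectionN (sn n.+1)).
Qed.

Lemma section_near_eq u v x :
  (\forall y \near x, u y = v y) -> is_section u x -> is_section v x.
Proof. by have [_ + _ _] := hA; apply. Qed.

Lemma section_germ_open (s : gcochain A X) : germ_open (fun l z => is_section (s l) z).
Proof. by move=> l z; have [+ _ _ _] := hA; apply. Qed.

Lemma gsection_gdiff (D : set X) q (s : gcochain A X) : open D ->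
  gsection D q s -> gsection D q.+1 (gdiff s).
Proof.
move=> oD ss x Dx; pose P (i : 'I_q.+2) l z := is_section (s (delete i l)) z.
have HP i : iter_near q.+1 (P i) x.
  apply: (gnear_delete (P := fun l z => is_section (s l) z) oD) => //.
    exact: section_germ_open.
  by rewrite -ltnS ltn_ord.
apply: iter_near_sub (iter_near_forall HP) => l z lq; rewrite /P => Hs.
have ls : size (rcons l z) = q.+2 by rewrite size_rcons lq.
rewrite (_ : gdiff s (rcons l z) = fun y =>
  \sum_(i < q.+2) sgn i (s (delete i (rcons l z)) y)); last first.
  by apply/funext => y; rewrite gdiffE ls.
by apply: section_sum => i _; apply: section_sgn; exact: Hs.
Qed.

End OnSpace.

Hypothesis good : good_nerve Gam.

Lemma gdom_open p : open (@gdom _ Gam p).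
Proof. by have [_ + _ _ _] := good; apply. Qed.

Lemma gdom_face p i (x : gspace Gam p.+1) : gdom x -> gdom (gface i x).
Proof. by have [_ _ _ + _] := good; apply. Qed.

Lemma gface_continuous p i : continuous (@gface _ Gam p i).
Proof. by move=> x; have [_ _ + _ _] := good => /(_ p i x)[]. Qed.

Section Coefficient.
Variable A : coeff R.
Hypothesis sA : is_sheaf A.

Lemma sheaf_on p : is_sheaf_on A (gspace Gam p).
Proof. by have [+ _ _ _ _] := good => ch; exact: sA.1. Qed.

Lemma gsection_pull p q i (s : gcochain A (gspace Gam p)) :
  gsection (@gdom _ Gam p) q s -> gsection (@gdom _ Gam p.+1) q (pull i s).
Proof.
move=> ss x dx.
have := iter_near_pull (@gface_continuous p i) (ss _ (gdom_face i dx)).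
have [ch _ fs _ _] := good; apply: iter_near_mono => l z.
exact: (sA.2 _ _ (gface i) _ _ (ch _) (ch _) (fs _ _ _)).
Qed.

Lemma tsection_tdiff n (c : cochain Gam A) : tsection n c -> tsection n.+1 (tdiff c).
Proof.
move=> sc p pn x dx.
have sv : iter_near (n.+1 - p) (fun l z => is_section (sgn p \o gdiff (c p) l) z) x.
  have [pn'|pn'] := leqP p n.
    rewrite subSn//; have := gsection_gdiff (sheaf_on p) (@gdom_open p) (sc p pn') dx.
    by apply: iter_near_mono => l z; exact: (section_sgn (sheaf_on p)).
  (* In the column p = n + 1 the component of c is unconstrained, but it enters only through [gdiff]
     on lists of length 1, which is 0. *)
  have -> : (n.+1 - p = 0)%N by apply/eqP; rewrite subn_eq0.
  apply: iter_nearW => l z l0.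
  rewrite (_ : _ \o _ = fun=> 0); first exact: section0 (sheaf_on _) _.
  by apply/funext => y /=; rewrite gdiff1 ?sgn0// size_rcons l0.
have sh : iter_near (n.+1 - p) (fun l z => is_section (hdiff c (p := p) l) z) x.
  case: p pn x dx {sv} => [|p] pn x dx.
    by apply: iter_nearW => l z _; exact: section0 (sheaf_on _) _.
  rewrite subSS.
  have H (i : 'I_p.+2) := gsection_pull i (sc p pn) dx.
  apply: iter_near_mono (iter_near_forall H) => l z Hs.
  rewrite (_ : hdiff c (p := p.+1) l = fun y => \sum_(i < p.+2) sgn i (pull i (c p) l y)) //.
  by apply: (section_sum (sheaf_on _)) => i _; apply: (section_sgn (sheaf_on _)); exact: Hs.
apply: iter_near_mono (iter_nearI sh sv) => l z [? ?].
exact: (sectionD (sheaf_on p)).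
Qed.

Lemma tsection0 n : tsection n ((fun _ _ _ => 0) : cochain Gam A).
Proof. by move=> p _ x _; apply: iter_nearW => l z _; exact: section0 (sheaf_on _) _. Qed.

Lemma tsectionB n (c d : cochain Gam A) : tsection n c -> tsection n d ->
  tsection (A := A) n (fun p l x => c p l x - d p l x).
Proof.
move=> sc sd p pn x dx; apply: iter_near_mono (iter_nearI (sc p pn x dx) (sd p pn x dx)).
by move=> l z [? ?]; exact: (sectionB (sheaf_on p)).
Qed.

Lemma tsectionD n (c d : cochain Gam A) : tsection n c -> tsection n d ->
  tsection (A := A) n (fun p l x => c p l x + d p l x).
Proof.
move=> sc sd p pn x dx; apply: iter_near_mono (iter_nearI (sc p pn x dx) (sd p pn x dx)).
by move=> l z [? ?]; exact: (sectionD (sheaf_on p)).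
Qed.

Lemma tsectionN n (c : cochain Gam A) : tsection n c ->
  tsection (A := A) n (fun p l x => - c p l x).
Proof.
move=> sc p pn x dx; apply: iter_near_mono (sc p pn x dx).
by move=> l z ?; exact: (sectionN (sheaf_on p)).
Qed.

(** Other lists and other points are never inspected, and as [gdom] is open, equality of values on
    it is equality of germs. Cochain identities thus need proof only under these three
    conditions. *)
Lemma tsection_eq n (c d : cochain Gam A) :
  (forall p l x, (p <= n)%N -> size l = (n - p).+1 -> gdom x -> c p l x = d p l x) ->
  tsection n c -> tsection n d.
Proof.
move=> cd sc p pn x dx.
have := iter_nearI (sc p pn x dx) (iter_near_open (n - p) (@gdom_open p) dx).
apply: iter_near_sub => l z lq [Hs dz]; apply: (section_near_eq (sheaf_on p)) Hs.
apply: (filterS _ (nbhs_open (@gdom_open p) dz)) => y dy.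
by apply: cd => //; rewrite size_rcons lq.
Qed.

End Coefficient.

Definition null A n (c : cochain Gam A) : Prop := tsection (A := germ0 A) n c.

Lemma teqP A n (c d : cochain Gam A) :
  teq n c d <-> null n (fun p l x => c p l x - d p l x).
Proof.
split=> H p pn x dx; apply: iter_near_mono (H p pn x dx) => l z e.
  by apply: (filterS _ e) => y ->; rewrite subrr.
by apply: (filterS _ e) => y /eqP; rewrite subr_eq0 => /eqP.
Qed.

Lemma null_tdiff A n (c : cochain Gam A) : null n c -> null n.+1 (tdiff c).
Proof. exact: (tsection_tdiff (@germ0_is_sheaf A)). Qed.

Lemma null0 A n : null n ((fun _ _ _ => 0) : cochain Gam A).
Proof. exact: (tsection0 (@germ0_is_sheaf A)). Qed.

Lemma nullD A n (c d : cochain Gam A) : null n c -> null n d ->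
  null n (fun p l x => c p l x + d p l x).
Proof. exact: (tsectionD (@germ0_is_sheaf A)). Qed.

Lemma nullB A n (c d : cochain Gam A) : null n c -> null n d ->
  null n (fun p l x => c p l x - d p l x).
Proof. exact: (tsectionB (@germ0_is_sheaf A)). Qed.

Lemma nullN A n (c : cochain Gam A) : null n c -> null n (fun p l x => - c p l x).
Proof. exact: (tsectionN (@germ0_is_sheaf A)). Qed.

Lemma null_eq A n (c d : cochain Gam A) :
  (forall p l x, (p <= n)%N -> size l = (n - p).+1 -> gdom x -> c p l x = d p l x) ->
  null n c -> null n d.
Proof. exact: (tsection_eq (@germ0_is_sheaf A)). Qed.

Lemma null_morph A B n (f : A -> B) (c : cochain Gam A) :
  f 0 = 0 -> null n c -> null (A := B) n (fun p l x => f (c p l x)).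
Proof.
move=> f0 nc p pn x dx; apply: iter_near_mono (nc p pn x dx) => l z e.
by apply: (filterS _ e) => y ->.
Qed.

Lemma null_inj A B n (f : A -> B) (c : cochain Gam A) :
  (forall u, f u = 0 -> u = 0) -> null (A := B) n (fun p l x => f (c p l x)) -> null n c.
Proof.
move=> f0 nc p pn x dx; apply: iter_near_mono (nc p pn x dx) => l z e.
by apply: (filterS _ e) => y /f0.
Qed.

Lemma tsection_near A n (c d : cochain Gam A) : is_sheaf A ->
  null n (fun p l x => c p l x - d p l x) -> tsection n c -> tsection n d.
Proof.
move=> sA ncd sc p pn x dx.
apply: iter_near_mono (iter_nearI (ncd p pn x dx) (sc p pn x dx)) => l z [e].
apply: (section_near_eq (sheaf_on sA p)).
by apply: (filterS _ e) => y /eqP; rewrite subr_eq0 => /eqP.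
Qed.

End TotalSections.

(** * The connecting map *)

Section Connecting.
Context {R : realType} {Gam : nerve R}.
Hypothesis good : good_nerve Gam.
Implicit Types A : coeff R.

Lemma cocycleP A n (c : cochain Gam A) :
  cocycle n c <-> tsection n c /\ null n.+1 (tdiff c).
Proof.
split=> -[sc]; first move=> /teqP dc; last move=> dc.
  by split=> //; apply: (null_eq good _ dc) => p l x _ _ _; rewrite subr0.
split=> //; apply/teqP; apply: (null_eq good _ dc) => p l x _ _ _; by rewrite subr0.
Qed.

Lemma cohomologousP A n (c d : cochain Gam A) : cohomologous n.+1 c d <->
  exists2 b : cochain Gam A, tsection n b &
    null n.+1 (fun p l x => c p l x - d p l x - tdiff b l x).
Proof.
split=> -[b sb H]; exists b => //; first by move/teqP: H.
by apply/(teqP _ (fun p l x => c p l x - d p l x)).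
Qed.

Lemma cocycle_null_tdiff A n (c : cochain Gam A) : cocycle n c -> null n.+1 (tdiff c).
Proof. by move=> /cocycleP[]. Qed.

Lemma cohomologous_sym A n (c d : cochain Gam A) : is_sheaf A ->
  cohomologous n.+1 c d -> cohomologous n.+1 d c.
Proof.
move=> sA /cohomologousP[b sb nb]; apply/cohomologousP.
exists (fun p l x => - b p l x); first exact: tsectionN.
apply: (null_eq good _ (nullN good nb)) => p l x _ _ _.
by rewrite tdiffN !opprB !opprK [LHS]addrC.
Qed.

Lemma cohomologous_trans A n (c d e : cochain Gam A) : is_sheaf A ->
  cohomologous n.+1 c d -> cohomologous n.+1 d e -> cohomologous n.+1 c e.
Proof.
move=> sA /cohomologousP[b sb nb] /cohomologousP[b' sb' nb']; apply/cohomologousP.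
exists (fun p l x => b p l x + b' p l x); first exact: tsectionD.
apply: (null_eq good _ (nullD good nb nb')) => p l x _ _ _.
by rewrite tdiffD addrACA subrKA (opprD (tdiff b l x)).
Qed.

Lemma tdiff0 A p l x : tdiff ((fun _ _ _ => 0) : cochain Gam A) (p := p) l x = 0.
Proof.
apply: (@tdiff_morph R Gam A A (fun _ => 0) (fun _ _ _ => 0)) => _ _.
by rewrite subr0.
Qed.

Lemma cohomologous_null A n (c d : cochain Gam A) : is_sheaf A ->
  null n.+1 (fun p l x => c p l x - d p l x) -> cohomologous n.+1 c d.
Proof.
move=> sA ncd; apply/cohomologousP; exists (fun _ _ _ => 0); first exact: tsection0.
apply: (null_eq good _ ncd) => p l x _ _ _.
by rewrite tdiff0 subr0.
Qed.

Lemma cohomologous_refl A n (c : cochain Gam A) : is_sheaf A -> cohomologous n.+1 c c.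
Proof.
move=> sA; apply: cohomologous_null => //.
apply: (null_eq good (c := fun _ _ _ => 0)); last exact: (null0 good A).
by move=> p l x _ _ _; rewrite subrr.
Qed.

Lemma cclass_eq A n (c d : cochain Gam A) : is_sheaf A ->
  cohomologous n.+1 c d -> cclass n.+1 c = cclass n.+1 d.
Proof.
move=> sA cd; apply/seteqP; split=> e [ce ec]; split=> //.
  exact: cohomologous_trans ec cd.
exact: cohomologous_trans ec (cohomologous_sym sA cd).
Qed.

Lemma cocycle_cohomologous A n (c d : cochain Gam A) : is_sheaf A ->
  tsection n.+1 d -> cohomologous n.+1 c d -> cocycle n.+1 c -> cocycle n.+1 d.
Proof.
move=> sA sd /cohomologousP[b sb nb] /cocycleP[sc dc]; apply/cocycleP; split=> //.
apply: (null_eq good _ (nullB good dc (null_tdiff good nb))) => p l x _ _ _.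
by rewrite !tdiffB tdiff_tdiff// subr0 opprB addrC subrK.
Qed.

Lemma mem_cclass A n (c : cochain Gam A) : is_sheaf A ->
  cocycle n.+1 c -> cclass n.+1 c c.
Proof. by move=> sA cc; split=> //; exact: cohomologous_refl. Qed.

Lemma expiBr (u v : R) : expi (u - v) = expi u - expi v :> circle R.
Proof. exact: expiB. Qed.

Lemma tdiff_expi (r : cochain Gam (sheafR R)) p l x :
  tdiff (cochainRT r) (p := p) l x = expi (tdiff r l x).
Proof. exact: (tdiff_morph (A := sheafR R) (B := sheafT R) r l x expiBr). Qed.

Lemma tdiff_turns (c : cochain Gam (sheafZ R)) p l x :
  tdiff (cochainZR c) (p := p) l x = (tdiff c l x)%:~R * (2 * pi).
Proof.
apply: (tdiff_morph (A := sheafZ R) (B := sheafR R) (f := fun k => k%:~R * (2 * pi))).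
by move=> u v; rewrite intrB mulrBl.
Qed.

Lemma charts p : smooth_charts (gspace Gam p).
Proof. by have [+ _ _ _ _] := good; apply. Qed.

(** The germs of a Godement cochain are indexed by lists and need not be compatible, so each is
    lifted separately and the lifts are collected by choice. *)
Lemma exists_lift n (c : cochain Gam (sheafT R)) : tsection n c ->
  exists2 r : cochain Gam (sheafR R), tsection n r &
    null (A := sheafT R) n (fun p l x => expi (r p l x) - c p l x).
Proof.
move=> sc.
(* A list determines its last point, where the germ is taken; the lift is 0 for the empty list and
   where there is no section to lift. *)
have H p (l : seq (gspace Gam p)) : exists r : gspace Gam p -> R,
    forall l' z, l = rcons l' z -> is_section (c p l) z ->
      smooth_fun_at r z /\ \forall y \near z, expi (r y) = c p l y.
  case: (lastP l) => [|l' z]; first by exists (fun=> 0) => -[].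
  have [sz|nsz] := pselect (is_section (c p (rcons l' z)) z); last first.
    by exists (fun=> 0) => l'' z' /rcons_inj[_ <-].
  have [r sr er] := section_lift (@charts p) sz.
  by exists r => l'' z' /rcons_inj[_ <-].
pose r p l := sval (cid (H p l)).
have rP p l' z : is_section (c p (rcons l' z)) z ->
    smooth_fun_at (r p (rcons l' z)) z /\
    \forall y \near z, expi (r p (rcons l' z) y) = c p (rcons l' z) y.
  by move=> sz; have := svalP (cid (H p (rcons l' z))); exact.
exists r => p pn x dx; apply: iter_near_sub (sc p pn x dx) => l z _ /rP[] //.
by move=> _ e; apply: (filterS _ e) => y ->; rewrite subrr.
Qed.

(** Exactness at the real term: a smooth function with values in the multiples of 2 pi is 2 pi times
    a locally constant integer. *)
Lemma exists_turns n (r : cochain Gam (sheafR R)) : tsection n r ->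
  null (A := sheafT R) n (fun p l x => expi (r p l x)) ->
  exists2 e : cochain Gam (sheafZ R), tsection n e &
    null (A := sheafR R) n (fun p l x => r p l x - (e p l x)%:~R * (2 * pi)).
Proof.
move=> sr nr; exists (fun p l x => turns (r p l x)) => p pn x dx.
  apply: iter_near_mono (iter_nearI (sr p pn x dx) (nr p pn x dx)) => l z [sz ez].
  exact: section_turns (smooth_fun_continuous (@charts p) sz) ez.
apply: iter_near_mono (nr p pn x dx) => l z ez.
by apply: (filterS _ ez) => y ey; rewrite turnsK// subrr.
Qed.

Lemma tsectionZR n (e : cochain Gam (sheafZ R)) : tsection n e -> tsection n (cochainZR e).
Proof.
move=> se p pn x dx; apply: iter_near_mono (se p pn x dx) => l z ez.
have [_ sRe _ _] := sheafR_is_sheaf.1 _ (@charts p).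
apply: (sRe (fun=> (e p l z)%:~R * (2 * pi) : R)).
  by apply: (filterS _ ez) => y ey; rewrite /cochainZR ey.
exact: smooth_fun_cst (@charts p) _ _.
Qed.

Lemma turns_eq0 (k : int) : k%:~R * (2 * pi) = 0 :> R -> k = 0.
Proof.
move=> /eqP; rewrite mulf_eq0 intr_eq0 => /orP[/eqP //|].
by rewrite mulf_eq0 pnatr_eq0 /= gt_eqF// pi_gt0.
Qed.

(** One lift determines the whole image. Two lifts of cohomologous cochains differ, up to a
    coboundary, by 2 pi times an integral cochain, so the integral cocycles they define are
    cohomologous; conversely, adding 2 pi e to r adds D e to d. *)
Lemma connecting_cclass n (c : cochain Gam (sheafT R)) (d : cochain Gam (sheafZ R))
    (r : cochain Gam (sheafR R)) :
  cocycle n.+1 c -> tsection n.+2 d -> tsection n.+1 r ->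
  tsection n.+1 (cochainRT r) -> cohomologous n.+1 (cochainRT r) c ->
  null (A := sheafR R) n.+2 (fun p l x => tdiff r l x - (d p l x)%:~R * (2 * pi)) ->
  cocycle n.+2 d /\ connecting n.+1 (cclass n.+1 c) = cclass n.+2 d.
Proof.
move=> cc sd sr sTr rc nd; have sZ := @sheafZ_is_sheaf R.
have sR := @sheafR_is_sheaf R; have sT := @sheafT_is_sheaf R.
have cd : cocycle n.+2 d.
  apply/cocycleP; split=> //.
  apply: (null_inj (A := sheafZ R) (B := sheafR R) (f := fun k => k%:~R * (2 * pi)) turns_eq0).
  have := nullN good (null_tdiff good nd); apply: (null_eq good) => p l x _ _ _.
  by rewrite tdiffB tdiff_turns tdiff_tdiff// sub0r opprK.
split=> //; apply/seteqP; split=> [d' [cd' [r' [sr' [_ rc'] /teqP nd']]]|d' [cd' dd']].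
  split=> //.
  have /cohomologousP[b sb nb] := cohomologous_trans sT rc' (cohomologous_sym sT rc).
  have [b' sb' nb'] := exists_lift sb.
  (* Subtracting the coboundary of a real lift of b makes the exponential of s trivial, so s is 2 pi
     times an integral cochain e with D e = d' - d. *)
  pose s : cochain Gam (sheafR R) := fun p l x => r' p l x - r p l x - tdiff b' l x.
  have ss : tsection n.+1 s.
    exact: (tsectionB good sR (tsectionB good sR sr' sr) (tsection_tdiff good sR sb')).
  have ns : null (A := sheafT R) n.+1 (fun p l x => expi (s p l x)).
    apply: (null_eq good _ (nullB good nb (null_tdiff good nb'))) => p l x _ _ _.
    by rewrite /s !expiB -tdiff_expi (tdiffB (cochainRT b') b) opprB subrKA.
  have [e se ne] := exists_turns ss ns.
  apply/cohomologousP; exists e => //.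
  apply: (null_inj (A := sheafZ R) (B := sheafR R) (f := fun k => k%:~R * (2 * pi)) turns_eq0).
  have := nullB good (null_tdiff good ne) (nullB good nd' nd).
  apply: (null_eq good) => p l x _ _ _.
  rewrite (tdiffB s (cochainZR e)) tdiff_turns /s !tdiffB tdiff_tdiff// !intrB !mulrBl.
  by rewrite /cochainZR; ring.
have /cohomologousP[e se ne] := dd'; split=> //.
(* The added multiple of 2 pi leaves the exponential unchanged and moves D r from d to d'. *)
exists (fun p l x => r p l x + (e p l x)%:~R * (2 * pi)).
have er : cochainRT (fun p l x => r p l x + (e p l x)%:~R * (2 * pi)) = cochainRT r.
  by do 3!(apply: functional_extensionality_dep => ?); rewrite /cochainRT expiD expi2pi addr0.
split.
- by apply: (tsectionD good sR) => //; exact: tsectionZR.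
- by rewrite er; split=> //; apply: cocycle_cohomologous (cohomologous_sym sT rc) cc.
- apply/teqP.
  have := nullB good nd (null_morph (A := sheafZ R) (B := sheafR R)
    (f := fun k => k%:~R * (2 * pi)) (mul0r _) ne).
  apply: (null_eq good) => p l x _ _ _.
  rewrite (tdiffD r (cochainZR e)) tdiff_turns /cochainZR !intrB; ring.
Qed.

Lemma exists_connecting n (c : cochain Gam (sheafT R)) : cocycle n c ->
  exists (r : cochain Gam (sheafR R)) (d : cochain Gam (sheafZ R)),
    [/\ tsection n r, tsection n (cochainRT r),
        null (A := sheafT R) n (fun p l x => expi (r p l x) - c p l x),
        tsection n.+1 d &
        null (A := sheafR R) n.+1 (fun p l x => tdiff r l x - (d p l x)%:~R * (2 * pi))].
Proof.
move=> /cocycleP[sc dc]; have [r sr rc] := exists_lift sc.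
have nr : null (A := sheafT R) n.+1 (fun p l x => expi (tdiff r (p := p) l x)).
  apply: (null_eq good _ (nullD good (null_tdiff good rc) dc)) => p l x _ _ _.
  by rewrite (tdiffB (cochainRT r) c) subrK tdiff_expi.
have [d sd nd] := exists_turns (tsection_tdiff good (@sheafR_is_sheaf R) sr) nr.
exists r, d; split=> //; apply: (tsection_near good (@sheafT_is_sheaf R) _ sc).
by apply: (null_eq good _ (nullN good rc)) => p l x _ _ _; rewrite opprB.
Qed.

End Connecting.

(** * The cup product *)

Section ListDeletion.
Variable T : Type.
Implicit Type l : seq T.

Lemma take_delete_le i r l : (i <= r)%N -> take r (delete i l) = delete i (take r.+1 l).
Proof.
elim: i r l => [|i IH] r [|x l] //; first by rewrite /= !delete0.
by case: r => // r ir; rewrite /= !delete_cons /= IH.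
Qed.

Lemma drop_delete_le i r l : (i <= r)%N -> drop r (delete i l) = drop r.+1 l.
Proof.
elim: i r l => [|i IH] r [|x l] //; first by rewrite delete0.
by case: r => // r ir; rewrite delete_cons /= IH.
Qed.

Lemma take_delete_ge i r l : (r <= i)%N -> take r (delete i l) = take r l.
Proof.
elim: i r l => [|i IH] [|r] [|x l] // ri; rewrite ?take0 //.
by rewrite delete_cons /= IH.
Qed.

Lemma drop_delete_ge i r l : (r <= i)%N -> drop r (delete i l) = delete (i - r) (drop r l).
Proof.
elim: i r l => [|i IH] [|r] [|x l] // ri; rewrite ?drop0 //.
by rewrite delete_cons subSS /= IH.
Qed.

End ListDeletion.

Section CupProduct.
Context {R : realType} {Gam : nerve R}.
Implicit Types A : coeff R.
Local Notation Z := (sheafZ R).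

Lemma mulrz_sgnr (V : zmodType) k (v : V) (m : int) : v *~ sgn k m = sgn k (v *~ m).
Proof. by rewrite !sgnE mulrzz mulrzA. Qed.

Lemma mulrz_sgnl (V : zmodType) k (v : V) (m : int) : sgn k v *~ m = sgn k (v *~ m).
Proof. by rewrite !sgnE mulrzAC. Qed.

(** Faces up to r act on the first factor, later ones on the second. The two differentials on the
    right contain one extra term each, the last face of f and the first face of g; these are the
    same product with opposite signs. *)
Lemma gdiff_product A (X : chartedSpace R) (f : gcochain Z X) (g : gcochain A X) r s l x :
  size l = (r + s).+2 ->
  \sum_(i < size l) sgn i (g (drop r (delete i l)) x *~ f (take r.+1 (delete i l)) x) =
  g (drop r.+1 l) x *~ gdiff f (take r.+2 l) x +
  sgn r (gdiff g (drop r l) x *~ f (take r.+1 l) x).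
Proof.
move=> sl; have sr : size (take r.+2 l) = r.+2 by rewrite size_takel// sl; lia.
have ss : size (drop r l) = s.+2 by rewrite size_drop sl; lia.
rewrite [gdiff f _ _]gdiffE ?sr// [gdiff g _ _]gdiffE ?ss//.
rewrite [\sum_(i < r.+2) _]big_ord_recr [\sum_(i < s.+2) _]big_ord_recl /=.
have -> : delete r.+1 (take r.+2 l) = take r.+1 l.
  by rewrite -take_delete_le// take_delete_ge.
have -> : delete 0 (drop r l) = drop r.+1 l.
  by rewrite -(subnn r) -drop_delete_ge// drop_delete_le.
have e : size l = (r.+1 + s.+1)%N by rewrite sl addSn addnS.
rewrite e big_split_ord /=.
rewrite !mulrzDr !mulrzDl /= sgnD sgnS mulrNz.
rewrite [_ *~ sgn r _]mulrz_sgnr [sgn 0 _]/sgn /= subrKA.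
congr (_ + _).
  rewrite mulrz_sumr; apply: eq_bigr => i _.
  have ir : (i <= r)%N by rewrite -ltnS.
  rewrite (mulrz_sgnr i) (drop_delete_le _ ir).
  by rewrite take_delete_le ?(leqW ir).
rewrite mulrz_suml sgn_sum; apply: eq_bigr => i _.
rewrite mulrz_sgnl sgn_sgn drop_delete_ge; last by lia.
rewrite take_delete_ge; last by lia.
rewrite /bump leq0n add1n (_ : (r.+1 + i - r = i.+1)%N); last by lia.
by rewrite (_ : (r.+1 + i = i.+1 + r)%N)//; lia.
Qed.

(** [tcup] with an arbitrary right-hand coefficient, on which the left factor acts by integer
    multiples. It gives a meaning to products of alpha with circle-valued and real cochains; for A =
    Z it is [tcup]. *)
Definition zcup A m n (a : cochain Gam Z) (b : cochain Gam A) : cochain Gam A :=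
  fun p l x =>
  \sum_(k < p.+1 | (k <= m)%N && (p - k <= n)%N)
    sgn ((m - k) * (p - k))
      (back b (p - k) (drop (m - k) l) x *~ front a k (take (m - k).+1 l) x).

Lemma tcupE m n (a b : cochain Gam Z) : tcup m n a b = zcup m n a b.
Proof.
apply: functional_extensionality_dep => p; apply/funext => l; apply/funext => x.
by apply: eq_bigr => k _; rewrite mulrzz mulrC.
Qed.

Lemma front_id A (c : cochain Gam A) k : front c k (p := k) = c k.
Proof. by case: k => [|k] /=; rewrite ?eqxx. Qed.

Lemma back_id A (c : cochain Gam A) k : back c k (p := k) = c k.
Proof. by case: k => [|k] /=; rewrite ?eqxx. Qed.

Lemma frontS A (c : cochain Gam A) k p : (k <= p)%N ->
  front c k (p := p.+1) = pull p.+1 (front c k (p := p)).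
Proof. by move=> kp /=; rewrite gtn_eqF. Qed.

Lemma backS A (c : cochain Gam A) k p : (k <= p)%N ->
  back c k (p := p.+1) = pull 0 (back c k (p := p)).
Proof. by move=> kp /=; rewrite gtn_eqF. Qed.

Local Arguments front : simpl never.
Local Arguments back : simpl never.

(** Iterating the last face gives a single pullback, and the map is the same for all coefficients
    and cochains. Linearity, compatibility with [gdiff] and change of coefficients follow at
    once. *)
Lemma front_map k p : (k <= p)%N -> exists f : gspace Gam p -> gspace Gam k,
  forall A (c : cochain Gam A), front c k (p := p) = fun l x => c k (map f l) (f x).
Proof.
elim: p => [|p IH]; first rewrite leqn0 => /eqP ->.
  by exists id => A c; apply/funext => l; apply/funext => x; rewrite front_id map_id.
rewrite leq_eqVlt ltnS => /predU1P[->|kp].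
  by exists id => A c; apply/funext => l; apply/funext => x; rewrite front_id map_id.
have [f fE] := IH kp; exists (fun x => f (gface p.+1 x)) => A c.
by rewrite frontS// fE; apply/funext => l; apply/funext => x; rewrite /pull -map_comp.
Qed.

Lemma back_map k p : (k <= p)%N -> exists f : gspace Gam p -> gspace Gam k,
  forall A (c : cochain Gam A), back c k (p := p) = fun l x => c k (map f l) (f x).
Proof.
elim: p => [|p IH]; first rewrite leqn0 => /eqP ->.
  by exists id => A c; apply/funext => l; apply/funext => x; rewrite back_id map_id.
rewrite leq_eqVlt ltnS => /predU1P[->|kp].
  by exists id => A c; apply/funext => l; apply/funext => x; rewrite back_id map_id.
have [f fE] := IH kp; exists (fun x => f (gface 0 x)) => A c.
by rewrite backS// fE; apply/funext => l; apply/funext => x; rewrite /pull -map_comp.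
Qed.

Definition hface A i (c : cochain Gam A) : cochain Gam A := fun p =>
  match p return gcochain A (gspace Gam p) with
  | 0 => fun _ _ => 0 | p'.+1 => pull i (c p') end.

Lemma front_tdiff A (c : cochain Gam A) k p l x : (k <= p)%N ->
  front (tdiff c) k (p := p) l x =
  front (hdiff c) k (p := p) l x + sgn k (gdiff (front c k (p := p)) l x).
Proof. by move=> /front_map[f fE]; rewrite !fE gdiff_pull. Qed.

Lemma back_tdiff A (c : cochain Gam A) k p l x : (k <= p)%N ->
  back (tdiff c) k (p := p) l x =
  back (hdiff c) k (p := p) l x + sgn k (gdiff (back c k (p := p)) l x).
Proof. by move=> /back_map[f fE]; rewrite !fE gdiff_pull. Qed.

Lemma front_hdiff0 A (c : cochain Gam A) p l x : front (hdiff c) 0 (p := p) l x = 0.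
Proof. by have [f ->] := front_map (leq0n p). Qed.

Lemma back_hdiff0 A (c : cochain Gam A) p l x : back (hdiff c) 0 (p := p) l x = 0.
Proof. by have [f ->] := back_map (leq0n p). Qed.

Lemma front_hdiffS A (c : cochain Gam A) k p l x : (k < p)%N ->
  front (hdiff c) k.+1 (p := p) l x =
  \sum_(i < k.+2) sgn i (front (hface i c) k.+1 (p := p) l x).
Proof.
move=> /front_map[f fE]; rewrite fE hdiffS; apply: eq_bigr => i _.
by rewrite fE.
Qed.

Lemma back_hdiffS A (c : cochain Gam A) k p l x : (k < p)%N ->
  back (hdiff c) k.+1 (p := p) l x =
  \sum_(i < k.+2) sgn i (back (hface i c) k.+1 (p := p) l x).
Proof.
move=> /back_map[f fE]; rewrite fE hdiffS; apply: eq_bigr => i _.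
by rewrite fE.
Qed.

Hypothesis good : good_nerve Gam.

(** The front face keeps the vertices 0, ..., k, so deleting a vertex beyond k is not seen by it,
    while deleting an earlier one is a face of the front of length k + 1. At i = k + 1 both
    descriptions hold. The lemmas on [back] mirror this with the last vertices. *)
Lemma pull_front_ge A (c : cochain Gam A) i k p : (k <= p)%N -> (k < i <= p.+1)%N ->
  pull i (front c k (p := p)) = front c k (p := p.+1).
Proof.
elim: p i => [|p IH] i; first rewrite leqn0 => /eqP ->.
  by case: i => [|[|i]] // _; rewrite frontS.
move=> kp /andP[ki]; rewrite leq_eqVlt => /predU1P[->|ip]; first by rewrite -frontS.
move: kp; rewrite leq_eqVlt ltnS => /predU1P[kp|kp].
  by move: ki ip; rewrite kp !ltnS => /leq_trans /[apply]; rewrite ltnn.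
by rewrite (frontS _ kp) (pull_pull _ good)// IH ?ki// -!frontS// leqW.
Qed.

Lemma pull_front_le A (c : cochain Gam A) i k p : (k <= p)%N -> (i <= k.+1)%N ->
  pull i (front c k (p := p)) = front (hface i c) k.+1 (p := p.+1).
Proof.
elim: p => [|p IH]; first rewrite leqn0 => /eqP -> i1; first by rewrite !front_id.
rewrite leq_eqVlt ltnS => /predU1P[->|kp] ik; first by rewrite !front_id.
by rewrite (frontS _ kp) (pull_pull _ good) ?IH// ?[RHS]frontS// (leq_trans ik).
Qed.

Lemma pull_back_le A (c : cochain Gam A) i k p : (k <= p)%N -> (i <= p - k)%N ->
  pull i (back c k (p := p)) = back c k (p := p.+1).
Proof.
elim: p i => [|p IH] i kp ik.
  by move: ik; rewrite sub0n leqn0 => /eqP ->; rewrite -backS.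
case: i ik => [|i] ik; first by rewrite -backS.
move: kp ik; rewrite leq_eqVlt ltnS => /predU1P[->|kp]; first by rewrite subnn.
rewrite subSn// ltnS => ik.
by rewrite (backS _ kp) -(pull_pull _ good)// IH// [RHS]backS// leqW.
Qed.

Lemma pull_back_ge A (c : cochain Gam A) i k p : (k <= p)%N -> (p - k <= i)%N ->
  pull i (back c k (p := p)) = back (hface (i - (p - k)) c) k.+1 (p := p.+1).
Proof.
elim: p i => [|p IH] i; first rewrite leqn0 => /eqP -> _.
  by rewrite !back_id !subn0.
rewrite leq_eqVlt ltnS => /predU1P[->|kp]; first by rewrite !back_id subnn subn0.
rewrite subSn//; case: i => // i ik.
by rewrite (backS _ kp) -(pull_pull _ good)// IH// -backS.
Qed.

(** The groupoid counterpart of [gdiff_product]: the face k + 1 of the front factor and the face 0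
    of the back factor yield the same product with opposite signs and cancel. *)
Lemma hdiff_product A (a : cochain Gam Z) (b : cochain Gam A) k s l1 l2 x :
  \sum_(i < (k + s).+2) sgn i (pull i (back b s (p := k + s)) l2 x *~
                               pull i (front a k (p := k + s)) l1 x) =
  back b s (p := (k + s).+1) l2 x *~ front (hdiff a) k.+1 (p := (k + s).+1) l1 x +
  sgn k (back (hdiff b) s.+1 (p := (k + s).+1) l2 x *~ front a k (p := (k + s).+1) l1 x).
Proof.
have kp := leq_addr s k; have sp := leq_addl k s.
have ks : (k + s - s)%N = k by rewrite addnK.
rewrite front_hdiffS ?ltnS// back_hdiffS ?ltnS//.
rewrite [\sum_(i < k.+2) _]big_ord_recr [\sum_(i < s.+2) _]big_ord_recl /=.
rewrite -(pull_front_le a kp (leqnn _)) (pull_front_ge _ kp) ?ltnSn ?ltnS//.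
have -> : back (hface 0 b) s.+1 (p := (k + s).+1) = back b s (p := (k + s).+1).
  have := @pull_back_ge _ b (k + s - s) _ _ sp (leqnn _); rewrite subnn => <-.
  exact: pull_back_le.
rewrite (_ : (k + s).+2 = (k.+1 + s.+1)%N); last by rewrite addSn addnS.
rewrite big_split_ord /= !mulrzDr !mulrzDl /= sgnD sgnS mulrNz.
rewrite [_ *~ sgn k _]mulrz_sgnr [sgn 0 _]/sgn /= subrKA; congr (_ + _).
  rewrite mulrz_sumr; apply: eq_bigr => i _; have ik : (i <= k)%N by rewrite -ltnS.
  by rewrite mulrz_sgnr pull_back_le ?ks// pull_front_le// leqW.
rewrite mulrz_suml sgn_sum; apply: eq_bigr => i _.
rewrite mulrz_sgnl sgn_sgn pull_back_ge ?ks//; last by lia.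
rewrite pull_front_ge//; last by have := ltn_ord i; lia.
rewrite /bump leq0n add1n (_ : (k.+1 + i - k = i.+1)%N); last by lia.
by rewrite (_ : (k.+1 + i = i.+1 + k)%N)//; lia.
Qed.

Lemma hdiff_product_le A (a : cochain Gam Z) (b : cochain Gam A) k p l1 l2 x :
  (k <= p)%N ->
  \sum_(i < p.+2) sgn i (pull i (back b (p - k) (p := p)) l2 x *~
                         pull i (front a k (p := p)) l1 x) =
  back b (p - k) (p := p.+1) l2 x *~ front (hdiff a) k.+1 (p := p.+1) l1 x +
  sgn k (back (hdiff b) (p - k).+1 (p := p.+1) l2 x *~ front a k (p := p.+1) l1 x).
Proof.
move=> kp; have [s ps] : exists s, p = (k + s)%N by exists (p - k)%N; rewrite subnKC.
by move: l1 l2 x; rewrite ps addKn => l1 l2 x; exact: hdiff_product.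
Qed.

End CupProduct.

(** * The Leibniz rule *)

Section CupLeibniz.
Context {R : realType} {Gam : nerve R}.
Hypothesis good : good_nerve Gam.
Implicit Types A : coeff R.
Local Notation Z := (sheafZ R).
Local Arguments front : simpl never.
Local Arguments back : simpl never.

Lemma gdiff_zcup A m n (a : cochain Gam Z) (b : cochain Gam A) p l x :
  (p <= (m + n).+1)%N -> size l = ((m + n).+1 - p).+1 ->
  sgn p (gdiff (zcup m n a b (p := p)) l x) =
  \sum_(k < p.+1 | (k <= m.+1)%N && (p - k <= n)%N)
    sgn ((m.+1 - k) * (p - k) + k) (back b (p - k) (p := p) (drop (m.+1 - k) l) x *~
      gdiff (front a k (p := p)) (take (m.+1 - k).+1 l) x) +
  sgn m (\sum_(k < p.+1 | (k <= m)%N && (p - k <= n.+1)%N)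
    sgn ((m - k) * (p - k) + (p - k)) (gdiff (back b (p - k) (p := p)) (drop (m - k) l) x *~
      front a k (p := p) (take (m - k).+1 l) x)).
Proof.
move=> pmn sl.
have -> : sgn p (gdiff (zcup m n a b (p := p)) l x) =
    \sum_(k < p.+1 | (k <= m)%N && (p - k <= n)%N) sgn p (sgn ((m - k) * (p - k))
      (back b (p - k) (p := p) (drop (m - k).+1 l) x *~
         gdiff (front a k (p := p)) (take (m - k).+2 l) x +
       sgn (m - k) (gdiff (back b (p - k) (p := p)) (drop (m - k) l) x *~
         front a k (p := p) (take (m - k).+1 l) x))).
  have [l1|l1] := leqP (size l) 1.
    rewrite gdiff1// sgn0 big1// => k /andP[km pk].
    have := ltn_ord k; rewrite ltnS => kp; exfalso; lia.
  rewrite gdiffE// -sgn_sum; congr sgn.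
  rewrite (eq_bigr (fun i : 'I_(size l) => \sum_(k < p.+1 | (k <= m)%N && (p - k <= n)%N)
    sgn ((m - k) * (p - k)) (sgn i (back b (p - k) (p := p) (drop (m - k) (delete i l)) x *~
      front a k (p := p) (take (m - k).+1 (delete i l)) x)))); last first.
    by move=> i _; rewrite sgn_sum; apply: eq_bigr => k _; rewrite !sgn_sgn addnC.
  rewrite exchange_big /=; apply: eq_bigr => k /andP[km pk].
  have := ltn_ord k; rewrite ltnS => kp.
  rewrite -sgn_sum (gdiff_product (front a k (p := p)) (back b (p - k) (p := p))
    (r := m - k) (s := n - (p - k)))//; lia.
rewrite sgn_sum big_mkcond [X in _ = X + _]big_mkcond [X in _ = _ + X]big_mkcond.
rewrite -big_split; apply: eq_bigr => k _ /=.
have := ltn_ord k; rewrite ltnS => kp.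
(* The sums on the right allow k = m + 1, respectively p - k = n + 1, which does not occur on the
   left. There [gdiff] is applied to a singleton, so the extra terms are 0. *)
have [km|km] := leqP k m; last first.
  rewrite addr0 /=; case: ifP => // /andP[km1 _].
  have -> : (m.+1 - k = 0)%N by lia.
  by rewrite gdiff1 ?mulr0z ?sgn0// size_take; case: ifP => //; lia.
rewrite (leqW km) /=; have [pk|pk] := leqP (p - k) n; last first.
  rewrite add0r; case: ifP => // pk1.
  by rewrite gdiff1 ?mul0rz ?sgn0// size_drop; lia.
rewrite (leqW pk) subSn// !sgnD !sgn_sgn mulSn; congr (_ + _).
  by congr (sgn _ _); lia.
by congr (sgn _ _); lia.
Qed.

Lemma hdiff_zcup A m n (a : cochain Gam Z) (b : cochain Gam A) p l x :
  hdiff (zcup m n a b) (p := p) l x =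
  \sum_(k < p.+1 | (k <= m.+1)%N && (p - k <= n)%N)
    sgn ((m.+1 - k) * (p - k)) (back b (p - k) (p := p) (drop (m.+1 - k) l) x *~
      front (hdiff a) k (p := p) (take (m.+1 - k).+1 l) x) +
  sgn m (\sum_(k < p.+1 | (k <= m)%N && (p - k <= n.+1)%N)
    sgn ((m - k) * (p - k)) (back (hdiff b) (p - k) (p := p) (drop (m - k) l) x *~
      front a k (p := p) (take (m - k).+1 l) x)).
Proof.
rewrite sgn_sum big_mkcond [X in _ = _ + X]big_mkcond /=.
case: p l x => [|p] l x.
  rewrite !big_ord1 front_hdiff0 subn0 back_hdiff0 mul0rz mulr0z !sgn0.
  by rewrite ?if_same addr0.
(* The terms split off contain [hdiff] in degree 0, which is 0; what remains of the first sum is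
   indexed by k + 1. *)
rewrite [X in _ = X + _]big_ord_recl [X in _ = _ + X]big_ord_recr /=.
rewrite front_hdiff0 mulr0z sgn0 if_same add0r.
rewrite subnn back_hdiff0 mul0rz !sgn0 if_same addr0.
rewrite /zcup.
rewrite (eq_bigr (fun i : 'I_p.+2 => \sum_(k < p.+1 | (k <= m)%N && (p - k <= n)%N)
  sgn ((m - k) * (p - k)) (sgn i (
    pull i (back b (p - k) (p := p)) (drop (m - k) l) x *~
    pull i (front a k (p := p)) (take (m - k).+1 l) x)))); last first.
  move=> i _; rewrite sgn_sum; apply: eq_bigr => k _.
  by rewrite !sgn_sgn addnC /pull map_drop map_take.
rewrite exchange_big /= -big_split big_mkcond; apply: eq_bigr => k _ /=.
have := ltn_ord k; rewrite ltnS => kp.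
rewrite /bump leq0n add1n subSS (subSn kp) !ltnS.
case: ifP => [/andP[km pk]|_]; last by rewrite addr0.
rewrite -sgn_sum (hdiff_product_le good a b _ _ _ kp) sgnD !sgn_sgn; congr (_ + _).
(* The two exponents differ by an even number: adding 2(m - k) turns (m - k)(p - k) + k into (m -
   k)(p - k + 1) + m. *)
rewrite -[LHS](sgn_addn2 _ (m - k)) mulnS; congr (sgn _ _); lia.
Qed.

(** The sign (-1)^{(m - k)(p - k)} in the product is chosen so that the horizontal and vertical
    Leibniz rules combine into one for the total differential. *)
Lemma tdiff_zcup A m n (a : cochain Gam Z) (b : cochain Gam A) p l x :
  (p <= (m + n).+1)%N -> size l = ((m + n).+1 - p).+1 ->
  tdiff (zcup m n a b) (p := p) l x =
  zcup m.+1 n (tdiff a) b l x + sgn m (zcup m n.+1 a (tdiff b) l x).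
Proof.
move=> pmn sl; rewrite {1}/tdiff hdiff_zcup gdiff_zcup// addrACA -sgnD -!big_split /=.
congr (_ + sgn m _); apply: eq_bigr => k /andP[km pk].
  have := ltn_ord k; rewrite ltnS => kp.
  by rewrite front_tdiff// mulrzDr sgnD mulrz_sgnr sgn_sgn [in RHS]addnC.
by rewrite back_tdiff ?leq_subr// mulrzDl sgnD mulrz_sgnl sgn_sgn [in RHS]addnC.
Qed.

End CupLeibniz.

(** * The cup product on cohomology classes *)

Section CupClasses.
Context {R : realType} {Gam : nerve R}.
Hypothesis good : good_nerve Gam.
Implicit Types A B : coeff R.
Local Notation Z := (sheafZ R).
Local Arguments front : simpl never.
Local Arguments back : simpl never.

Lemma gsection_front A (c : cochain Gam A) k p q : is_sheaf A -> (k <= p)%N ->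
  gsection (@gdom _ Gam k) q (c k) ->
  gsection (@gdom _ Gam p) q (front c k (p := p)).
Proof.
move=> sA + sc; elim: p => [|p IH]; first by rewrite leqn0 => /eqP k0; move: sc; rewrite k0 front_id.
rewrite leq_eqVlt ltnS => /predU1P[<-|kp]; first by rewrite front_id.
by rewrite frontS//; apply: (gsection_pull good sA); exact: IH.
Qed.

Lemma gsection_back A (c : cochain Gam A) k p q : is_sheaf A -> (k <= p)%N ->
  gsection (@gdom _ Gam k) q (c k) ->
  gsection (@gdom _ Gam p) q (back c k (p := p)).
Proof.
move=> sA + sc; elim: p => [|p IH]; first by rewrite leqn0 => /eqP k0; move: sc; rewrite k0 back_id.
rewrite leq_eqVlt ltnS => /predU1P[<-|kp]; first by rewrite back_id.
by rewrite backS//; apply: (gsection_pull good sA); exact: IH.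
Qed.

(* The coefficients have the groups int and V, and differ by the sections they
   admit; S4, on which the cup product does not depend, is arbitrary. *)
Lemma tsection_zcup (V : zmodType)
    (S1 : forall X : chartedSpace R, (X -> int) -> X -> Prop)
    (S2 S3 S4 : forall X : chartedSpace R, (X -> V) -> X -> Prop)
    m n (a : cochain Gam (Coeff S1)) (b : cochain Gam (Coeff S2)) :
  is_sheaf (Coeff S1) -> is_sheaf (Coeff S2) -> is_sheaf (Coeff S3) ->
  (forall X u v x, smooth_charts X -> S1 X u x -> S2 X v x -> S3 X (fun y => v y *~ u y) x) ->
  tsection m a -> tsection n b ->
  tsection (A := Coeff S3) (m + n) (zcup (A := Coeff S4) m n a b).
Proof.
move=> s1 s2 s3 S12 sa sb p pmn x dx.
pose T (k : 'I_p.+1) : gcochain (Coeff S3) (gspace Gam p) := fun l x =>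
  if (k <= m)%N && (p - k <= n)%N then sgn ((m - k) * (p - k))
    (back b (p - k) (p := p) (drop (m - k) l) x *~ front a k (p := p) (take (m - k).+1 l) x)
  else 0.
have sT k : iter_near (m + n - p) (fun l z => is_section (T k l) z) x.
  rewrite /T; case cond: ((k <= m)%N && (p - k <= n)%N); last first.
    by apply: iter_nearW => l z _; exact: (section0 (sheaf_on good s3 p)).
  have /andP[km pk] := cond; have kp : (k <= p)%N by rewrite -ltnS.
  have sf := gsection_front s1 kp (sa k km).
  have sbk := gsection_back s2 (leq_subr k p) (sb (p - k)%N pk).
  have e1 : (m - k <= m + n - p)%N by lia.
  have e2 : (m + n - p = (m - k) + (n - (p - k)))%N by lia.
  have n1 := gnear_take (P := fun l z => is_section (front a k (p := p) l) z)
    (@section_germ_open _ _ _ (sheaf_on good s1 p) _) sf e1.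
  have n2 := gnear_drop (m - k) (P := fun l z => is_section (back b (p - k) (p := p) l) z)
    (@gdom_open _ _ good p) sbk.
  rewrite -e2 in n2.
  apply: iter_near_mono (iter_nearI (n1 x dx) (n2 x dx)) => l z [h1 h2].
  apply: (section_sgn (sheaf_on good s3 p)).
  exact: (S12 _ _ _ _ (charts good p) h1 h2).
apply: iter_near_mono (iter_near_forall sT) => l z Hs.
have -> : zcup (A := Coeff S4) m n a b l = fun y => \sum_(k < p.+1) T k l y.
  apply/funext => y; rewrite /zcup [LHS]big_mkcond; apply: eq_bigr => k _.
    rewrite /T; case: ifP => // _; have kp : (k <= p)%N by rewrite -ltnS.
    have [f fE] := @front_map _ Gam _ _ kp; have [g gE] := @back_map _ Gam _ _ (leq_subr k p).
    by rewrite (fE Z a) (fE (Coeff S1) a) (gE (Coeff S2) b) (gE (Coeff S4) b).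
by apply: (section_sum (sheaf_on good s3 p)) => k _; exact: Hs.
Qed.

Lemma tsection_zcupZ A m n (a : cochain Gam Z) (b : cochain Gam A) : is_sheaf A ->
  tsection m a -> tsection n b -> tsection (m + n) (zcup m n a b).
Proof.
case: A b => V S b sA; apply: tsection_zcup => //; first exact: sheafZ_is_sheaf.
move=> X u v x hX eu sv; have sX := sA.1 X hX.
apply: (section_near_eq sX _ (section_mulrz sX (u x) sv)).
by apply: (filterS _ eu) => y ->.
Qed.

(** With this coefficient for one factor and [germ0] for the other, [tsection_zcup] says that a null
    factor makes the product null, whatever the other factor is. *)
Definition any_section A : coeff R := @Coeff R A (fun _ _ _ => True).

Lemma any_section_is_sheaf A : is_sheaf (any_section A).
Proof. by split=> [X hX|//]; split=> // u x _; exact: nearW. Qed.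

Lemma null_zcupl A m n (a : cochain Gam Z) (b : cochain Gam A) :
  null m a -> null (m + n) (zcup m n a b).
Proof.
case: A b => V S b na.
pose S0 (V : zmodType) (X : chartedSpace R) (u : X -> V) (x : X) := \forall y \near x, u y = 0.
apply: (@tsection_zcup V (S0 int) (fun _ _ _ => True) (S0 V) S m n a b) => //.
- exact: germ0_is_sheaf Z.
- exact: any_section_is_sheaf (Coeff S).
- exact: germ0_is_sheaf (Coeff S).
- by move=> X u v x _ eu _; apply: (filterS _ eu) => y ->; rewrite mulr0z.
- by move=> p pn x dx; exact: iter_nearW.
Qed.

Lemma null_zcupr A m n (a : cochain Gam Z) (b : cochain Gam A) :
  null n b -> null (m + n) (zcup m n a b).
Proof.
case: A b => V S b nb.
pose S0 (V : zmodType) (X : chartedSpace R) (u : X -> V) (x : X) := \forall y \near x, u y = 0.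
apply: (@tsection_zcup V (fun _ _ _ => True) (S0 V) (S0 V) S m n a b) => //.
- exact: any_section_is_sheaf Z.
- exact: germ0_is_sheaf (Coeff S).
- exact: germ0_is_sheaf (Coeff S).
- by move=> X u v x _ _ ev; apply: (filterS _ ev) => y ->; rewrite mul0rz.
- by move=> p pn x dx; exact: iter_nearW.
Qed.

Lemma zcupBl A m n (a a' : cochain Gam Z) (b : cochain Gam A) p l x :
  zcup m n (fun p l x => a p l x - a' p l x) b (p := p) l x =
  zcup m n a b l x - zcup m n a' b l x.
Proof.
rewrite /zcup -sumrN -big_split; apply: eq_bigr => k /andP[km pk].
have kp : (k <= p)%N by rewrite -ltnS.
have [f fE] := @front_map _ Gam _ _ kp.
rewrite (fE Z a) (fE Z a') (fE Z (fun p l x => a p l x - a' p l x)).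
by rewrite mulrzBr sgnD sgnN.
Qed.

Lemma zcupBr A m n (a : cochain Gam Z) (b b' : cochain Gam A) p l x :
  zcup m n a (fun p l x => b p l x - b' p l x) (p := p) l x =
  zcup m n a b l x - zcup m n a b' l x.
Proof.
rewrite /zcup -sumrN -big_split; apply: eq_bigr => k /andP[km pk].
have [f fE] := @back_map _ Gam _ _ (leq_subr k p).
rewrite (fE A b) (fE A b') (fE A (fun p l x => b p l x - b' p l x)).
by rewrite mulrzBl sgnD sgnN.
Qed.

Lemma zcup_morph A B m n (f : A -> B) (a : cochain Gam Z) (b : cochain Gam A) p l x :
  (forall u v, f (u - v) = f u - f v) ->
  zcup (A := B) m n a (fun p l x => f (b p l x)) (p := p) l x = f (zcup m n a b l x).
Proof.
move=> fB; have f0 : f 0 = 0 by have := fB 0 0; rewrite !subrr.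
have fN u : f (- u) = - f u by rewrite -sub0r fB f0 sub0r.
have fD u v : f (u + v) = f u + f v by rewrite -{1}[v]opprK fB fN opprK.
rewrite /zcup (big_morph f fD f0); apply: eq_bigr => k /andP[km pk].
have [g gE] := @back_map _ Gam _ _ (leq_subr k p).
rewrite (gE A b) (gE B (fun p l x => f (b p l x))) (sgn_morph _ _ fB).
congr (sgn _ _); set u := b _ _ _; case: (front _ _ _ _) => i.
  by elim: i => [|i IH]; rewrite ?mulr0z// -addn1 PoszD !mulrzDr fD IH.
rewrite NegzE !mulrNz fN; congr (- _).
by elim: i => [|i IH] //; rewrite -addn1 PoszD !mulrzDr fD IH.
Qed.

Lemma tdiff_zcup_cocyclel A m n (a : cochain Gam Z) (b : cochain Gam A) :
  cocycle m a ->
  null (m + n).+1 (fun p l x => tdiff (zcup m n a b) l x - sgn m (zcup m n.+1 a (tdiff b) l x)).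
Proof.
move=> /cocycle_null_tdiff na.
apply: (null_eq good _ (null_zcupl (n := n) b (na good))) => p l x pmn sl _.
by rewrite tdiff_zcup// addrK.
Qed.

Lemma tdiff_zcup_cocycler A m n (a : cochain Gam Z) (b : cochain Gam A) :
  cocycle n b ->
  null (m + n).+1 (fun p l x => tdiff (zcup m n a b) l x - zcup m.+1 n (tdiff a) b l x).
Proof.
move=> /cocycle_null_tdiff nb.
have := null_zcupr (m := m) a (nb good); rewrite addnS => H.
have {}H := null_morph (f := sgn m) (sgn0 _ m) H.
apply: (null_eq good _ H) => p l x pmn sl _.
by rewrite tdiff_zcup// addrC addKr.
Qed.

Lemma zcup_cocycle A m n (a : cochain Gam Z) (b : cochain Gam A) : is_sheaf A ->
  cocycle m a -> cocycle n b -> cocycle (m + n) (zcup m n a b).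
Proof.
move=> sA ca cb; have [sa da] := (cocycleP good m a).1 ca.
have [sb db] := (cocycleP good n b).1 cb.
apply/(cocycleP good); split; first exact: tsection_zcupZ.
have := null_morph (f := sgn m) (sgn0 _ m) (null_zcupr (m := m) a db); rewrite addnS => H.
apply: (null_eq good _ (nullD good (tdiff_zcup_cocyclel (n := n) b ca) H)) => p l x _ _ _.
by rewrite subrK.
Qed.

Lemma cup_cohomologousl m n (a a' b : cochain Gam Z) : cocycle n.+1 b ->
  cohomologous m.+1 a a' ->
  cohomologous (m.+1 + n.+1) (tcup m.+1 n.+1 a b) (tcup m.+1 n.+1 a' b).
Proof.
move=> cb /(cohomologousP m)[u su nu]; have [sb _] := (cocycleP good _ b).1 cb.
apply/(cohomologousP (m + n.+1)); exists (zcup m n.+1 u b).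
  exact: (tsection_zcupZ (@sheafZ_is_sheaf R)).
have := nullB good (null_zcupl (n := n.+1) b nu) (tdiff_zcup_cocycler u cb).
apply: (null_eq good) => p l x _ _ _.
rewrite !tcupE (zcupBl _ _ (fun p l x => a p l x - a' p l x)) zcupBl.
by rewrite opprB addrA subrK.
Qed.

Lemma cup_cohomologousr m n (a b b' : cochain Gam Z) : cocycle m.+1 a ->
  cohomologous n.+1 b b' ->
  cohomologous (m.+1 + n.+1) (tcup m.+1 n.+1 a b) (tcup m.+1 n.+1 a b').
Proof.
move=> ca /(cohomologousP n)[u su nu]; have [sa _] := (cocycleP good _ a).1 ca.
(* For the cocycle a of degree m + 1 the Leibniz rule reads D(a cup u) = (-1)^{m+1} a cup D u; the
   sign in the witness compensates. *)
apply/(cohomologousP (m + n.+1)); exists (fun p l x => sgn m.+1 (zcup m.+1 n a u l x)).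
  rewrite -addSnnS; have := tsection_zcupZ (@sheafZ_is_sheaf R) sa su.
  by rewrite /sgn; case: (odd _) => // H; exact: (tsectionN good (@sheafZ_is_sheaf R)).
have := null_morph (f := sgn m.+1) (sgn0 _ m.+1) (tdiff_zcup_cocyclel (n := n) u ca).
rewrite -addnS => H; have := nullB good (null_zcupr (m := m.+1) a nu) H.
apply: (null_eq good) => p l x _ _ _.
rewrite !tcupE (zcupBr _ _ a (fun p l x => b p l x - b' p l x)) zcupBr.
rewrite (tdiff_morph (A := Z) (B := Z) (f := sgn m.+1)); last by move=> ? ?; rewrite sgnD sgnN.
rewrite sgnD sgnN sgn_sgn addnn -[(m.+1).*2]add0n sgn_addn2 opprB addrA subrK.
by [].
Qed.

Lemma cup_cclass m n (a b : cochain Gam Z) : cocycle m.+1 a -> cocycle n.+1 b ->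
  cup m.+1 n.+1 (cclass m.+1 a) (cclass n.+1 b) =
  cclass (m.+1 + n.+1) (tcup m.+1 n.+1 a b).
Proof.
move=> ca cb; have sZ := @sheafZ_is_sheaf R.
apply/seteqP; split=> [c [a' [b' [[ca' aa'] [cb' bb'] cc]]]|c cc]; last first.
  by exists a, b; split=> //; exact: mem_cclass.
suff <- : cclass (m.+1 + n.+1) (tcup m.+1 n.+1 a' b') =
  cclass (m.+1 + n.+1) (tcup m.+1 n.+1 a b) by [].
apply: (cclass_eq good sZ); apply: (cohomologous_trans good sZ).
  exact: (cup_cohomologousl cb' aa').
exact: (cup_cohomologousr ca bb').
Qed.

End CupClasses.

(** * The nerve of Gamma *)

Section GammaNerve.
Context {R : realType}.
Implicit Types X Y Z G M : chartedSpace R.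

Lemma smooth_at_fst_comp X Y Z (phi : Z -> prod_space X Y) z :
  smooth_charts X -> smooth_charts Y -> smooth_charts Z ->
  smooth_at phi z -> smooth_at (Y := X) (fun y => (phi y).1) z.
Proof.
move=> hX hY hZ sphi.
apply: (smooth_at_comp (psi := fun xy : prod_space X Y => xy.1 : X) hZ _ sphi).
  exact: smooth_charts_prod.
exact: smooth_at_fst.
Qed.

Lemma smooth_at_snd_comp X Y Z (phi : Z -> prod_space X Y) z :
  smooth_charts X -> smooth_charts Y -> smooth_charts Z ->
  smooth_at phi z -> smooth_at (Y := Y) (fun y => (phi y).2) z.
Proof.
move=> hX hY hZ sphi.
apply: (smooth_at_comp (psi := fun xy : prod_space X Y => xy.2 : Y) hZ _ sphi).
  exact: smooth_charts_prod.
exact: smooth_at_snd.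
Qed.

Lemma smooth_at_delete_nth X p i (x : pow_space X p.+1) : smooth_charts X ->
  smooth_at (X := pow_space X p.+1) (Y := pow_space X p) (delete_nth i) x.
Proof.
move=> hX; have hp q := smooth_charts_pow q hX.
elim: p i x => [|p IH] i x; first exact: (smooth_at_cst (tt : pow_space X 0) x (hp 1%N)).
case: i => [|i]; first exact: (smooth_at_snd (Y := pow_space X p.+1) x hX (hp p.+1)).
apply: (smooth_at_pair (X := X) (Y := pow_space X p)).
  exact: (smooth_at_fst (Y := pow_space X p.+1) x hX (hp p.+1)).
apply: (smooth_at_comp (phi := fun y : pow_space X p.+2 => y.2 : pow_space X p.+1)
  (psi := delete_nth (X := X) i) (hp p.+2) (hp p.+1)); last exact: IH.
exact: (smooth_at_snd (Y := pow_space X p.+1) x hX (hp p.+1)).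
Qed.

Section Action.
Context (G M : chartedSpace R) (mul : G -> G -> G) (act : G -> M -> M).
Hypotheses (hG : smooth_charts G) (hM : smooth_charts M).
Hypothesis smul : forall x, smooth_at (X := prod_space G G) (fun ab => mul ab.1 ab.2 : G) x.
Hypothesis sact : forall x, smooth_at (X := prod_space G M) (fun gx => act gx.1 gx.2 : M) x.
Hypothesis mulA : associative mul.
Hypothesis actM : forall a b x, act (mul a b) x = act a (act b x).

Lemma smooth_charts_TM : smooth_charts (TM M).
Proof. by apply: smooth_charts_prod => //; exact: smooth_charts_circle. Qed.

Let hT := smooth_charts_TM.
Let hp p := smooth_charts_pow p hG.
Let hpT p := smooth_charts_prod (hp p) hT.

Lemma smooth_at_actTM Z (g : Z -> G) (y : Z -> TM M) z : smooth_charts Z ->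
  smooth_at g z -> smooth_at y z -> smooth_at (Y := TM M) (fun z => actTM act (g z) (y z)) z.
Proof.
move=> hZ sg sy; have hC := @smooth_charts_circle R.
apply: (smooth_at_pair (X := circle_space R) (Y := M)).
  exact: (smooth_at_fst_comp hC hM hZ sy).
have s2 := smooth_at_snd_comp hC hM hZ sy.
exact: (smooth_at_comp hZ (smooth_charts_prod hG hM) (smooth_at_pair sg s2) (sact _)).
Qed.

Lemma smooth_at_action_face p i (x : prod_space (pow_space G p.+1) (TM M)) :
  smooth_at (X := prod_space (pow_space G p.+1) (TM M)) (Y := prod_space (pow_space G p) (TM M))
    (action_face mul act i) x.
Proof.
elim: p i x => [|p IH] i x.
  pose X := prod_space (pow_space G 1) (TM M).
  have s2 : smooth_at (X := X) (Y := TM M) (fun gy => gy.2) x.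
    exact: (smooth_at_snd x (hp 1) hT).
  have s1 : smooth_at (X := X) (Y := pow_space G 1) (fun gy => gy.1) x.
    exact: (smooth_at_fst x (hp 1) hT).
  have s11 : smooth_at (X := X) (Y := G) (fun gy => gy.1.1) x.
    exact: (smooth_at_fst_comp (Y := pow_space G 0) hG (hp 0) (hpT 1) s1).
  have s0 : smooth_at (X := X) (Y := pow_space G 0) (fun _ => tt) x.
    exact: (smooth_at_cst (tt : pow_space G 0) x (hpT 1)).
  case: i => [|i]; first exact: (smooth_at_pair s0 s2).
  exact: (smooth_at_pair s0 (smooth_at_actTM (hpT 1) s11 s2)).
pose X := prod_space (pow_space G p.+2) (TM M).
have hX : smooth_charts X := hpT p.+2.
have s2 : smooth_at (X := X) (Y := TM M) (fun gy => gy.2) x.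
  exact: (smooth_at_snd x (hp p.+2) hT).
have s1 : smooth_at (X := X) (Y := pow_space G p.+2) (fun gy => gy.1) x.
  exact: (smooth_at_fst x (hp p.+2) hT).
have s11 : smooth_at (X := X) (Y := G) (fun gy => gy.1.1) x.
  exact: (smooth_at_fst_comp (Y := pow_space G p.+1) hG (hp p.+1) hX s1).
have s12 : smooth_at (X := X) (Y := pow_space G p.+1) (fun gy => gy.1.2) x.
  exact: (smooth_at_snd_comp (Y := pow_space G p.+1) hG (hp p.+1) hX s1).
case: i => [|[|i]]; first exact: (smooth_at_pair s12 s2).
  have s121 : smooth_at (X := X) (Y := G) (fun gy => gy.1.2.1) x.
    exact: (smooth_at_fst_comp (Y := pow_space G p) hG (hp p) hX s12).
  have s122 : smooth_at (X := X) (Y := pow_space G p) (fun gy => gy.1.2.2) x.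
    exact: (smooth_at_snd_comp (Y := pow_space G p) hG (hp p) hX s12).
  have sm := smooth_at_comp hX (smooth_charts_prod hG hG) (smooth_at_pair s11 s121) (smul _).
  exact: (smooth_at_pair (Y := TM M) (smooth_at_pair (Y := pow_space G p) sm s122) s2).
have sr := smooth_at_comp hX (hpT p.+1) (smooth_at_pair s12 s2) (IH i.+1 _).
have sr1 := smooth_at_fst_comp (hp p) hT hX sr.
have sr2 := smooth_at_snd_comp (hp p) hT hX sr.
exact: (smooth_at_pair (Y := TM M) (smooth_at_pair (Y := pow_space G p) s11 sr1) sr2).
Qed.

Lemma delete_nthC X p i j (x : pow_space X p.+2) : (i <= j)%N ->
  delete_nth i (delete_nth j.+1 x) = delete_nth j (delete_nth i x).
Proof.
elim: p i j x => [|p IH] [|i] [|j] x //= ij.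
by congr (_, _); exact: IH.
Qed.

Lemma action_faceC p i j (x : pow_space G p.+2 * TM M) : (i <= j)%N ->
  action_face mul act i (action_face mul act j.+1 x) =
  action_face mul act j (action_face mul act i x).
Proof.
elim: p i j x => [|p IH] i j [[g [g' gs]] y] ij.
  case: i ij => [|[|i]] ij; case: j ij => [|[|j]] ij //=; rewrite /actTM /= ?actM //.
case: i ij => [|[|i]] ij; case: j ij => [|[|j]] ij //=.
- by rewrite mulA.
- by rewrite -!surjective_pairing (IH i.+1 j.+1 ((g', gs), y) ij).
Qed.

End Action.

End GammaNerve.

Section GammaCocycles.
Context {R : realType}.

Lemma all_pow_mono (X : chartedSpace R) (P Q : X -> Prop) p (xs : pow_space X p) :
  (forall x, P x -> Q x) -> all_pow P xs -> all_pow Q xs.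
Proof.
by move=> PQ; elim: p xs => [|p IH] xs //= [/PQ Q1 /IH Q2]; split.
Qed.

Lemma all_pow_delete (X : chartedSpace R) (P : X -> Prop) p i (xs : pow_space X p.+1) :
  all_pow P xs -> all_pow P (delete_nth i xs).
Proof.
elim: p i xs => [|p IH] [|i] xs //= [Px Pxs] //.
by split=> //; exact: IH.
Qed.

Lemma all_pow_near (X : chartedSpace R) (T : topologicalType) (P : X -> T -> Prop) p
    (xs : pow_space X p) t :
  (forall x, P x t -> \forall s \near t, P x s) ->
  all_pow (P^~ t) xs -> \forall s \near t, all_pow (P^~ s) xs.
Proof.
move=> nP; elim: p xs => [|p IH] xs /=; first by move=> _; exact: nearW.
by move=> [/nP n1 /IH n2]; exact: (filterI n1 n2).
Qed.

(** A face moves the base point by at most one group element and fixes its circle coordinate, so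
    invariance of the V_i gives stability of [gamma_dom]. *)
Lemma action_face_base (G M : chartedSpace R) (mul : G -> G -> G) (act : G -> M -> M)
    p i (gy : pow_space G p.+1 * TM M) :
  (action_face mul act i gy).2 = gy.2 \/
  exists g, (action_face mul act i gy).2 = actTM act g gy.2.
Proof.
elim: p i gy => [|p IH] i gy.
  by case: i => [|i]; [left|right; exists gy.1.1].
by case: i => [|[|i]]; [left|left|exact: (IH i.+1 (gy.1.2, gy.2))].
Qed.

(** * The two arcs and the components of their overlap *)

Section Arcs.
Variable eps : R.
Hypothesis Heps : 0 < eps < pi / 2.

Lemma open_Tplus : open (Tplus eps).
Proof. by apply: expi_open; exact: interval_open. Qed.

Lemma open_Tminus : open (Tminus eps).
Proof. by apply: expi_open; exact: interval_open. Qed.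

Lemma open_Tone : open (Tone eps).
Proof. by apply: expi_open; exact: interval_open. Qed.

Lemma Tone_Re_gt0 z : Tone eps z -> 0 < complex.Re (val z).
Proof.
have /andP[e0 e1] := Heps; move=> [t]; rewrite /= in_itv /= => /andP[t1 t2] <-.
by apply: cos_gt0_pihalf; apply/andP; split; lra.
Qed.

Lemma cos_lt0 (t : R) : pi / 2 < t < pi / 2 + pi -> cos t < 0.
Proof.
move=> /andP[t1 t2]; rewrite -[t](subrK pi) cosDpi oppr_lt0.
by apply: cos_gt0_pihalf; apply/andP; split; lra.
Qed.

(** Since eps < pi / 2, the arc around 1 lies in the right half-plane and the rest of the overlap in
    the left one. The sign of the real part therefore separates the two components, which makes
    membership in [Tone] locally constant on the overlap. *)
Lemma overlap_Re_lt0 z :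
  Tplus eps z -> Tminus eps z -> ~ Tone eps z -> complex.Re (val z) < 0.
Proof.
have /andP[e0 e1] := Heps; have p0 := pi_gt0 R.
move=> [t]; rewrite /= in_itv /= => /andP[t1 t2] <-.
move=> [s]; rewrite /= in_itv /= => /andP[s1 s2] st nT.
have et : eps <= t.
  by rewrite leNgt; apply/negP => te; apply: nT; exists t => //; rewrite /= in_itv /= t1.
have cst : cos s = cos t by have := congr1 (fun z : circle R => complex.Re (val z)) st.
have sst : sin s = sin t by have := congr1 (fun z : circle R => complex.Im (val z)) st.
have [tp|tp] := ltP (pi / 2) t; first by apply: cos_lt0; apply/andP; split; lra.
exfalso; have sint : 0 < sin t by apply: sin_gt0_pi; apply/andP; split; lra.
have cost : 0 <= cos t by apply: cos_ge0_pihalf; apply/andP; split; lra.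
have [sp|sp] := ltP s (pi / 2 + pi).
  by move: cost; rewrite leNgt -cst cos_lt0//; apply/andP; split; lra.
have [sp2|sp2] := leP s (2 * pi).
  move: sint; rewrite -sst -[s](subrK pi) sinDpi oppr_gt0 ltNge sin_ge0_pi//.
  by apply/andP; split; lra.
(* The end of the second arc beyond 2 pi wraps around into the arc at 1. *)
apply: nT; exists (s - 2 * pi); first by rewrite /= in_itv /=; apply/andP; split; lra.
by have := @expi2pi R 1; rewrite mul1r => e; rewrite -st expiB e subr0.
Qed.

Lemma Tone_locally z : Tplus eps z -> Tminus eps z ->
  \forall w \near z, `[< Tone eps w >] = `[< Tone eps z >].
Proof.
move=> zp zm; have [zT|zT] := asboolP (Tone eps z).
  by apply: (filterS _ (nbhs_open open_Tone zT)) => w /asboolP.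
have nz := near_continuous (@Re_continuous R z) (nbhs_open (@open_lt R 0) (overlap_Re_lt0 zp zm zT)).
apply: (filterS _ nz) => w /= wz; apply/asboolPn => /Tone_Re_gt0.
by rewrite ltNge (ltW wz).
Qed.

End Arcs.

End GammaCocycles.

(** * Cochains concentrated in one bidegree *)

Section CochainConcentrated.
Context {R : realType} {Gam : nerve R}.
Hypothesis good : good_nerve Gam.
Variable A : coeff R.
Hypothesis sA : is_sheaf A.

Lemma tsection_cochain1 (u : gspace Gam 1 -> A) :
  (forall x, gdom x -> is_section u x) -> tsection 1 (cochain1 u).
Proof.
move=> su [|[|p]] // _ x dx.
by apply: iter_nearW => l z _; exact: (section0 (sheaf_on good sA 0)).
Qed.

Lemma gdiff_const (X : chartedSpace R) (u : X -> A) l x :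
  size l = 2 -> gdiff (A := A) (fun _ => u) l x = 0.
Proof. by move=> sl; rewrite gdiffE sl// big_ord_recl big_ord1 /= subrr. Qed.

(** On lists of length 2 the vertical differential of a cochain independent of the list is a
    difference of two equal terms. Only the groupoid coboundary remains. *)
Lemma tdiff_cochain1 (u : gspace Gam 1 -> A) p l x : (p <= 2)%N -> size l = (2 - p).+1 ->
  tdiff (cochain1 u) (p := p) l x =
  cochain2 (fun y => u (gface 0 y) - u (gface 1 y) + u (gface 2 y)) l x.
Proof.
case: p l x => [|[|[|p]]] l x // _ sl; rewrite /tdiff.
- by rewrite add0r /gdiff sl /= big1// => i _; rewrite sgn0.
- by rewrite gdiff_const// sgn0 addr0 hdiffS big1// => i _; rewrite sgn0.
- rewrite gdiff1 ?sl// sgn0 addr0 hdiffS !big_ord_recr big_ord0 /= add0r.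
  by rewrite /pull /sgn /=.
Qed.

Lemma cocycle_cochain1 (u : gspace Gam 1 -> A) :
  (forall x, gdom x -> is_section u x) ->
  (forall x : gspace Gam 2, gdom x -> u (gface 0 x) - u (gface 1 x) + u (gface 2 x) = 0) ->
  cocycle 1 (cochain1 u).
Proof.
move=> su du; apply/(cocycleP good); split; first exact: tsection_cochain1.
apply: (null_eq good (c := fun _ _ _ => 0)); last exact: (null0 good A).
move=> p l x p2 sl dx; rewrite tdiff_cochain1//.
by case: p l x p2 sl dx => [|[|[|p]]] l x // _ _ dx; rewrite /= du.
Qed.

(** Only p = 2, k = 1 contributes, with exponent (m - k)(p - k) = 0. The front arrow of a pair is
    its last face, and the back arrow its face 0. *)
Lemma zcup_cochain1 (u : gspace Gam 1 -> int) (v : gspace Gam 1 -> A) p l x :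
  (p <= 2)%N ->
  zcup 1 1 (cochain1 (A := sheafZ R) u) (cochain1 v) (p := p) l x =
  cochain2 (fun y => v (gface 0 y) *~ u (gface 2 y)) l x.
Proof.
case: p l x => [|[|[|p]]] l x // _; rewrite /zcup.
- by rewrite big_mkcond big_ord1 /= mulr0z sgn0.
- rewrite big_mkcond !big_ord_recr big_ord0 /= add0r.
  by rewrite mulr0z mul0rz !sgn0 addr0.
- rewrite big_mkcond !big_ord_recr big_ord0 /= add0r addr0 add0r.
  by rewrite subnn mul0n.
Qed.

End CochainConcentrated.

Section GammaGood.
Context {R : realType} (eps : R) (G M : chartedSpace R).
Context (mul : G -> G -> G) (one : G) (inv : G -> G) (act : G -> M -> M).
Hypothesis HG : is_lie_group mul one inv.
Hypothesis HM : is_manifold M.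
Hypothesis Hact : is_smooth_action mul one act.
Context (n : nat) (V : 'I_n -> set M).
Hypothesis HV : is_invariant_open_cover act V.
Hypothesis Heps : 0 < eps < pi / 2.

Let Gam := Gamma eps mul act V.

Lemma lie_smooth_charts : smooth_charts G.
Proof. by have [/manifold_smooth_charts] := HG. Qed.

Let hG := lie_smooth_charts.
Let hM := manifold_smooth_charts HM.

Lemma smooth_at_mul x : smooth_at (X := prod_space G G) (fun ab => mul ab.1 ab.2 : G) x.
Proof.
have [_ _ _ sm _] := HG.
exact: (smooth_map_at_smooth (smooth_charts_prod hG hG) hG (sm x)).
Qed.

Lemma smooth_at_act x : smooth_at (X := prod_space G M) (fun gx => act gx.1 gx.2 : M) x.
Proof.
have [_ _ sm] := Hact.
exact: (smooth_map_at_smooth (smooth_charts_prod hG hM) hM (sm x)).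
Qed.

Lemma smooth_charts_gamma p : smooth_charts (gamma_space G M n p).
Proof.
apply: smooth_charts_prod.
  by apply: smooth_charts_pow; exact: smooth_charts_discrete.
by apply: smooth_charts_prod; [exact: smooth_charts_pow|exact: smooth_charts_TM].
Qed.

Lemma gamma_dom_face p i (x : gamma_space G M n p.+1) :
  gamma_dom eps V x -> gamma_dom eps V (gamma_face mul act i x).
Proof.
move=> dx.
have dx' : all_pow (X := discrete_space R (cover_index n))
  (fun j : cover_index n => Ucover eps V j x.2.2) x.1 := dx.
apply: all_pow_mono (all_pow_delete i dx') => j.
have [_ _ Vinv] := HV.
have [e|[g e]] := action_face_base mul act i x.2; rewrite /= e//.
by move=> [Uj Vj]; split=> //; exact: Vinv.
Qed.

Lemma open_gamma_dom p : open (@gamma_dom R eps G M n V p).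
Proof.
apply: openS_nbhs => -[js gy] dx.
have nj := near_pow_discrete js.
have nU : \forall gy' \near gy, all_pow (X := discrete_space R (cover_index n))
    (fun j : cover_index n => Ucover eps V j gy'.2) js.
  apply: (@all_pow_near R (discrete_space R (cover_index n)) (prod_space (pow_space G p) (TM M))
    (fun (j : cover_index n) gy' => Ucover eps V j gy'.2) _ js gy) => [|//].
  move=> j [Uz Vx]; have [Vo _ _] := HV.
  have c2 : {for gy, continuous (fun gy' : prod_space (pow_space G p) (TM M) => gy'.2 : TM M)}.
    exact: cvg_snd.
  apply: (near_continuous c2).
  have nz : \forall z \near gy.2.1, if j.1 then Tminus eps z else Tplus eps z.
    by case: (j.1) Uz => Uz; apply: nbhs_open Uz; [exact: open_Tminus|exact: open_Tplus].
  exists ([set z | if j.1 then Tminus eps z else Tplus eps z], V j.2) => //=.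
  by split=> //; exact: nbhs_open.
by exists ([set js' | js' = js], [set gy' | all_pow (X := discrete_space R (cover_index n))
    (fun j : cover_index n => Ucover eps V j gy'.2) js]) => //= -[js' gy'] [/= ->].
Qed.

Lemma Gamma_good : good_nerve Gam.
Proof.
have [_ mulA _ _ _] := HG; have [_ actM _] := Hact.
split.
- exact: smooth_charts_gamma.
- exact: open_gamma_dom.
- move=> p i x; pose D := discrete_space R (cover_index n).
  have hD : smooth_charts D := @smooth_charts_discrete _ _.
  have hDp q := smooth_charts_pow q hD.
  have hP q := smooth_charts_prod (smooth_charts_pow q hG) (smooth_charts_TM hM).
  have s1 := smooth_at_comp (smooth_charts_gamma p.+1) (hDp p.+2)
    (smooth_at_fst x (hDp p.+2) (hP p.+1)) (@smooth_at_delete_nth _ D p.+1 i _ hD).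
  have s2 := smooth_at_comp (smooth_charts_gamma p.+1) (hP p.+1)
    (smooth_at_snd x (hDp p.+2) (hP p.+1))
    (@smooth_at_action_face _ _ _ _ _ hG hM smooth_at_mul smooth_at_act p i _).
  exact: (smooth_at_pair s1 s2).
- exact: gamma_dom_face.
- move=> p i j x ij.
  exact: (congr2 pair (delete_nthC (X := discrete_space R (cover_index n)) x.1 ij)
    (action_faceC mulA actM x.2 ij)).
Qed.

End GammaGood.

(** * Hilbert and Fock spaces *)

Section HilbertSpace.
Context {R : realType} {H : lmodType R[i]}.
Variable dot : {dot H for @Num.conj R[i]}.
Local Notation "''[' u , v ]" := (dot u v) : ring_scope.
Local Notation sq := (sqnorm dot).

Lemma dotDl u v w : '[u + v, w] = '[u, w] + '[v, w].
Proof. exact: linearDl. Qed.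

Lemma dotDr u v w : '[u, v + w] = '[u, v] + '[u, w].
Proof. exact: linearDr. Qed.

Lemma dotBr u v w : '[u, v - w] = '[u, v] - '[u, w].
Proof. exact: linearBr. Qed.

Lemma dotZl c v w : '[c *: v, w] = c * '[v, w].
Proof. exact: linearZl_LR. Qed.

Lemma dotZr c v w : '[v, c *: w] = c^* * '[v, w].
Proof. exact: linearZr_LR. Qed.

Lemma dot0l v : '[0, v] = 0.
Proof. exact: linear0l. Qed.

Lemma dot0r v : '[v, 0] = 0.
Proof. exact: linear0r. Qed.

Lemma dotC v w : '[v, w] = '[w, v]^*.
Proof. by rewrite hermC expr0 mul1r. Qed.

Lemma dot_sqnorm v : '[v, v] = Complex (sq v) 0.
Proof.
have := dnorm_ge0 dot v; rewrite /sqnorm; case: '[v, v] => a b.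
by rewrite lecE /= => /andP[/eqP -> _].
Qed.

Lemma sqnorm_ge0 v : 0 <= sq v.
Proof. by have := dnorm_ge0 dot v; rewrite dot_sqnorm lecE /= => /andP[_]. Qed.

Lemma sqnorm_eq0 v : sq v = 0 -> v = 0.
Proof. by move=> v0; apply/eqP; rewrite -(dnorm_eq0 dot) dot_sqnorm v0. Qed.

Lemma sqnorm0 : sq 0 = 0.
Proof. by rewrite /sqnorm linear0l. Qed.

Lemma sqnormN v : sq (- v) = sq v.
Proof. by rewrite /sqnorm hnormN. Qed.

(** The parallelogram law replaces the triangle inequality, so that all estimates stay with squared
    norms. The factor 2 is the origin of the bounds e / 4 below. *)
Lemma sqnormD_le v w : sq (v + w) <= 2 * (sq v + sq w).
Proof.
have e : sq (v + w) + sq (v - w) = 2 * (sq v + sq w).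
  suff : '[v + w, v + w] + '[v - w, v - w] = 2 * ('[v, v] + '[w, w]).
    rewrite !dot_sqnorm => /(congr1 (@complex.Re R)) /= ->.
    by rewrite mulrDl; ring.
  by rewrite (dnormD dot) (dnormB dot) /=; ring.
by rewrite -e lerDl sqnorm_ge0.
Qed.

Lemma sqnormB_le v w : sq (v - w) <= 2 * (sq v + sq w).
Proof. by rewrite -[sq w]sqnormN sqnormD_le. Qed.

Lemma sqnormZ (c : R[i]) v : sq (c *: v) = (complex.Re c ^+ 2 + complex.Im c ^+ 2) * sq v.
Proof.
rewrite {1}/sqnorm linearZl_LR linearZr_LR /= dot_sqnorm.
by case: c => a b /=; ring.
Qed.

Definition linear_map (T : H -> H) :=
  forall (c : R[i]) v w, T (c *: v + w) = c *: T v + T w.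

Lemma linear_map0 (T : H -> H) : linear_map T -> T 0 = 0.
Proof.
by move=> lT; have := lT (-1) 0 0; rewrite scaleN1r addr0 oppr0 scaleN1r addNr.
Qed.

Lemma linear_mapZ (T : H -> H) c v : linear_map T -> T (c *: v) = c *: T v.
Proof. by move=> lT; have := lT c v 0; rewrite addr0 linear_map0 ?addr0. Qed.

Lemma linear_mapB (T : H -> H) v w : linear_map T -> T (v - w) = T v - T w.
Proof. by move=> lT; have := lT (-1) w v; rewrite !scaleN1r addrC => ->; rewrite addrC. Qed.

Definition subspace (W : set H) : Prop :=
  W 0 /\ forall (c : R[i]) v w, W v -> W w -> W (c *: v + w).

Lemma subspace_sum (W : set H) n (c : 'I_n -> R[i]) (v : 'I_n -> H) :
  subspace W -> (forall i, W (v i)) -> W (\sum_(i < n) c i *: v i).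
Proof.
move=> [W0 WD] Wv; elim: n c v Wv => [|n IH] c v Wv; first by rewrite big_ord0.
by rewrite big_ord_recl; apply: WD => //; apply: IH => i; exact: Wv.
Qed.

Lemma lspan_subspace (A : set H) : subspace (lspan A).
Proof.
split; first by exists 0, (fun=> 0), (fun=> 0); split=> [[]//|]; rewrite big_ord0.
move=> c _ _ [m [a [v [Av ->]]]] [n [b [w [Aw ->]]]].
exists (m + n)%N, (fun i => match fintype.split i with inl j => c * a j | inr j => b j end),
  (fun i => match fintype.split i with inl j => v j | inr j => w j end).
split=> [i|]; first by case: (fintype.split i).
rewrite big_split_ord scaler_sumr; congr (_ + _); apply: eq_bigr => i _.
  by rewrite (unsplitK (inl i)) scalerA.
by rewrite (unsplitK (inr i)).
Qed.

Lemma sub_lspan (A : set H) : A `<=` lspan A.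
Proof.
move=> v Av; exists 1, (fun=> 1), (fun=> v); split=> //.
by rewrite big_ord1 scale1r.
Qed.

Lemma lspan_min (A W : set H) : subspace W -> A `<=` W -> lspan A `<=` W.
Proof. by move=> sW AW _ [n [c [v [Av ->]]]]; apply: subspace_sum => // i; exact: AW. Qed.

Lemma subspace_preimage (W : set H) (T : H -> H) :
  linear_map T -> subspace W -> subspace (T @^-1` W).
Proof.
move=> lT [W0 WD]; split; first by rewrite /= linear_map0.
by move=> c v w Wv Ww; rewrite /= lT; exact: WD.
Qed.

Lemma lspan_map (A B : set H) (T : H -> H) : linear_map T ->
  (forall v, A v -> lspan B (T v)) -> forall v, lspan A v -> lspan B (T v).
Proof.
move=> lT AB; apply: lspan_min => //; apply: subspace_preimage => //.
exact: lspan_subspace.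
Qed.

Lemma sub_nclosure (W : set H) : W `<=` nclosure dot W.
Proof. by move=> v Wv e e0; exists v => //; rewrite subrr sqnorm0. Qed.

Lemma nclosure_closed (W : set H) : nclosure dot (nclosure dot W) `<=` nclosure dot W.
Proof.
move=> v Wv e e0; have e4 : 0 < e / 4 by rewrite divr_gt0.
have [w Ww vw] := Wv _ e4; have [u Wu wu] := Ww _ e4.
exists u => //; apply: (@le_lt_trans _ _ (2 * (sq (v - w) + sq (w - u)))); last lra.
by rewrite -(subrKA w); exact: sqnormD_le.
Qed.

Lemma nclosure_subspace (W : set H) : subspace W -> subspace (nclosure dot W).
Proof.
move=> [W0 WD]; split; first exact: sub_nclosure.
move=> c v w Wv Ww e e0; set k := complex.Re c ^+ 2 + complex.Im c ^+ 2.
have k0 : 0 <= k by rewrite addr_ge0 ?sqr_ge0.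
have d0 : 0 < e / (4 * (k + 1)) by rewrite divr_gt0// mulr_gt0// ltr_wpDl.
have e4 : 0 < e / 4 by rewrite divr_gt0.
have [v' Wv' vv'] := Wv _ d0; have [w' Ww' ww'] := Ww _ e4.
exists (c *: v' + w'); first exact: WD.
have -> : c *: v + w - (c *: v' + w') = c *: (v - v') + (w - w').
  by rewrite scalerBr opprD addrACA.
apply: le_lt_trans (sqnormD_le _ _) _; rewrite sqnormZ -/k.
have kv : k * sq (v - v') <= e / 4.
  apply: (@le_trans _ _ ((k + 1) * (e / (4 * (k + 1))))).
    apply: ler_pM => //; [exact: sqnorm_ge0|by rewrite lerDl|exact: ltW].
  by rewrite le_eqVlt; apply/orP; left; apply/eqP; field; rewrite gt_eqF// ltr_wpDl.
lra.
Qed.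

Lemma nclosure_lspan_closed_subspace (A : set H) :
  closed_subspace dot (nclosure dot (lspan A)).
Proof.
have [W0 WD] := nclosure_subspace (lspan_subspace A).
by split=> //; exact: nclosure_closed.
Qed.

End HilbertSpace.

Section Operators.
Context {R : realType} {H : lmodType R[i]}.
Variable dot : {dot H for @Num.conj R[i]}.
Local Notation sq := (sqnorm dot).

Lemma nclosure_map (A W : set H) (T : H -> H) (C : R) : linear_map T ->
  (forall v, sq (T v) <= C * sq v) -> closed_subspace dot W ->
  (forall v, A v -> W (T v)) -> forall v, nclosure dot (lspan A) v -> W (T v).
Proof.
move=> lT bT [W0 WD Wcl] AW v cv; apply: Wcl => e e0.
have d0 : 0 < e / (`|C| + 1) by rewrite divr_gt0// ltr_wpDl.
have [w sw vw] := cv _ d0; exists (T w).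
  apply: (lspan_min (W := T @^-1` W) _ _ sw) => //.
  exact: subspace_preimage.
rewrite -linear_mapB//; apply: le_lt_trans (bT _) _.
apply: (@le_lt_trans _ _ ((`|C| + 1) * sq (v - w))).
  by rewrite ler_wpM2r ?sqnorm_ge0// (le_trans (ler_norm _))// lerDl.
by rewrite mulrC -ltr_pdivlMr// ltr_wpDl.
Qed.

(** If w in the span is close to v, then T1 v - T2 v = T1 (v - w) - T2 (v - w), whose squared norm
    is at most 4 times that of v - w. *)
Lemma isometry_eq_dense (A : set H) (T1 T2 : H -> H) : linear_map T1 -> linear_map T2 ->
  (forall v, sq (T1 v) = sq v) -> (forall v, sq (T2 v) = sq v) ->
  nclosure dot (lspan A) = setT -> (forall v, A v -> T1 v = T2 v) ->
  forall v, T1 v = T2 v.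
Proof.
move=> l1 l2 i1 i2 dA A12 v; apply/eqP; rewrite -subr_eq0; apply/eqP.
apply: (@sqnorm_eq0 _ _ dot); apply/eqP; rewrite eq_le sqnorm_ge0 andbT.
apply/ler_addgt0Pr => e e0; rewrite add0r.
have : nclosure dot (lspan A) v by rewrite dA.
have e4 : 0 < e / 4 by rewrite divr_gt0.
move=> /(_ _ e4)[w sw vw].
have e12 : T1 w = T2 w.
  have sE : subspace [set w | T1 w = T2 w].
    split=> [|c u u' /= e1 e2]; first by rewrite /= !linear_map0.
    by rewrite l1 l2 e1 e2.
  exact: (lspan_min sE A12 sw).
have -> : T1 v - T2 v = T1 (v - w) - T2 (v - w).
  by rewrite (linear_mapB v w l1) (linear_mapB v w l2) e12 opprB subrKA.
by apply: le_trans (sqnormB_le _ _ _) _; rewrite i1 i2; lra.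
Qed.

End Operators.

(** * Charge and density in the Fock space *)

Section FockAlgebra.
Context {R : realType} (F : fockSpace R).
Local Notation u := (basisH F).
Local Notation sq := (sqnorm (dotF F)).
Local Notation sqH := (sqnorm (dotH F)).

Lemma ann_linear_map (f : oneH F) : linear_map (ann f).
Proof. exact: ann_linear. Qed.

Lemma dotF_inj (v w : F) : (forall x, dotF F x v = dotF F x w) -> v = w.
Proof.
move=> e; apply/eqP; rewrite -subr_eq0 -(dnorm_eq0 (dotF F)) dotBr.
by rewrite e subrr.
Qed.

(** Creation operators are given only as adjoints of annihilation operators; their linearity and
    anticommutation are obtained by testing against all vectors. *)
Lemma cre_linear_map (f : oneH F) : linear_map (cre f).
Proof.
move=> c v w; apply: dotF_inj => x.
by rewrite -cre_adjoint !dotDr !dotZr -!cre_adjoint.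
Qed.

Lemma cre_linearl (c : R[i]) (f g : oneH F) (v : F) :
  cre (c *: f + g) v = c *: cre f v + cre g v.
Proof.
apply: dotF_inj => x; rewrite -cre_adjoint ann_antilinear dotDr dotDl dotZl dotZr.
by rewrite !cre_adjoint.
Qed.

Lemma car_cre2 (f g : oneH F) (v : F) : cre f (cre g v) + cre g (cre f v) = 0.
Proof.
apply: dotF_inj => x; rewrite dotDr -!cre_adjoint -dotDl.
by rewrite car_ann dot0l dot0r.
Qed.

(** Pairing the relation {a(f), a(f)*} = <f, f> with v. It bounds both operators, in v as well as in
    f. *)
Lemma ann_cre_sqnorm (f : oneH F) (v : F) : sq (ann f v) + sq (cre f v) = sqH f * sq v.
Proof.
have e : dotF F (ann f v) (ann f v) + dotF F (cre f v) (cre f v) =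
         (dotH F f f)^* * dotF F v v.
  have -> : dotF F (cre f v) (cre f v) = dotF F v (ann f (cre f v)).
    by rewrite [RHS]dotC cre_adjoint -dotC.
  by rewrite cre_adjoint -dotDr addrC car_cre dotZr.
move: e; rewrite !dot_sqnorm => /(congr1 (@complex.Re R)) /= ->.
by ring.
Qed.

Lemma ann_sqnorm_le (f : oneH F) (v : F) : sq (ann f v) <= sqH f * sq v.
Proof. by rewrite -ann_cre_sqnorm lerDl sqnorm_ge0. Qed.

Lemma cre_sqnorm_le (f : oneH F) (v : F) : sq (cre f v) <= sqH f * sq v.
Proof. by rewrite -ann_cre_sqnorm lerDr sqnorm_ge0. Qed.

Definition standard (q : int) : set F := [set v | exists ks ls : seq int,
  [/\ all (fun k : int => k < 0) ks, all (fun k : int => 0 <= k) ls,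
      q = (size ls)%:Z - (size ks)%:Z & v = monomial F ks ls]].

(* the algebraic part of the eigenspace of charge q *)
Definition charged (q : int) : set F := lspan (standard q).

Lemma charged_subspace q : subspace (charged q).
Proof. exact: lspan_subspace. Qed.

Lemma chargedB q v w : charged q v -> charged q w -> charged q (v - w).
Proof.
move=> cv cw; have [_ sub] := charged_subspace q.
by have := sub (-1) w v cw cv; rewrite scaleN1r addrC.
Qed.

Lemma chargedZB q (c : R[i]) v w : charged q v -> charged q w -> charged q (c *: v - w).
Proof.
move=> cv cw; have [_ sub] := charged_subspace q; have [sub0 _] := charged_subspace q.
by apply: chargedB => //; have := sub c v 0 cv sub0; rewrite addr0.
Qed.

Lemma chargedN q v : charged q v -> charged q (- v).
Proof. by move=> cv; rewrite -sub0r; apply: chargedB => //; exact: (charged_subspace q).1. Qed.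

Lemma charged_map q r (T : F -> F) : linear_map T ->
  (forall ks ls : seq int, all (fun k : int => k < 0) ks -> all (fun k : int => 0 <= k) ls ->
     q = (size ls)%:Z - (size ks)%:Z -> charged r (T (monomial F ks ls))) ->
  forall v, charged q v -> charged r (T v).
Proof.
move=> lT H; apply: lspan_map => // _ [ks [ls [hk hl hq ->]]].
by apply: (H ks ls).
Qed.

Lemma charged_monomial (ks ls : seq int) :
  all (fun k : int => k < 0) ks -> all (fun k : int => 0 <= k) ls ->
  charged ((size ls)%:Z - (size ks)%:Z) (monomial F ks ls).
Proof. by move=> hk hl; apply: sub_lspan; exists ks, ls. Qed.

Lemma ann_neg_charged (k : int) q v : k < 0 -> charged q v -> charged (q - 1) (ann (u k) v).
Proof.
move=> k0; apply: charged_map; first exact: ann_linear_map.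
move=> ks ls hk hl ->; have := @charged_monomial (k :: ks) ls.
rewrite /= k0 => /(_ hk hl); congr (charged _ _); lia.
Qed.

(** The anticommutation relation moves the creation operator past the annihilators of a monomial,
    each time leaving a term of the same total charge. Only monomials without annihilators remain to
    be treated. *)
Lemma cre_charged_of (l : int) :
  (forall ls : seq int, all (fun k : int => 0 <= k) ls ->
     charged ((size ls)%:Z + 1) (cre (u l) (monomial F [::] ls))) ->
  forall q v, charged q v -> charged (q + 1) (cre (u l) v).
Proof.
move=> H q v; apply: charged_map; first exact: cre_linear_map.
move=> ks ls + hl ->; elim: ks => [|k ks IH] /=; first by move=> _; rewrite subr0; exact: H.
move=> /andP[k0 hk]; have := car_cre (u k) (u l) (monomial F ks ls).
move=> /eqP; rewrite addrC eq_sym -subr_eq => /eqP <-.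
apply: chargedZB.
  by have := charged_monomial hk hl; congr (charged _ _); lia.
by have := ann_neg_charged k0 (IH hk); congr (charged _ _); lia.
Qed.

Lemma cre_ge0_charged (l : int) q v : 0 <= l -> charged q v -> charged (q + 1) (cre (u l) v).
Proof.
move=> l0; apply: cre_charged_of => ls hl; have := @charged_monomial [::] (l :: ls) isT.
by rewrite /= l0 => /(_ hl); congr (charged _ _); lia.
Qed.

Lemma basis_nclosure (P : set int) (k : int) : P k ->
  nclosure (dotH F) (lspan (u @` P)) (u k).
Proof. by move=> Pk; apply: sub_nclosure; apply: sub_lspan; exists k. Qed.

(** For l < 0 the result is not a standard monomial: the operator is moved through the other
    creation operators up to the vacuum, which it kills. *)
Lemma cre_charged (l : int) q v : charged q v -> charged (q + 1) (cre (u l) v).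
Proof.
have [l0|l0] := leP 0 l; first exact: cre_ge0_charged.
apply: cre_charged_of; elim=> [|l' ls IH] /=.
  rewrite cre_vacuum; first by move=> _; exact: (charged_subspace _).1.
  exact: (basis_nclosure (P := [set k : int | k < 0])).
move=> /andP[l'0 hl]; have := car_cre2 (u l) (u l') (monomial F [::] ls).
move=> /eqP; rewrite addr_eq0 => /eqP ->; apply: chargedN.
by have := cre_ge0_charged l'0 (IH hl); congr (charged _ _); lia.
Qed.

(** For k >= 0 the operator anticommutes with the annihilators, contracts with the creation
    operators, and finally kills the vacuum. *)
Lemma ann_charged (k : int) q v : charged q v -> charged (q - 1) (ann (u k) v).
Proof.
have [k0|k0] := ltP k 0; first exact: ann_neg_charged.
apply: charged_map; first exact: ann_linear_map.
move=> ks ls + + ->; elim: ks => [|k' ks IH] /=; last first.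
  move=> /andP[k'0 hk] hl; have := car_ann (u k) (u k') (monomial F ks ls).
  move=> /eqP; rewrite addr_eq0 => /eqP ->; apply: chargedN.
  by have := ann_neg_charged k'0 (IH hk hl); congr (charged _ _); lia.
move=> _; elim: ls => [|l ls IH] /=.
  rewrite ann_vacuum; first by move=> _; exact: (charged_subspace _).1.
  exact: (basis_nclosure (P := [set k : int | 0 <= k])).
move=> /andP[l0 hl]; have := car_cre (u k) (u l) (monomial F [::] ls).
move=> /eqP; rewrite eq_sym -subr_eq => /eqP <-; apply: chargedZB.
  by have := @charged_monomial [::] ls isT hl; rewrite /=; congr (charged _ _); lia.
by have := cre_ge0_charged l0 (IH hl); congr (charged _ _); lia.
Qed.

Definition monomials : set F := [set v | exists q, standard q v].

Lemma charged_monomials q : charged q `<=` lspan monomials.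
Proof.
apply: lspan_min; first exact: lspan_subspace.
by move=> v sv; apply: sub_lspan; exists q.
Qed.

(** The closed span is invariant under all a(f) and a*(f), and it contains the vacuum, so
    irreducibility makes it everything. *)
Lemma monomials_dense : nclosure (dotF F) (lspan monomials) = setT.
Proof.
set W := nclosure _ _; have Wcl : closed_subspace (dotF F) W.
  exact: nclosure_lspan_closed_subspace.
have [W0 WD Wc] := Wcl.
have sW w : lspan monomials w -> W w by exact: sub_nclosure.
have Wann k v : W v -> W (ann (u k) v).
  apply: (nclosure_map (ann_linear_map _) (ann_sqnorm_le _) Wcl) => w [q sw].
  by apply/sW/charged_monomials/ann_charged/sub_lspan/sw.
have Wcre k v : W v -> W (cre (u k) v).
  apply: (nclosure_map (cre_linear_map _) (cre_sqnorm_le _) Wcl) => w [q sw].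
  by apply/sW/charged_monomials/cre_charged/sub_lspan/sw.
have [_ bH] := basisHP F.
(* Invariance is known for basis vectors f. For fixed v the operators depend on f with the bound of
   [ann_cre_sqnorm], so it extends from their span to all f. *)
have approx (T : oneH F -> F -> F) v :
    (forall f g w, T (f - g) w = T f w - T g w) ->
    (forall f w, sq (T f w) <= sqH f * sq w) ->
    (forall f, lspan (range u) f -> W (T f v)) -> forall f, W (T f v).
  move=> TB Tle TW f; apply: Wc => e e0.
  have d0 : 0 < e / (sq v + 1) by rewrite divr_gt0// ltr_wpDl// sqnorm_ge0.
  have : nclosure (dotH F) (lspan (range u)) f by rewrite bH.
  move=> /(_ _ d0)[g sg fg]; exists (T g v); first exact: TW.
  rewrite -TB; apply: le_lt_trans (Tle _ _) _.
  apply: (@le_lt_trans _ _ (sqH (f - g) * (sq v + 1))).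
    by rewrite ler_wpM2l ?sqnorm_ge0// lerDl.
  by rewrite -ltr_pdivlMr// ltr_wpDl// sqnorm_ge0.
have [W00|//] : W = [set 0] \/ W = setT.
  apply: (fock_irreducible Wcl) => f v Wv; split.
    apply: (approx (fun f => ann f)) => [f' g w|f' w|f' [n [c [b [bu ->]]]]].
    - have := ann_antilinear (-1) g f' w.
      by rewrite rmorphN1 !scaleN1r addrC => ->; rewrite addrC.
    - exact: ann_sqnorm_le.
    - elim: n c b bu => [|n IH] c b bu.
        rewrite big_ord0; have := ann_antilinear (-1) 0 0 v.
        by rewrite rmorphN1 !scaleN1r addr0 oppr0 addNr => ->.
      rewrite big_ord_recl ann_antilinear; apply: WD; last exact: IH.
      by have [k _ <-] := bu ord0; exact: Wann.
  apply: (approx (fun f => cre f)) => [f' g w|f' w|f' [n [c [b [bu ->]]]]].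
  - have := cre_linearl (-1) g f' w.
    by rewrite !scaleN1r addrC => ->; rewrite addrC.
  - exact: cre_sqnorm_le.
  - elim: n c b bu => [|n IH] c b bu.
      rewrite big_ord0; have := cre_linearl (-1) 0 0 v.
      by rewrite !scaleN1r addr0 oppr0 addNr => ->.
    rewrite big_ord_recl cre_linearl; apply: WD; last exact: IH.
    by have [k _ <-] := bu ord0; exact: Wcre.
have : W (vacuum F) by apply/sW/(@charged_monomials 0)/(@charged_monomial [::] [::]).
rewrite W00 => /= vac0; have := vacuum_unit F; rewrite vac0 dot0l => /eqP.
by rewrite eq_sym oner_eq0.
Qed.

End FockAlgebra.

(** * The powers z^N and the shift *)

Section ChargePowers.
Context {R : realType} (F : fockSpace R).
Variables (Ndom : set F) (N : F -> F).
Hypothesis HN : is_charge Ndom N.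
Variable powN : circle R -> unitary (dotF F).
Hypothesis HpowN : is_charge_power Ndom N powN.
Variable S : unitary (dotF F).
Hypothesis HS : is_shift S.
Local Notation u := (basisH F).
Local Notation sq := (sqnorm (dotF F)).

Lemma unitary_sqnorm (T : unitary (dotF F)) v : sq (T v) = sq v.
Proof. by rewrite /sqnorm uop_isometry. Qed.

(** [N] is a bare function on a bare set. That eigenvectors form a subspace is read off from
    self-adjointness, whose right-hand condition is linear in the pair (v, w). *)
Lemma charged_eigen (q : int) v : charged q v -> Ndom v /\ N v = q%:~R *: v.
Proof.
have [adj mon] := HN; pose E := [set v : F | Ndom v /\ N v = q%:~R *: v].
have sE : subspace E.
  split.
    apply/(adj 0); move=> v' _; by rewrite scaler0 !dot0r.
  move=> c a b [Na ea] [Nb eb]; apply/(adj (c *: a + b)) => v' Nv'.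
  have ha := (adj a (q%:~R *: a)).1 (conj Na ea) v' Nv'.
  have hb := (adj b (q%:~R *: b)).1 (conj Nb eb) v' Nv'.
  rewrite scalerDr scalerA [_ * c]mulrC -scalerA.
  by rewrite dotDr dotZr ha hb [RHS]dotDr [X in _ = X + _]dotZr.
apply: (lspan_min sE) => _ [ks [ls [hk hl e ->]]].
by rewrite /E /= e; exact: mon.
Qed.

Lemma powN_charged z (q : int) v : charged q v -> powN z v = (val z) ^ q *: v.
Proof. by move=> /charged_eigen[]; exact: HpowN. Qed.

Lemma val_circle_neq0 (z : circle R) : val z != 0.
Proof. by rewrite -normr_eq0 (eqP (valP z)) oner_eq0. Qed.

(** On charge q this is z^q w^q = (zw)^q. Since [powN] is prescribed on eigenvectors only, the
    identity is extended by isometry from the dense span of monomials. *)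
Lemma powND z w v : powN z (powN w v) = powN (z + w) v.
Proof.
apply: (@isometry_eq_dense R F (dotF F) (@monomials R F) (fun v => powN z (powN w v))
  (powN (z + w))).
- by move=> c a b /=; rewrite !uop_linear.
- exact: uop_linear.
- by move=> a; rewrite !unitary_sqnorm.
- exact: unitary_sqnorm.
- exact: monomials_dense.
move=> a [q sa]; have ca : charged q a := sub_lspan sa.
rewrite !(powN_charged _ ca) (linear_mapZ _ _ (uop_linear _)) (powN_charged _ ca).
by rewrite scalerA mulrC val_add -expfzMl.
Qed.

(** S raises every index by one and puts a*(u_0) before the vacuum. An annihilator of index -1
    becomes one of index 0, so the image of a standard monomial need not be standard; hence the
    charge rules for operators of all indices. *)
Lemma shift_charged q v : charged q v -> charged (q + 1) (S v).
Proof.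
have [Svac Sann Scre] := HS.
apply: charged_map; first exact: uop_linear.
move=> ks ls _ _ ->; elim: ks => [|k ks IH] /=.
  elim: ls => [|l ls IH] /=.
    rewrite Svac; have := cre_charged 0 (charged_monomial F (ks := [::]) (ls := [::]) isT isT).
    exact.
  have := Scre l (S (monomial F [::] ls)); rewrite uopK => ->.
  by have := cre_charged (l + 1) IH; congr (charged _ _); rewrite /=; lia.
have := Sann k (S (monomial F ks ls)); rewrite uopK => ->.
by have := ann_charged (k + 1) IH; congr (charged _ _); rewrite /=; lia.
Qed.

(** On charge q both sides equal z^{q+1} S v, as S raises the charge by one; density does the
    rest. *)
Lemma powN_shift z v : powN z (S v) = val z *: S (powN z v).
Proof.
apply: (@isometry_eq_dense R F (dotF F) (@monomials R F) (fun v => powN z (S v))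
  (fun v => val z *: S (powN z v))).
- by move=> c a b /=; rewrite !uop_linear.
- by move=> c a b /=; rewrite !uop_linear scalerDr !scalerA [_ * c]mulrC.
- by move=> a; rewrite !unitary_sqnorm.
- move=> a; rewrite sqnormZ !unitary_sqnorm.
  by rewrite circle_norm mul1r.
- exact: monomials_dense.
move=> a [q sa]; have ca : charged q a := sub_lspan sa.
rewrite (powN_charged _ ca) (powN_charged _ (shift_charged ca)).
by rewrite (linear_mapZ _ _ (uop_linear _)) scalerA addrC expfzDr ?val_circle_neq0// expr1z.
Qed.

Lemma powN_unshift z v : powN z (uinv S v) = (val z)^-1 *: uinv S (powN z v).
Proof.
have := powN_shift z (uinv S v); rewrite uinvK => ->.
have -> : forall w, uinv S (val z *: S w) = val z *: w.
  by move=> w; apply: (can_inj (uopK S)); rewrite uinvK (linear_mapZ _ _ (uop_linear _)).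
by rewrite scalerA mulVf ?scale1r// val_circle_neq0.
Qed.

End ChargePowers.

(** * The cocycles of Gamma *)

Section ArrowCocycles.
Context {R : realType} (eps : R) (G M : chartedSpace R).
Context (mul : G -> G -> G) (one : G) (inv : G -> G) (act : G -> M -> M).
Hypothesis HG : is_lie_group mul one inv.
Hypothesis HM : is_manifold M.
Hypothesis Hact : is_smooth_action mul one act.
Context (n : nat) (V : 'I_n -> set M).
Hypothesis HV : is_invariant_open_cover act V.
Hypothesis Heps : 0 < eps < pi / 2.
Context (h : 'I_n -> 'I_n -> G -> M -> circle R).
Hypothesis Hh : is_line_bundle_cocycle mul act V h.

Local Notation Gam := (Gamma eps mul act V).
Local Notation arrow := (@arrow_fun R eps G M mul act n V _).
Local Notation afun := (@alpha_fun R eps G M n).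
Let good := Gamma_good eps HG HM Hact HV.
Let hG := lie_smooth_charts HG.
Let hM := manifold_smooth_charts HM.

Definition line_fun (j0 j1 : cover_index n) (g : G) (z : circle R) (x : M) : circle R :=
  h j0.2 j1.2 g x.

Definition shift_line_fun (j0 j1 : cover_index n) (g : G) (z : circle R) (x : M) : circle R :=
  if `[< Tone eps z >] && (j0.1 && ~~ j1.1) then h j0.2 j1.2 g x else 0.

(** Membership in [Tone] is locally constant only where z lies in both arcs, that is, when the two
    indices are on different sides. For indices on the same side it may jump, but alpha and
    [shift_line_fun] vanish there. *)
Lemma near_arrow (y : gspace Gam 1) : gdom y ->
  \forall y' \near y, y'.1 = y.1 /\
    ((y.1.1 : cover_index n).1 != (y.1.2.1 : cover_index n).1 ->
     `[< Tone eps y'.2.2.1 >] = `[< Tone eps y.2.2.1 >]).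
Proof.
case: y => -[j0 [j1 []]] [[g []] [z x]] /= [[/= z0 _] [[/= z1 _] _]].
pose D := pow_space (discrete_space R (cover_index n)) 2.
pose y : gspace Gam 1 := ((j0, (j1, tt)), ((g, tt), (z, x))).
have n1 : \forall y' \near y, y'.1 = y.1.
  have c1 : {for y, continuous (fun y' : gspace Gam 1 => y'.1 : D)} by exact: cvg_fst.
  exact: (near_continuous c1 (near_pow_discrete (y.1 : D))).
have n2 : (j0 : cover_index n).1 != (j1 : cover_index n).1 ->
    \forall y' \near y, `[< Tone eps y'.2.2.1 >] = `[< Tone eps z >].
  move=> j01; have [zp zm] : Tplus eps z /\ Tminus eps z.
    by case: (j0) (j1) z0 z1 j01 => -[] ? [[] ?] /=.
  have c2 : {for y, continuous (fun y' : gspace Gam 1 => y'.2 : prod_space (pow_space G 1) (TM M))}.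
    exact: cvg_snd.
  have c3 : {for y.2, continuous (fun y' : prod_space (pow_space G 1) (TM M) => y'.2 : TM M)}.
    exact: cvg_snd.
  have c4 : {for y.2.2, continuous (fun y' : TM M => y'.1 : circle R)} by exact: cvg_fst.
  exact: (near_continuous c2 (near_continuous c3 (near_continuous c4 (Tone_locally Heps zp zm)))).
have [e|j01] := boolP ((j0 : cover_index n).1 == (j1 : cover_index n).1).
  by apply: (filterS _ n1) => y' ->.
by apply: (filterS _ (filterI n1 (n2 j01))) => y' [].
Qed.

Lemma alpha_section (y : gspace Gam 1) : gdom y ->
  @is_section R (sheafZ R) (gspace Gam 1) (arrow afun) y.
Proof.
move=> /near_arrow; apply: filterS => y' [e eT].
rewrite /arrow_fun /alpha_fun e.
case: y e eT => -[[b0 i0] [[b1 i1] []]] [[g []] [z x]] /= _.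
by case: b0 b1 => -[] /= => [_|/(_ isT)->|/(_ isT)->|_] //; rewrite !if_same.
Qed.

Lemma gdom_arrow (y : gspace Gam 1) : gdom y ->
  V (y.1.1 : cover_index n).2 y.2.2.2 /\ V (y.1.2.1 : cover_index n).2 y.2.2.2.
Proof. by move=> [[_ ?] [[_ ?] _]]. Qed.

Lemma line_section (y : gspace Gam 1) : gdom y ->
  @is_section R (sheafT R) (gspace Gam 1) (arrow line_fun) y.
Proof.
move=> dy; have [V0 V1] := gdom_arrow dy.
have hT := smooth_charts_TM hM; have hC := @smooth_charts_circle R.
have hp := smooth_charts_pow 1 hG; have hpT := smooth_charts_prod hp hT.
have hD : smooth_charts (pow_space (discrete_space R (cover_index n)) 2).
  by apply: smooth_charts_pow; exact: smooth_charts_discrete.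
have hY : smooth_charts (gspace Gam 1) := smooth_charts_prod hD hpT.
have s2 : smooth_at (X := gspace Gam 1) (fun y => y.2) y := smooth_at_snd y hD hpT.
have s21 := smooth_at_fst_comp hp hT hY s2; have s22 := smooth_at_snd_comp hp hT hY s2.
have sg := smooth_at_fst_comp hG (smooth_charts_pow 0 hG) hY s21.
have sx := smooth_at_snd_comp hC hM hY s22.
have := sheafT_is_sheaf.2 _ _ _ _ _ hY (smooth_charts_prod hG hM) (smooth_at_pair sg sx)
  (Hh.1 _ _ y.2.1.1 _ V0 V1).
have [_ eqs _ _] := sheafT_is_sheaf.1 _ hY; apply: eqs.
by apply: (filterS _ (near_arrow dy)) => y' [e _]; rewrite /arrow_fun e.
Qed.

Lemma shift_line_section (y : gspace Gam 1) : gdom y ->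
  @is_section R (sheafT R) (gspace Gam 1) (arrow shift_line_fun) y.
Proof.
move=> dy; have [_ eqs s0 _] := sheafT_is_sheaf.1 _ (charts good 1).
pose b (y : gspace Gam 1) := `[< Tone eps y.2.2.1 >] &&
  ((y.1.1 : cover_index n).1 && ~~ (y.1.2.1 : cover_index n).1).
have nb : \forall y' \near y, b y' = b y.
  apply: (filterS _ (near_arrow dy)) => y' [e]; rewrite /b e.
  case: y {dy b e} => -[[b0 i0] [[b1 i1] []]] [[g []] [z x]] /=.
  by case: b0 b1 => -[] /= => [_|/(_ isT)->|/(_ isT)->|_] //; rewrite !andbF.
case: (boolP (b y)) => by_.
  apply: eqs (line_section dy); apply: (filterS _ nb) => y' e.
  by rewrite /arrow_fun /shift_line_fun -/(b y') e by_.
apply: eqs (s0 y); apply: (filterS _ nb) => y' e.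
by rewrite /arrow_fun /shift_line_fun -/(b y') e (negPf by_).
Qed.

Lemma line_fun_cocycle (x : gspace Gam 2) : gdom x ->
  let u := arrow line_fun in
  u (gface 0 x) - u (gface 1 x) + u (gface 2 x) = 0.
Proof.
case: x => -[i [j [k []]]] [[a [b []]] [z m]] /= [[_ Vi] [[_ Vj] [[_ Vk] _]]].
rewrite /arrow_fun /line_fun /=.
have -> : h (i : cover_index n).2 (k : cover_index n).2 (mul a b) m =
  h (i : cover_index n).2 (j : cover_index n).2 a (act b m) +
  h (j : cover_index n).2 (k : cover_index n).2 b m.
  by apply: val_inj; rewrite val_add; apply/esym; exact: Hh.2.
by rewrite [X in _ - X]addrC opprD addrA subrr add0r addNr.
Qed.

(** Over the component of 1, alpha is the difference of the side indicators of its two indices, so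
    its coboundary telescopes. *)
Lemma alpha_fun_cocycle (x : gspace Gam 2) :
  let u := arrow afun in
  u (gface 0 x) - u (gface 1 x) + u (gface 2 x) = 0.
Proof.
case: x => -[i [j [k []]]] [[a [b []]] [z m]] /=.
rewrite /arrow_fun /alpha_fun /=; case: `[<_>] => //=.
by case: (i : cover_index n) (j : cover_index n) (k : cover_index n) => -[] ? [[] ?] [[] ?] /=.
Qed.

Lemma alpha_cocycle : cocycle 1 (alpha eps mul act V).
Proof.
apply: (cocycle_cochain1 good (@sheafZ_is_sheaf R)); first exact: alpha_section.
by move=> x _; exact: alpha_fun_cocycle.
Qed.

Lemma line_cocycle : cocycle 1 (line_cochain eps mul act V h).
Proof.
by apply: (cocycle_cochain1 good (@sheafT_is_sheaf R)); [exact: line_section|exact: line_fun_cocycle].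
Qed.

End ArrowCocycles.

(** * The connecting map on a cup product with an integral class *)

Section ConnectingCup.
Context {R : realType} {Gam : nerve R}.
Hypothesis good : good_nerve Gam.

Lemma connecting_zcup n (a : cochain Gam (sheafZ R)) (c f : cochain Gam (sheafT R)) :
  cocycle 1 a -> cocycle n.+1 c -> tsection n.+2 f ->
  cohomologous n.+2 f (fun p l x => - zcup 1 n.+1 a c l x) ->
  [/\ cohomology Gam (sheafT R) n.+2 (cclass n.+2 f),
      cohomology Gam (sheafZ R) n.+3
        (cup 1 n.+2 (cclass 1 a) (connecting n.+1 (cclass n.+1 c))) &
      connecting n.+2 (cclass n.+2 f) =
        cup 1 n.+2 (cclass 1 a) (connecting n.+1 (cclass n.+1 c))].
Proof.
move=> ca cc sf fac; have sT := @sheafT_is_sheaf R; have sR := @sheafR_is_sheaf R.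
have ta := ((cocycleP good 1 a).1 ca).1.
have [r [d [tr tec rc td dr]]] := exists_connecting good cc.
have [cd ->] := connecting_cclass good cc td tr tec (cohomologous_null good sT rc) dr.
have cad := zcup_cocycle good (@sheafZ_is_sheaf R) ca cd.
rewrite (cup_cclass good ca cd) tcupE.
have cf : cocycle n.+2 f.
  have caN : cocycle n.+2 (fun p l x => - zcup 1 n.+1 a c (p := p) l x).
    have := zcup_cocycle good sT ca cc; move=> /(cocycleP good)[t0 n0].
    apply/(cocycleP good); split; first exact: (tsectionN good sT).
    apply: (null_eq good (c := fun p l x => - tdiff (zcup 1 n.+1 a c) (p := p) l x)).
      by move=> p l x _ _ _; rewrite tdiffN.
    exact: nullN.
  exact: (cocycle_cohomologous good sT sf (cohomologous_sym good sT fac) caN).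
pose r' : cochain Gam (sheafR R) := fun p l x => - zcup 1 n.+1 a r (p := p) l x.
(* As [expi] is additive it commutes with integer multiples, so this holds exactly; replacing
   [expi r] by c then costs only a null cochain. *)
have er' : cochainRT r' =
    (fun p l x => - zcup 1 n.+1 a (cochainRT r) (p := p) l x) :> cochain Gam (sheafT R).
  apply: functional_extensionality_dep => p; apply/funext => l; apply/funext => x.
  by rewrite /cochainRT /r' expiN -(zcup_morph (A := sheafR R) (B := sheafT R) _ _ _ _ _ _ (@expiBr R)).
have tr' : tsection n.+2 r' := (tsectionN good sR (tsection_zcupZ good sR ta tr)).
have ter' : tsection n.+2 (cochainRT r').
  by rewrite er'; exact: (tsectionN good sT (tsection_zcupZ good sT ta tec)).
have rf : cohomologous n.+2 (cochainRT r') f.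
  apply: (cohomologous_trans good sT _ (cohomologous_sym good sT fac)).
  apply: (cohomologous_null good sT); rewrite er'.
  apply: (null_eq good (c := fun p l x =>
    - zcup 1 n.+1 a (fun p l x => expi (r p l x) - c p l x : sheafT R) (p := p) l x)).
    by move=> p l x _ _ _; rewrite zcupBr opprB opprK addrC.
  exact: (nullN good (null_zcupr good (m := 1) a rc)).
have [|_ ->] := connecting_cclass good cf ((cocycleP good _ _).1 cad).1 tr' ter' rf.
  have h1 := tdiff_zcup_cocyclel good (n := n.+1) r ca.
  have h2 := null_zcupr good (m := 1) a dr.
  apply: (null_eq good _ (nullD good (nullN good h1) h2)) => p l x _ _ _.
  rewrite tdiffN zcupBr.
  have -> : zcup 1 n.+2 a (fun p l x => (d p l x)%:~R * (2 * pi) : sheafR R) (p := p) l x =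
     (zcup 1 n.+2 a d (p := p) l x)%:~R * (2 * pi).
    by apply: (@zcup_morph _ _ (sheafZ R) (sheafR R) 1 n.+2 (fun k : int => k%:~R * (2 * pi))) => u v;
      rewrite intrB mulrBl.
  rewrite /sgn /=; lra.
by split=> //; [exists f|exists (zcup 1 n.+2 a d)].
Qed.

End ConnectingCup.

(** * The Dixmier-Douady cocycle *)

Section FockBundleClass.
Context {R : realType} (eps : R) (G M : chartedSpace R).
Context (mul : G -> G -> G) (one : G) (inv : G -> G) (act : G -> M -> M).
Hypothesis HG : is_lie_group mul one inv.
Hypothesis HM : is_manifold M.
Hypothesis Hact : is_smooth_action mul one act.
Context (n : nat) (V : 'I_n -> set M).
Hypothesis HV : is_invariant_open_cover act V.
Hypothesis Heps : 0 < eps < pi / 2.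
Context (h : 'I_n -> 'I_n -> G -> M -> circle R).
Hypothesis Hh : is_line_bundle_cocycle mul act V h.
Context (F : fockSpace R) (Ndom : set F) (N : F -> F).
Hypothesis HN : is_charge Ndom N.
Context (powN : circle R -> unitary (dotF F)).
Hypothesis HpowN : is_charge_power Ndom N powN.
Context (S : unitary (dotF F)).
Hypothesis HS : is_shift S.

Local Notation Gam := (Gamma eps mul act V).
Local Notation arrow := (@arrow_fun R eps G M mul act n V _).
Local Notation afun := (@alpha_fun R eps G M n).
Local Notation line := (arrow (line_fun h)).
Local Notation shift_line := (arrow (shift_line_fun eps h)).
Let good := Gamma_good eps HG HM Hact HV.
Let sT := @sheafT_is_sheaf R.

(* The cochain - (alpha cup h) + d(shift_line): the coboundary accounts for the
   placement of S^-1 to the left of z^N in the lifts. *)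
Definition DD_fun (y : gspace Gam 2) : circle R :=
  - (line (gface 0 y) *~ arrow afun (gface 2 y)) +
  (shift_line (gface 0 y) - shift_line (gface 1 y) + shift_line (gface 2 y)).

(** With p = h_ij and q = h_jk the cocycle relation makes the third power (pq)^N, so the powers
    cancel and only the passage of S or S^-1 across a power leaves a scalar. Away from the component
    of 1 no S occurs; over it there are eight cases for the sides of i, j, k. *)
Lemma DD_fun_is_DD_cocycle : is_DD_cocycle h powN S DD_fun.
Proof.
move=> i j k a b z x y [[_ Vi] [[_ Vj] [[_ Vk] _]]] v.
rewrite /DD_fun /arrow_fun /line_fun /alpha_fun /shift_line_fun /ghat /=.
have -> : h i.2 k.2 (mul a b) x = h i.2 j.2 a (act b x) + h j.2 k.2 b x.
  by apply: val_inj; rewrite val_add; apply/esym; exact: Hh.2.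
move: (h i.2 j.2 a (act b x)) (h j.2 k.2 b x) => p q.
have p0 := val_circle_neq0 p; have q0 := val_circle_neq0 q.
have PQ w : powN p (powN q w) = powN (p + q) w := powND HN HpowN p q w.
case: `[< Tone eps z >] => /=; last first.
  by rewrite PQ uinvK !(mulr1, invr1, divr1) scale1r.
have [UZ SZ] : linear_map (uinv S) /\ linear_map S.
  by split; [exact: (uop_linear (uinverse S))|exact: uop_linear].
case: (i.1) (j.1) (k.1) => -[] [] /=; rewrite ?(mulr0z, mulr1z, mulrN1z) /=.
- by rewrite PQ uinvK !(mulr1, invr1, divr1) scale1r.
(* i, j > n >= k: p^N passes S^-1, which leaves p^-1. The alpha term is trivial and the scalar comes
   from the coboundary alone. *)
- rewrite (powN_unshift HN HpowN HS) PQ uinvK uopK; congr (_ *: _).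
  by rewrite invr1 mul1r mulr1 invfM mulrA mulrAC divff// mul1r.
(* i, k > n >= j: S^-1 p^N q^N S leaves pq, with q from the alpha term and p from the coboundary. *)
- rewrite (powN_shift HN HpowN HS) (linear_mapZ _ _ (uop_linear _)) (powN_shift HN HpowN HS).
  rewrite PQ uinvK !(linear_mapZ _ _ UZ) uopK scalerA; congr (_ *: _).
  by rewrite invrK invr1 mulr1 mul1r mulr1n.
- rewrite PQ uinvK uopK -[LHS]scale1r; congr (_ *: _).
  by rewrite mulr1n invrK mul1r invfM [_^-1 * _ * _]mulrAC mulVf// mul1r divff.
(* j, k > n >= i: moving S past q^N leaves q^-1, which is the alpha term; the coboundary is
   trivial. *)
- rewrite (powN_unshift HN HpowN HS) (linear_mapZ _ _ SZ) uinvK.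
  rewrite (linear_mapZ _ _ (uop_linear _)) PQ uinvK; congr (_ *: _).
  by rewrite divr1 !mulr1.
- rewrite uinvK PQ uinvK -[LHS]scale1r; congr (_ *: _).
  by rewrite invr1 !mulr1 mulVf.
- by rewrite uinvK PQ uinvK !(mulr1, invr1, divr1) scale1r.
- by rewrite PQ uinvK !(mulr1, invr1, divr1) scale1r.
Qed.

(** The scalar is recovered by pairing with the vacuum, a unit vector. Hence all choices of f agree
    on [gdom] and define the same class. *)
Lemma is_DD_cocycle_unique (f f' : gspace Gam 2 -> circle R) y :
  is_DD_cocycle h powN S f -> is_DD_cocycle h powN S f' -> gdom y -> f y = f' y.
Proof.
case: y => -[i [j [k []]]] [[a [b []]] [z x]] Hf Hf' dy.
have := Hf i j k a b z x dy (vacuum F); rewrite (Hf' i j k a b z x dy (vacuum F)).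
move=> /(congr1 (fun v => dotF F v (vacuum F))); rewrite !dotZl vacuum_unit !mulr1.
by move=> e; apply/esym/val_inj.
Qed.

Lemma DD_classE : DD_class eps mul act V h powN S = cclass 2 (cochain2 (A := sheafT R) DD_fun).
Proof.
apply/seteqP; split=> [c [f Hf]|c cc]; last by exists DD_fun => //; exact: DD_fun_is_DD_cocycle.
rewrite (_ : cclass 2 (cochain2 (A := sheafT R) f) = cclass 2 (cochain2 (A := sheafT R) DD_fun))//.
apply: (cclass_eq good sT); apply: (cohomologous_null good sT).
apply: (null_eq good (c := fun _ _ _ => 0)); last exact: (null0 good (sheafT R)).
case=> [|[|[|p]]] l x // _ _ dx; rewrite /= ?subr0//.
by rewrite (is_DD_cocycle_unique Hf DD_fun_is_DD_cocycle dx) subrr.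
Qed.

Lemma DD_fun_eq p l x : (p <= 2)%N -> size l = (2 - p).+1 ->
  cochain2 (A := sheafT R) DD_fun (p := p) l x =
  - zcup 1 1 (alpha eps mul act V) (line_cochain eps mul act V h) (p := p) l x +
  tdiff (cochain1 (A := sheafT R) shift_line) (p := p) l x.
Proof.
move=> p2 sl; rewrite tdiff_cochain1// zcup_cochain1//.
by case: p p2 l x sl => [|[|[|p]]] p2 l x sl //; rewrite /= oppr0 addr0.
Qed.

(** [is_DD_cocycle] is a pointwise condition. Smoothness is read off from the formula, whose
    ingredients are sections. *)
Lemma DD_fun_section : tsection 2 (cochain2 (A := sheafT R) DD_fun).
Proof.
have tu := tsection_cochain1 good sT (shift_line_section HG HM Hact HV Heps Hh).
have [tz _] := (cocycleP good _ _).1 (zcup_cocycle good sT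
  (alpha_cocycle HG HM Hact HV Heps) (line_cocycle HG HM Hact HV Heps Hh)).
apply: (tsection_eq good sT _ (tsectionD good sT (tsectionN good sT tz) (tsection_tdiff good sT tu))).
by move=> p l x p2 sl _; rewrite DD_fun_eq.
Qed.

Lemma DD_fun_cohomologous :
  cohomologous 2 (cochain2 (A := sheafT R) DD_fun)
    (fun p l x => - zcup 1 1 (alpha eps mul act V) (line_cochain eps mul act V h) l x).
Proof.
apply/cohomologousP; exists (cochain1 (A := sheafT R) shift_line).
  exact: (tsection_cochain1 good sT (shift_line_section HG HM Hact HV Heps Hh)).
apply: (null_eq good (c := fun _ _ _ => 0)); last exact: (null0 good (sheafT R)).
by move=> p l x p2 sl _; rewrite DD_fun_eq// opprK addrAC addrK addNr.
Qed.

End FockBundleClass.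
Theorem mainTheorem6 (R : realType)
  (* the compact Lie group G acting on the compact manifold M *)
  (G M : chartedSpace R) (mul : G -> G -> G) (one : G) (inv : G -> G)
  (act : G -> M -> M)
  (HG : is_lie_group mul one inv) (HGc : compact [set: G])
  (HM : is_manifold M) (HMc : compact [set: M])
  (Hact : is_smooth_action mul one act)
  (* the cover, and the arcs of the circle *)
  (n : nat) (V : 'I_n -> set M)
  (HV : is_invariant_open_cover act V)
  (HVacyclic : has_acyclic_intersections V)
  (eps : R) (Heps : 0 < eps < pi / 2)
  (* the equivariant line bundle *)
  (h : 'I_n -> 'I_n -> G -> M -> circle R)
  (Hh : is_line_bundle_cocycle mul act V h)
  (* the Fock space, the charge operator and the shift *)
  (F : fockSpace R)
  (Ndom : set F) (N : F -> F) (HN : is_charge Ndom N)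
  (powN : circle R -> unitary (dotF F)) (HpowN : is_charge_power Ndom N powN)
  (S : unitary (dotF F)) (HS : is_shift S) :
  let Gam := Gamma eps mul act V in
  let alpha_class := cclass 1 (alpha eps mul act V) in
  let beta_G := connecting 1 (cclass 1 (line_cochain eps mul act V h)) in
  let DD := DD_class eps mul act V h powN S in
  [/\ cohomology Gam (sheafT R) 2 DD,
      cohomology Gam (sheafZ R) 3 (cup 1 2 alpha_class beta_G) &
      connecting 2 DD = cup 1 2 alpha_class beta_G].

Proof.
move=> Gam alpha_class beta_G DD.
have good := Gamma_good eps HG HM Hact HV.
rewrite /DD (DD_classE eps HG HM Hact HV Hh HN HpowN HS).
exact: (connecting_zcup good (alpha_cocycle HG HM Hact HV Heps)
  (line_cocycle HG HM Hact HV Heps Hh) (DD_fun_section HG HM Hact HV Heps Hh)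
  (DD_fun_cohomologous HG HM Hact HV Heps Hh)).
Qed.
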